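(* Algebras over the terminal $\mathtt{ggGrc}$-operad $\mathsf 1_{\mathtt{ggGrc}}$ are modular operads; that is, the category of $\mathsf 1_{\mathtt{ggGrc}}$-algebras in graded vector spaces is equivalent to the category of modular operads.
   Context: $\Bbbk$ is a field of characteristic $0$; everything takes values in graded $\Bbbk$-vector spaces, with Koszul signs. **The operadic category $\mathtt O=\mathtt{ggGrc}$.** An ordered graph $\Gamma$ has vertices $V=\{1,\dots,n\}$, $n\ge1$, a finite set $\mathrm{Fl}$ of half-edges, a map $g:\mathrm{Fl}\to V$, an involution $\sigma$ of $\mathrm{Fl}$, a linear order on each $g^{-1}(v)$ (local orders) and a linear order on the set of fixed points of $\sigma$, called legs (global order); half-edges are taken to be $\{1,\dots,m\}$, ordered first by vertex and then locally. Two-element orbits of $\sigma$ are internal edges and $e(\Gamma)$ is their number. Objects of $\mathtt{ggGrc}$ are connected ordered graphs with a genus $g(v)\in\mathbb N$ for each vertex; the genus of $\Gamma$ is $\sum_vg(v)+b_1(\Gamma)$. A morphism $\Gamma'\to\Gamma''$ is a pair $(\psi,\varphi)$: an injection $\psi:\mathrm{Fl}''\to\mathrm{Fl}'$ commuting with involutions and restricting to a bijection of legs preserving the global orders, and a surjection $\varphi:V'\to V''$ with $\varphi g'\psi=g''$, such that if $h\notin\mathrm{Im}\,\psi$ then $\varphi g'(h)=\varphi g'(\sigma'h)$, all fibers are connected, and the genus of each $v\in V''$ equals the genus of the fiber over $v$. The fiber over $v$ has vertices $\varphi^{-1}(v)$ (renumbered order-preservingly), half-edges $h\in\mathrm{Fl}'$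 with $\varphi g'(h)=v$, involution $h\mapsto\sigma'(h)$ if $h\notin\mathrm{Im}\,\psi$ and $h\mapsto h$ if $h\in\mathrm{Im}\,\psi$, inherited local orders and vertex genera, and global order transported along $\psi$ from the local order at $v$. Put $|\Gamma|=V$, $|(\psi,\varphi)|=\varphi$; induced maps between fibers are restrictions. Local terminal objects (terminal in their connected component) are the one-vertex graphs without internal edges; the trivial (chosen local terminal) ones, $U$, are those whose local and global orders agree. The set $\pi_0(\mathtt{ggGrc})$ of connected components is $\mathbb N\times\mathbb N$ (number of legs, genus). $\phi:T\to S$ with $|\phi|$ order-preserving is elementary (at $i\in|S|$) if all its fibers are trivial except $F=\phi^{-1}(i)$, and $e(F)\ge1$; notation $F\triangleright_iT\xrightarrow{\phi}S$. **The terminal operad and its algebras.** $\mathsf 1_{\mathtt{ggGrc}}(T)=\Bbbk$ for all $T$, with all presheaf actions of isomorphisms, compositions $\circ_\phi:\Bbbk\otimes\Bbbk\to\Bbbk$ for elementary $\phi$, and units $\eta_U:\Bbbk\to\Bbbk$ the canonical identifications. For $T\in\mathtt O$ let $s_i(T)=\mathrm{id}_T^{-1}(i)$, and let $\pi_0(T)$ be the connected component of $T$. A $\mathsf 1_{\mathtt{ggGrc}}$-algebra is a family $A=(A_c)_{c\in\pi_0(\mathtt O)}$ of graded vector spaces with degree $0$ maps $\alpha_T:A_{\pi_0(s_1(T))}\otimes\cdots\otimes A_{\pi_0(s_n(T))}\to A_{\pi_0(T)}$, $n=|T|$, for all $T$, such that: (1) $\alpha_U=\mathrm{id}$ for trivial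 $U$; (2) for $F\triangleright_iT\xrightarrow{\phi}S$, $\alpha_T$ equals $\alpha_S$ precomposed with $\alpha_F$ applied to the consecutive factors indexed by $|\phi|^{-1}(i)$; (3) for an isomorphism $\omega:T\to S$, $\alpha_T(a_1\otimes\cdots\otimes a_n)=\pm\alpha_S(b_1\otimes\cdots\otimes b_n)$ with $b_j=\alpha_{\omega^{-1}(j)}(a_k)$, $k=|\omega|^{-1}(j)$, $\pm$ the Koszul sign of the permutation. **Modular operads.** A modular operad is a functor $\mathcal M$ from (finite sets and bijections)$\times$(discrete category $\mathbb N$) to graded vector spaces with degree $0$ maps ${}_a\circ_b:\mathcal M(S_1\sqcup\{a\};g_1)\otimes\mathcal M(S_2\sqcup\{b\};g_2)\to\mathcal M(S_1\sqcup S_2;g_1+g_2)$ and $\circ_{uv}=\circ_{vu}:\mathcal M(S\sqcup\{u\}\sqcup\{v\};g)\to\mathcal M(S;g+1)$, natural with respect to bijections of the finite sets, such that (with $\tau$ the symmetry) ${}_a\circ_b={}_b\circ_a\tau$; ${}_a\circ_b(\mathrm{id}\otimes{}_c\circ_d)={}_c\circ_d({}_a\circ_b\otimes\mathrm{id})$ on $\mathcal M(S_1\sqcup\{a\};g_1)\otimes\mathcal M(S_2\sqcup\{b\}\sqcup\{c\};g_2)\otimes\mathcal M(S_3\sqcup\{d\};g_3)$; $\circ_{ab}\circ_{cd}=\circ_{cd}\circ_{ab}$ on $\mathcal M(S\sqcup\{a,b,c,d\};g)$; $\circ_{ab}\,{}_c\circ_d=\circ_{cd}\,{}_a\circ_b$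 on $\mathcal M(S_1\sqcup\{a,c\};g_1)\otimes\mathcal M(S_2\sqcup\{b,d\};g_2)$; ${}_a\circ_b(\circ_{uv}\otimes\mathrm{id})=\circ_{uv}\,{}_a\circ_b$ on $\mathcal M(S_1\sqcup\{a,u,v\};g_1)\otimes\mathcal M(S_2\sqcup\{b\};g_2)$. *)

(* Defs.v *)
From HB Require Import structures.
From mathcomp Require Import all_boot all_order all_algebra.
From mathcomp Require Import boolp.

Set Implicit Arguments.
Unset Strict Implicit.
Unset Printing Implicit Defensive.

Import GRing.Theory.
Local Open Scope ring_scope.

(** * Categories, functors, equivalences *)

Record category := Category {
  ob :> Type;
  hom : ob -> ob -> Type;
  idm : forall x, hom x x;
  compm : forall x y z, hom y z -> hom x y -> hom x z;
  comp1m : forall x y (f : hom x y), compm (idm y) f = f;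
  compm1 : forall x y (f : hom x y), compm f (idm x) = f;
  compmA : forall x y z t (f : hom z t) (g : hom y z) (h : hom x y),
    compm f (compm g h) = compm (compm f g) h
}.

Record functor (C D : category) := Functor {
  fob :> ob C -> ob D;
  fmap : forall x y : C, hom x y -> hom (fob x) (fob y);
  fmap1 : forall x : C, fmap (idm x) = idm (fob x);
  fmapM : forall (x y z : C) (f : hom y z) (g : hom x y),
    fmap (compm f g) = compm (fmap f) (fmap g)
}.

Definition id_functor (C : category) : functor C C :=
  @Functor C C (fun x => x) (fun _ _ f => f) (fun _ => erefl)
    (fun _ _ _ _ _ => erefl).

Lemma comp_functor1 C D E (G : functor D E) (F : functor C D) (x : C) :
  fmap G (fmap F (idm x)) = idm (G (F x)).
Proof. by rewrite !fmap1. Qed.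

Lemma comp_functorM C D E (G : functor D E) (F : functor C D) (x y z : C)
    (f : hom y z) (g : hom x y) :
  fmap G (fmap F (compm f g)) = compm (fmap G (fmap F f)) (fmap G (fmap F g)).
Proof. by rewrite !fmapM. Qed.

Definition comp_functor C D E (G : functor D E) (F : functor C D) :
    functor C E :=
  @Functor C E (fun x => G (F x)) (fun _ _ f => fmap G (fmap F f))
    (comp_functor1 G F) (comp_functorM G F).

Definition is_natural C D (F G : functor C D)
    (eta : forall x : C, hom (F x) (G x)) : Prop :=
  forall (x y : C) (f : hom x y), compm (eta y) (fmap F f) = compm (fmap G f) (eta x).

Definition is_isom (C : category) (x y : C) (f : hom x y) : Prop :=
  exists g : hom y x, compm g f = idm x /\ compm f g = idm y.

Definition naturally_isomorphic C D (F G : functor C D) : Prop :=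
  exists eta : forall x : C, hom (F x) (G x),
    is_natural eta /\ forall x, is_isom (eta x).

Definition equivalent_categories (C D : category) : Prop :=
  exists (F : functor C D) (G : functor D C),
    naturally_isomorphic (comp_functor G F) (id_functor C) /\
    naturally_isomorphic (comp_functor F G) (id_functor D).

Definition prod_category (C D : category) : category.
Proof.
refine (@Category (ob C * ob D) (fun x y => hom x.1 y.1 * hom x.2 y.2)%type
  (fun x => (idm x.1, idm x.2))
  (fun x y z f g => (compm f.1 g.1, compm f.2 g.2)) _ _ _).
- by move=> x y [f g]; rewrite /= !comp1m.
- by move=> x y [f g]; rewrite /= !compm1.
- by move=> x y z t f g h; rewrite /= !compmA.
Defined.

Definition discrete_category (T : Type) : category.
Proof.
refine (@Category T (fun x y => x = y) (fun x => erefl x)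
  (fun x y z f g => etrans g f) _ _ _).
- by [].
- by move=> x y; case: _ /.
- by move=> x y z t f g h; apply: Prop_irrelevance.
Defined.

Record bij (S S' : finType) := Bij {
  bij_fun :> S -> S';
  bij_inv : S' -> S;
  bijK : cancel bij_fun bij_inv;
  bijVK : cancel bij_inv bij_fun
}.

Lemma bijP (S S' : finType) (f g : bij S S') : f =1 g -> f = g.
Proof.
case: f g => [f f' fK f'K] [g g' gK g'K] /= /funext fg.
case: g / fg gK g'K => gK g'K.
have fg' : f' = g' by apply: funext => x; rewrite -{1}[x]g'K fK.
by case: g' / fg' gK g'K => gK g'K; congr Bij; apply: Prop_irrelevance.
Qed.

Definition bij_id (S : finType) : bij S S :=
  @Bij S S id id (fun _ => erefl) (fun _ => erefl).

Definition bij_comp (S S' S'' : finType) (f : bij S' S'') (g : bij S S') :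
    bij S S'' :=
  @Bij S S'' (f \o g) (bij_inv g \o bij_inv f)
    (can_comp (bijK f) (bijK g)) (can_comp (bijVK g) (bijVK f)).

Definition FinBij : category.
Proof.
refine (@Category finType bij bij_id bij_comp _ _ _).
- by move=> *; apply: bijP.
- by move=> *; apply: bijP.
- by move=> *; apply: bijP.
Defined.

(** * Graded vector spaces *)

(* A [Z]-graded vector space is presented internally: [gcomp d] is the
   projection of [V] onto its degree [d] component, and [gcomp_sum] says that
   [V] is the (algebraic) direct sum of these components. *)
Record gvect (k : fieldType) := GVect {
  gv_sort :> lmodType k;
  gcomp : int -> gv_sort -> gv_sort;
  gcomp_linear : forall d, linear (gcomp d);
  gcomp_proj : forall d e v,
    gcomp d (gcomp e v) = if d == e then gcomp e v else 0;
  gcomp_sum : forall v, exists s : seq int,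
    uniq s /\ v = \sum_(d <- s) gcomp d v
}.

Definition homog (k : fieldType) (V : gvect k) (d : int) (v : V) : Prop :=
  gcomp d v = v.

Record gmap (k : fieldType) (V W : gvect k) := GMap {
  gmap_fun :> V -> W;
  gmap_linear : linear gmap_fun;
  gmap_homog : forall d v, homog d v -> homog d (gmap_fun v)
}.

Lemma gmapP (k : fieldType) (V W : gvect k) (f g : gmap V W) : f =1 g -> f = g.
Proof.
case: f g => [f fl fh] [g gl gh] /= /funext fg.
by case: g / fg gl gh => gl gh; congr GMap; apply: Prop_irrelevance.
Qed.

Definition gmap_id (k : fieldType) (V : gvect k) : gmap V V :=
  @GMap k V V id (fun _ _ _ => erefl) (fun _ _ h => h).

Definition gmap_comp (k : fieldType) (U V W : gvect k)
  (f : gmap V W) (g : gmap U V) : gmap U W.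
Proof.
refine (@GMap k U W (fun x => f (g x)) _ _).
- by move=> a x y; rewrite !gmap_linear.
- by move=> d v /(gmap_homog g) /(gmap_homog f).
Defined.

Definition GradedVect (k : fieldType) : category.
Proof.
refine (@Category (gvect k) (@gmap k) (@gmap_id k) (@gmap_comp k) _ _ _).
- by move=> *; apply: gmapP.
- by move=> *; apply: gmapP.
- by move=> *; apply: gmapP.
Defined.

(** * The operadic category of connected genus-graded ordered graphs *)

(* The half-edges ['I_nh] are numbered first by vertex ([att_mono]) and then
   locally, so the local order at [v] is the order induced from ['I_nh] on
   [att @^-1 v].  The global order is the order of occurrence in [legs]. *)
Record ograph := OGraph {
  nv : nat;
  nh : nat;
  att : 'I_nh -> 'I_nv;
  flip : 'I_nh -> 'I_nh;
  legs : seq 'I_nh;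
  gen : 'I_nv -> nat;
  att_mono : forall h h' : 'I_nh, (h <= h')%N -> (att h <= att h')%N;
  flipK : involutive flip;
  legs_uniq : uniq legs;
  mem_legs : forall h, (h \in legs) = (flip h == h)
}.

Definition adjacent (T : ograph) : rel 'I_(nv T) :=
  fun u v => [exists h, (att h == u) && (att (flip h) == v)].

Definition connected (T : ograph) : bool :=
  (0 < nv T)%N && [forall u, forall v, connect (@adjacent T) u v].

Definition edges (T : ograph) : {set {set 'I_(nh T)}} :=
  [set [set h; flip h] | h : 'I_(nh T) & flip h != h].

Definition ne (T : ograph) : nat := #|edges T|.

(* b_1 = #edges + #components - #vertices *)
Definition betti1 (T : ograph) : nat :=
  (ne T + n_comp (@adjacent T) 'I_(nv T) - nv T)%N.

Definition genus (T : ograph) : nat := (\sum_(v < nv T) gen v + betti1 T)%N.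

Definition pi0 (T : ograph) : nat * nat := (size (legs T), genus T).

(* The conditions on a morphism that do not mention its fibers.  [psi_legs] says
   that [psi] restricts to an order-preserving bijection of legs. *)
Record premor (T S : ograph) := PreMor {
  psi : 'I_(nh S) -> 'I_(nh T);
  phi : 'I_(nv T) -> 'I_(nv S);
  psi_inj : injective psi;
  psi_flip : forall h, psi (flip h) = flip (psi h);
  psi_legs : map psi (legs S) = legs T;
  phi_surj : forall v, exists u, phi u = v;
  phi_att : forall h, phi (att (psi h)) = att h;
  phi_contr : forall h, h \notin codom psi -> phi (att h) = phi (att (flip h))
}.

Lemma map_val_enum_sig (T : finType) (P : pred T) :
  map val (enum {: {x | P x}}) = enum P.
Proof.
rewrite enumT unlock /= pmap_filter; last exact: insubK.
by rewrite [RHS]/enum_mem; apply: eq_filter => x; apply: isSome_insub.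
Qed.

Lemma enum_val_sig_mono n (P : pred 'I_n) (i j : 'I_#|{: {h | P h}}|) :
  (i < j)%N -> (val (enum_val i) < val (enum_val j))%N.
Proof.
move=> ltij; pose s := map val (map val (enum {: {h | P h}})).
have size_e : size (enum {: {h | P h}}) = #|{: {h | P h}}| by rewrite cardE.
have nth_s (l : 'I_#|{: {h | P h}}|) : nth 0%N s l = val (val (enum_val l)).
  have ltl : (l < size (enum {: {h | P h}}))%N by rewrite size_e.
  rewrite (nth_map (val (enum_val l))); last by rewrite size_map.
  by rewrite (nth_map (enum_val l)) // -enum_val_nth.
have sorted_s : sorted ltn s.
  rewrite /s map_val_enum_sig /enum_mem -enumT sorted_map.
  apply: sorted_filter; first by move=> x y z; apply: ltn_trans.
  by rewrite -(@sorted_map _ _ val) val_enum_ord iota_ltn_sorted.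
rewrite -!nth_s; apply: (sorted_ltn_nth ltn_trans) => //;
  by rewrite inE /s 2!size_map size_e.
Qed.

Lemma enum_rank_sig_mono n (P : pred 'I_n) (x y : {h | P h}) :
  (val x <= val y)%N -> (enum_rank x <= enum_rank y)%N.
Proof.
by rewrite leqNgt; apply: contraNleq => /enum_val_sig_mono; rewrite !enum_rankK.
Qed.

Section Fiber.

Variables (T S : ograph) (f : premor T S) (v : 'I_(nv S)).

Definition fib_vertex := {u : 'I_(nv T) | phi f u == v}.
Definition fib_half := {h : 'I_(nh T) | phi f (att h) == v}.

Definition fib_v (j : 'I_#|{: fib_vertex}|) : 'I_(nv T) := val (enum_val j).
Definition fib_h (j : 'I_#|{: fib_half}|) : 'I_(nh T) := val (enum_val j).

Definition fib_att (j : 'I_#|{: fib_half}|) : 'I_#|{: fib_vertex}| :=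
  enum_rank (exist _ (att (fib_h j)) (valP (enum_val j)) : fib_vertex).

(* The involution of the fiber: half-edges in the image of [psi] become legs. *)
Definition cut (h : 'I_(nh T)) : 'I_(nh T) :=
  if h \in codom (psi f) then h else flip h.

Lemma cut_subproof (x : fib_half) : phi f (att (cut (val x))) == v.
Proof.
rewrite /cut; case: ifP => [_|/negbT/(phi_contr)]; first exact: (valP x).
by move=> <-; exact: (valP x).
Qed.

Definition fib_flip (j : 'I_#|{: fib_half}|) : 'I_#|{: fib_half}| :=
  enum_rank (exist _ (cut (fib_h j)) (cut_subproof (enum_val j)) : fib_half).

Lemma fib_leg_subproof (x : {h : 'I_(nh S) | att h == v}) :
  phi f (att (psi f (val x))) == v.
Proof. by rewrite phi_att; apply: (valP x). Qed.

(* The global order of the fiber is the local order of [S] at [v]. *)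
Definition fib_legs : seq 'I_#|{: fib_half}| :=
  [seq enum_rank (exist _ (psi f (val x)) (fib_leg_subproof x) : fib_half)
     | x <- enum {: {h : 'I_(nh S) | att h == v}}].

Definition fib_gen (j : 'I_#|{: fib_vertex}|) : nat := gen (fib_v j).

Lemma fib_att_mono (h h' : 'I_#|{: fib_half}|) :
  (h <= h')%N -> (fib_att h <= fib_att h')%N.
Proof.
rewrite leq_eqVlt => /predU1P [/val_inj -> //|/enum_val_sig_mono hh'].
by apply: enum_rank_sig_mono; rewrite /= att_mono // ltnW.
Qed.

Lemma fib_h_flip j : fib_h (fib_flip j) = cut (fib_h j).
Proof. by rewrite /fib_h /fib_flip enum_rankK. Qed.

Lemma codom_psi_flip h :
  (flip h \in codom (psi f)) = (h \in codom (psi f)).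
Proof.
by apply/codomP/codomP => -[h' hE]; exists (flip h');
  rewrite psi_flip -hE ?flipK.
Qed.

Lemma fib_h_inj : injective fib_h.
Proof. by move=> i j /val_inj /enum_val_inj. Qed.

Lemma fib_flipK : involutive fib_flip.
Proof.
move=> j; apply: fib_h_inj; rewrite !fib_h_flip /cut.
case: (boolP (fib_h j \in codom (psi f))) => [-> //|/negbTE jP].
by rewrite codom_psi_flip jP flipK.
Qed.

Lemma fib_legs_uniq : uniq fib_legs.
Proof.
rewrite map_inj_uniq ?enum_uniq // => x y /enum_rank_inj /(congr1 val) /=.
by move/psi_inj/val_inj.
Qed.

Lemma codom_psi_nonleg h :
  h \notin codom (psi f) -> flip h != h.
Proof.
apply: contra; rewrite -mem_legs -(psi_legs f).
by case/mapP => h' _ ->; apply: codom_f.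
Qed.

Lemma mem_fib_legs j : (j \in fib_legs) = (fib_flip j == j).
Proof.
rewrite -(inj_eq fib_h_inj) fib_h_flip /cut.
case: ifP => [/codomP [h' jE]|/negbT jN].
  rewrite eqxx; apply/mapP.
  have h'v : att h' == v.
    by rewrite -(phi_att f) -jE; apply: (valP (enum_val j)).
  exists (exist _ h' h'v); first by rewrite mem_enum.
  by apply: fib_h_inj; rewrite {2}/fib_h enum_rankK /=.
rewrite (negbTE (codom_psi_nonleg jN)); apply/mapP => -[x _ jE].
by move: jN; rewrite jE /fib_h enum_rankK /= codom_f.
Qed.

Definition fiber : ograph :=
  OGraph fib_gen fib_att_mono fib_flipK fib_legs_uniq mem_fib_legs.

End Fiber.

Record ggGrc := GgGrc {
  graph :> ograph;
  graph_connected : connected graph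
}.

Record gmor (T S : ggGrc) := GMor {
  gmor_pre :> premor T S;
  fiber_connected : forall v, connected (fiber gmor_pre v);
  fiber_genus : forall v, genus (fiber gmor_pre v) = gen v
}.

Definition gfiber (T S : ggGrc) (f : gmor T S) (v : 'I_(nv S)) : ggGrc :=
  GgGrc (fiber_connected f v).

Definition premor_id (T : ograph) : premor T T.
Proof.
refine (@PreMor T T id id (fun _ _ e => e) (fun _ => erefl) (map_id _)
  (fun v => ex_intro _ v erefl) (fun _ => erefl) _).
by move=> h; rewrite (_ : h \in codom id) //; apply/codomP; exists h.
Defined.

Lemma ne_flip (T : ograph) : (forall h : 'I_(nh T), flip h = h) -> ne T = 0%N.
Proof.
move=> flipE; apply/eqP; rewrite cards_eq0; apply/eqP/setP => e; rewrite inE.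
by apply/imsetP => -[h]; rewrite inE flipE eqxx.
Qed.

Lemma ord_eq1 n (i j : 'I_n) : n = 1%N -> i = j.
Proof. by move=> nE; move: i j; rewrite nE => i j; rewrite !ord1. Qed.

Lemma connected1 (T : ograph) : nv T = 1%N -> connected T.
Proof.
move=> nvE; apply/andP; split; first by rewrite nvE.
by apply/forallP => u; apply/forallP => v; rewrite (ord_eq1 u v nvE) connect0.
Qed.

Lemma genus_ne0 (T : ograph) : ne T = 0%N ->
  genus T = (\sum_(v < nv T) gen v)%N.
Proof.
move=> neE; rewrite /genus /betti1 neE add0n.
suff : (n_comp (@adjacent T) 'I_(nv T) <= nv T)%N.
  by rewrite -subn_eq0 => /eqP ->; rewrite addn0.
by rewrite (leq_trans (max_card _)) // card_ord.
Qed.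

Lemma card_fib_id (T : ograph) (v : 'I_(nv T)) :
  #|{: fib_vertex (premor_id T) v}| = 1%N.
Proof. by rewrite card_sig -(card1 v); apply: eq_card => u; rewrite !inE. Qed.

Lemma ne_fib_id (T : ograph) (v : 'I_(nv T)) : ne (fiber (premor_id T) v) = 0%N.
Proof.
apply: ne_flip => h; apply: fib_h_inj; rewrite fib_h_flip /cut.
by rewrite (_ : _ \in codom _) //; apply/codomP; exists (fib_h h).
Qed.

Lemma fib_v_id (T : ograph) (v : 'I_(nv T))
  (j : 'I_#|{: fib_vertex (premor_id T) v}|) : fib_v j = v.
Proof. exact/eqP/(valP (enum_val j)). Qed.

Lemma genus_fib_id (T : ograph) (v : 'I_(nv T)) :
  genus (fiber (premor_id T) v) = gen v.
Proof.
rewrite genus_ne0 ?ne_fib_id //=.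
rewrite (eq_bigr (fun=> gen v)) => [|j _]; last by rewrite /fib_gen fib_v_id.
by rewrite sum_nat_const card_ord card_fib_id mul1n.
Qed.

Definition gmor_id (T : ggGrc) : gmor T T :=
  @GMor T T (premor_id T) (fun v => @connected1 (fiber (premor_id T) v) (card_fib_id v))
    (@genus_fib_id T).

Definition source (T : ggGrc) (i : 'I_(nv T)) : ggGrc := gfiber (gmor_id T) i.

(* The local order of a one-vertex graph is the order of ['I_nh]. *)
Definition is_trivial (T : ograph) : Prop :=
  [/\ nv T = 1%N, ne T = 0%N & legs T = enum 'I_(nh T)].

Definition is_elementary (T S : ggGrc) (f : gmor T S) (i : 'I_(nv S)) : Prop :=
  [/\ forall u v : 'I_(nv T), (u <= v)%N -> (phi f u <= phi f v)%N,
      forall v, v != i -> is_trivial (gfiber f v)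
    & (1 <= ne (gfiber f i))%N].

(* Morphisms are pairs of maps composed componentwise, so a two-sided inverse
   of [w] is a morphism whose components are inverse to those of [w]. *)
Definition is_iso (T S : ggGrc) (w : gmor T S) : Prop :=
  exists w' : gmor S T,
    [/\ cancel (psi w) (psi w'), cancel (psi w') (psi w),
        cancel (phi w) (phi w') & cancel (phi w') (phi w)].

Lemma size_fib_legs (T S : ograph) (f : premor T S) (v : 'I_(nv S)) :
  size (fib_legs f v) = #|[pred h | att h == v]|.
Proof. by rewrite size_map -cardE card_sig. Qed.

(* This and the next three lemmas show that the inputs related by [same] in the
   algebra conditions below do live in the same component. *)
Lemma pi0_source (T : ggGrc) (i : 'I_(nv T)) :
  pi0 (source i) = (#|[pred h | att h == i]|, gen i).
Proof. by rewrite /pi0 size_fib_legs genus_fib_id. Qed.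

Lemma pi0_source_fiber (T S : ggGrc) (f : gmor T S) (v : 'I_(nv S))
    (j : 'I_(nv (gfiber f v))) :
  pi0 (source j) = pi0 (source (T := T) (fib_v j)).
Proof.
rewrite !pi0_source; congr pair.
rewrite -(card_image (@fib_h_inj _ _ f v)); apply: eq_card => h.
rewrite !inE; apply/imageP/eqP => [[k + ->]|hE].
  rewrite inE => /eqP <-.
  by rewrite /fib_v /= /fib_att enum_rankK.
have hv : phi f (att h) == v by rewrite hE; apply: (valP (enum_val j)).
exists (enum_rank (exist _ h hv : fib_half f v)); last by rewrite /fib_h enum_rankK.
rewrite inE /= /fib_att -(inj_eq enum_val_inj) enum_rankK -val_eqE /=.
by rewrite /fib_h enum_rankK /= hE.
Qed.

Lemma pi0_source_target (T S : ggGrc) (f : gmor T S) (v : 'I_(nv S)) :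
  pi0 (source v) = pi0 (gfiber f v).
Proof.
rewrite pi0_source /pi0 size_fib_legs.
by have := fiber_genus f v; rewrite /gfiber /= => ->.
Qed.

Lemma pi0_trivial (U : ggGrc) (i : 'I_(nv U)) :
  is_trivial U -> pi0 (source i) = pi0 U.
Proof.
move=> [nvE neE legsE]; have iE (j : 'I_(nv U)) : j = i by apply: ord_eq1.
rewrite pi0_source /pi0 legsE -cardE card_ord; congr pair.
  by rewrite -[RHS]card_ord; apply: eq_card => h; rewrite !inE [att h]iE eqxx.
rewrite genus_ne0 // (eq_bigr (fun=> gen i)) => [|j _]; last by rewrite [j]iE.
by rewrite sum_nat_const card_ord nvE mul1n.
Qed.

(** * Algebras over the terminal operad *)

(* Equality of elements of components indexed by colors that are equal, though
   not necessarily convertible. *)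
Definition same (k : fieldType) (A : nat * nat -> gvect k) c c'
    (x : A c) (y : A c') : Prop :=
  existT (fun c => A c : Type) c x = existT (fun c => A c : Type) c' y.

Definition inputs (k : fieldType) (A : nat * nat -> gvect k) (T : ggGrc) : Type :=
  forall i : 'I_(nv T), A (pi0 (source i)).

Definition koszul (k : fieldType) n m (f : 'I_n -> 'I_m) (d : 'I_n -> int) : k :=
  \prod_(p : 'I_n * 'I_n | (p.1 < p.2)%N && (f p.2 < f p.1)%N)
    (-1) ^+ absz (d p.1 * d p.2).

(* A degree 0 map out of a tensor product is given by the corresponding
   multilinear map, additive on degrees of homogeneous elements.  In
   [alpha_elem], [b] is the block of factors of [a] over [i], and [c] is [a] with
   this block replaced by its image under the operation of the fiber. *)
Record algebra (k : fieldType) := Algebra {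
  acar :> nat * nat -> gvect k;
  alpha : forall T : ggGrc, inputs acar T -> acar (pi0 T);
  alpha_linear : forall (T : ggGrc) (a : inputs acar T) (i : 'I_(nv T)),
    linear (fun x : acar (pi0 (source i)) => alpha (dfwith a x));
  alpha_homog : forall (T : ggGrc) (a : inputs acar T) (d : 'I_(nv T) -> int),
    (forall i, homog (d i) (a i)) -> homog (\sum_i d i) (alpha a);
  alpha_unit : forall (U : ggGrc), is_trivial U ->
    forall (a : inputs acar U) (i : 'I_(nv U)), same (alpha a) (a i);
  alpha_elem : forall (T S : ggGrc) (f : gmor T S) (i : 'I_(nv S)),
    is_elementary f i ->
    forall (a : inputs acar T) (b : inputs acar (gfiber f i)) (c : inputs acar S),
      (forall j, same (b j) (a (fib_v j))) ->
      same (c i) (alpha b) ->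
      (forall u, phi f u != i -> same (c (phi f u)) (a u)) ->
    same (alpha a) (alpha c);
  alpha_iso : forall (T S : ggGrc) (w : gmor T S), is_iso w ->
    forall (a : inputs acar T) (d : 'I_(nv T) -> int)
      (b : forall v, inputs acar (gfiber w v)) (c : inputs acar S),
      (forall u, homog (d u) (a u)) ->
      (forall v j, same (b v j) (a (fib_v j))) ->
      (forall v, same (c v) (alpha (b v))) ->
    same (alpha a) (koszul k (phi w) d *: alpha c)
}.

Record algebra_mor (k : fieldType) (A B : algebra k) := AlgebraMor {
  amor :> forall c, gmap (A c) (B c);
  amor_alpha : forall (T : ggGrc) (a : inputs A T),
    amor (pi0 T) (alpha a) = alpha (fun i => amor _ (a i) : B _)
}.

Lemma algebra_morP (k : fieldType) (A B : algebra k) (f g : algebra_mor A B) :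
  (forall c, f c =1 g c) -> f = g.
Proof.
case: f g => [f fP] [g gP] /= fg.
have fgE : f = g by apply: functional_extensionality_dep => c; apply: gmapP.
by case: g / fgE gP {fg} => gP; congr AlgebraMor; apply: Prop_irrelevance.
Qed.

Definition algebra_id (k : fieldType) (A : algebra k) : algebra_mor A A :=
  @AlgebraMor k A A (fun c => gmap_id (A c)) (fun _ _ => erefl).

Definition algebra_comp (k : fieldType) (A B C : algebra k)
  (f : algebra_mor B C) (g : algebra_mor A B) : algebra_mor A C.
Proof.
refine (@AlgebraMor k A C (fun c => gmap_comp (f c) (g c)) _).
by move=> T a /=; rewrite !amor_alpha.
Defined.

Definition TerminalAlgebras (k : fieldType) : category.
Proof.
refine (@Category (algebra k) (@algebra_mor k) (@algebra_id k) (@algebra_comp k)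
  _ _ _).
- by move=> *; apply: algebra_morP.
- by move=> *; apply: algebra_morP.
- by move=> *; apply: algebra_morP.
Defined.

(** * Modular operads *)

Definition bij_opt (S S' : finType) (f : bij S S') : bij (option S) (option S').
Proof.
by refine (@Bij (option S) (option S') (omap f) (omap (bij_inv f)) _ _);
  case=> //= x; rewrite ?bijK ?bijVK.
Defined.

Definition bij_sum (S1 S1' S2 S2' : finType) (f1 : bij S1 S1') (f2 : bij S2 S2') :
  bij (S1 + S2)%type (S1' + S2')%type.
Proof.
by refine (@Bij (S1 + S2)%type (S1' + S2')%type
  (fun x => match x with inl y => inl (f1 y) | inr y => inr (f2 y) end)
  (fun x => match x with inl y => inl (bij_inv f1 y)
                       | inr y => inr (bij_inv f2 y) end) _ _);
  case=> x; rewrite ?bijK ?bijVK.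
Defined.

Definition bij_sumC (S1 S2 : finType) : bij (S1 + S2)%type (S2 + S1)%type.
Proof.
by refine (@Bij (S1 + S2)%type (S2 + S1)%type
  (fun x => match x with inl y => inr y | inr y => inl y end)
  (fun x => match x with inl y => inr y | inr y => inl y end) _ _); case.
Defined.

Definition bij_sumA (S1 S2 S3 : finType) :
  bij (S1 + (S2 + S3))%type ((S1 + S2) + S3)%type.
Proof.
by refine (@Bij (S1 + (S2 + S3))%type ((S1 + S2) + S3)%type
  (fun x => match x with
    | inl y => inl (inl y) | inr (inl y) => inl (inr y) | inr (inr y) => inr y
    end)
  (fun x => match x with
    | inl (inl y) => inl y | inl (inr y) => inr (inl y) | inr y => inr (inr y)
    end) _ _); [case=> [|[]] | case=> [[]|]].
Defined.

Definition bij_optl (S1 S2 : finType) :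
  bij (option S1 + S2)%type (option (S1 + S2)%type).
Proof.
by refine (@Bij (option S1 + S2)%type (option (S1 + S2)%type)
  (fun x => match x with
    | inl None => None | inl (Some y) => Some (inl y) | inr y => Some (inr y)
    end)
  (fun x => match x with
    | None => inl None | Some (inl y) => inl (Some y) | Some (inr y) => inr y
    end) _ _); [case=> [[]|] | case=> [[]|]].
Defined.

Definition bij_optr (S1 S2 : finType) :
  bij (S1 + option S2)%type (option (S1 + S2)%type).
Proof.
by refine (@Bij (S1 + option S2)%type (option (S1 + S2)%type)
  (fun x => match x with
    | inr None => None | inr (Some y) => Some (inr y) | inl y => Some (inl y)
    end)
  (fun x => match x with
    | None => inr None | Some (inr y) => inr (Some y) | Some (inl y) => inl y
    end) _ _); [case=> [|[]] | case=> [[]|]].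
Defined.

Definition bij_swap (S : finType) : bij (option (option S)) (option (option S)).
Proof.
by refine (@Bij (option (option S)) (option (option S))
  (fun x => match x with
    | None => Some None | Some None => None | Some (Some y) => Some (Some y)
    end)
  (fun x => match x with
    | None => Some None | Some None => None | Some (Some y) => Some (Some y)
    end) _ _); case=> [[]|].
Defined.

(* [S ⊔ {a,b} ⊔ {c,d}]: exchanges the two pairs of added points. *)
Definition bij_swap2 (S : finType) :
  bij (option (option (option (option S)))) (option (option (option (option S)))).
Proof.
pose h (x : option (option (option (option S)))) :
    option (option (option (option S))) :=
  match x with
  | None => Some (Some None)
  | Some None => Some (Some (Some None))
  | Some (Some None) => None
  | Some (Some (Some None)) => Some None
  | Some (Some (Some (Some y))) => Some (Some (Some (Some y)))
  end.
by refine (@Bij _ _ h h _ _); case=> [[[[]|]|]|].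
Defined.

(* Brings the innermost of three added points to the outermost position. *)
Definition bij_rot (S : finType) :
  bij (option (option (option S))) (option (option (option S))) :=
  bij_comp (bij_swap (option S)) (bij_opt (bij_swap S)).

(* [(S1 ⊔ {a}) ⊔ (S2 ⊔ {b})] with [a] outermost on the right-hand side. *)
Definition bij_opt2 (S1 S2 : finType) :
  bij (option S1 + option S2)%type (option (option (S1 + S2)%type)) :=
  bij_comp (bij_opt (bij_optr S1 S2)) (bij_optl S1 (option S2)).

Definition bij_optl2 (S1 S2 : finType) :
  bij (option (option S1) + S2)%type (option (option (S1 + S2)%type)) :=
  bij_comp (bij_opt (bij_optl S1 S2)) (bij_optl (option S1) S2).

Definition genus_graded_functor (k : fieldType) : Type :=
  functor (prod_category FinBij (discrete_category nat)) (GradedVect k).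

Definition mspace (k : fieldType) (M : genus_graded_functor k) (S : finType) (g : nat) :
  gvect k := M (S, g).

Definition mact (k : fieldType) (M : genus_graded_functor k) (S S' : finType) (g g' : nat)
    (f : bij S S') (e : g = g') : gmap (mspace M S g) (mspace M S' g') :=
  @fmap _ _ M (S, g) (S', g') (f, e).

(* [S ⊔ {a}] is [option S], the added point [a] being [None], and [S1 ⊔ S2] is
   the sum type; in an iterated [option] the last added point is the outermost
   one.  [circ] is [_a∘_b] for the two added points and [contr] is [∘_uv] for
   the two last added points.  Bijections that are identities for strictly
   associative unions of sets are explicit.  [circ] is a degree 0 map out of a
   tensor product, given as a bilinear map. *)
Record modular_operad (k : fieldType) := ModularOperad {
  mfun :> genus_graded_functor k;
  circ : forall (S1 S2 : finType) (g1 g2 : nat),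
    mspace mfun (option S1) g1 -> mspace mfun (option S2) g2 ->
    mspace mfun (S1 + S2)%type (g1 + g2)%N;
  contr : forall (S : finType) (g : nat),
    gmap (mspace mfun (option (option S)) g) (mspace mfun S (g + 1)%N);
  circ_linearl : forall S1 S2 g1 g2 y,
    linear (fun x => @circ S1 S2 g1 g2 x y);
  circ_linearr : forall S1 S2 g1 g2 x,
    linear (fun y => @circ S1 S2 g1 g2 x y);
  circ_homog : forall S1 S2 g1 g2 d e x y,
    homog d x -> homog e y -> homog (d + e) (@circ S1 S2 g1 g2 x y);
  circ_natural : forall (S1 S1' S2 S2' : finType) (f1 : bij S1 S1')
      (f2 : bij S2 S2') g1 g2 x y,
    mact mfun (bij_sum f1 f2) (erefl (g1 + g2)%N) (circ x y) =
    circ (mact mfun (bij_opt f1) (erefl g1) x)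
         (mact mfun (bij_opt f2) (erefl g2) y);
  contr_natural : forall (S S' : finType) (f : bij S S') g x,
    mact mfun f (erefl (g + 1)%N) (contr S g x) =
    contr S' g (mact mfun (bij_opt (bij_opt f)) (erefl g) x);
  contr_sym : forall (S : finType) g x,
    contr S g (mact mfun (bij_swap S) (erefl g) x) = contr S g x;
  circ_sym : forall (S1 S2 : finType) g1 g2 d1 d2
      (x : mspace mfun (option S1) g1) (y : mspace mfun (option S2) g2),
    homog d1 x -> homog d2 y ->
    circ x y = (-1) ^+ absz (d1 * d2) *:
      mact mfun (bij_sumC S2 S1) (addnC g2 g1) (circ y x);
  circ_assoc : forall (S1 S2 S3 : finType) g1 g2 g3
      (x : mspace mfun (option S1) g1)
      (y : mspace mfun (option (option S2)) g2)
      (z : mspace mfun (option S3) g3),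
    mact mfun (bij_sumA S1 S2 S3) (addnA g1 g2 g3)
      (circ x (mact mfun (bij_optl S2 S3) (erefl (g2 + g3)%N) (circ y z))) =
    circ (mact mfun (bij_optr S1 S2) (erefl (g1 + g2)%N)
            (circ x (mact mfun (bij_swap S2) (erefl g2) y))) z;
  contr_contr : forall (S : finType) g
      (x : mspace mfun (option (option (option (option S)))) g),
    contr S (g + 1)%N (contr (option (option S)) g x) =
    contr S (g + 1)%N
      (contr (option (option S)) g (mact mfun (bij_swap2 S) (erefl g) x));
  contr_circ : forall (S1 S2 : finType) g1 g2
      (x : mspace mfun (option (option S1)) g1)
      (y : mspace mfun (option (option S2)) g2),
    contr _ _ (mact mfun (bij_opt2 S1 S2) (erefl (g1 + g2)%N) (circ x y)) =
    contr _ _ (mact mfun (bij_opt2 S1 S2) (erefl (g1 + g2)%N)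
      (circ (mact mfun (bij_swap S1) (erefl g1) x)
            (mact mfun (bij_swap S2) (erefl g2) y)));
  circ_contr : forall (S1 S2 : finType) g1 g2
      (x : mspace mfun (option (option (option S1))) g1)
      (y : mspace mfun (option S2) g2),
    mact mfun (bij_id (S1 + S2)%type) (addnAC g1 1 g2)
      (circ (contr (option S1) g1 x) y) =
    contr _ _ (mact mfun (bij_optl2 S1 S2) (erefl (g1 + g2)%N)
      (circ (mact mfun (bij_rot S1) (erefl g1) x) y))
}.

(* Morphisms are the natural transformations that commute with the structure
   operations. *)
Record modular_operad_mor (k : fieldType) (M N : modular_operad k) :=
  ModularOperadMor {
  mmor :> forall (S : finType) (g : nat), gmap (mspace M S g) (mspace N S g);
  mmor_natural : forall (S S' : finType) g g' (f : bij S S') (e : g = g') x,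
    mmor S' g' (mact M f e x) = mact N f e (mmor S g x);
  mmor_circ : forall (S1 S2 : finType) g1 g2
      (x : mspace M (option S1) g1) (y : mspace M (option S2) g2),
    mmor _ _ (circ x y) = circ (mmor _ _ x) (mmor _ _ y);
  mmor_contr : forall (S : finType) g (x : mspace M (option (option S)) g),
    mmor _ _ (contr M S g x) = contr N S g (mmor _ _ x)
}.

Lemma modular_operad_morP (k : fieldType) (M N : modular_operad k)
  (f h : modular_operad_mor M N) : (forall S g, f S g =1 h S g) -> f = h.
Proof.
case: f h => [f f1 f2 f3] [h h1 h2 h3] /= fh.
have fhE : f = h.
  by do 2![apply: functional_extensionality_dep => ?]; apply: gmapP.
case: h / fhE h1 h2 h3 {fh} => h1 h2 h3.
by congr ModularOperadMor; apply: Prop_irrelevance.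
Qed.

Definition modular_operad_id (k : fieldType) (M : modular_operad k) :
    modular_operad_mor M M :=
  @ModularOperadMor k M M (fun S g => gmap_id (mspace M S g))
    (fun _ _ _ _ _ _ _ => erefl) (fun _ _ _ _ _ _ => erefl)
    (fun _ _ _ => erefl).

Definition modular_operad_comp (k : fieldType) (M N P : modular_operad k)
  (f : modular_operad_mor N P) (h : modular_operad_mor M N) :
  modular_operad_mor M P.
Proof.
refine (@ModularOperadMor k M P (fun S g => gmap_comp (f S g) (h S g)) _ _ _).
- by move=> S S' g g' b e x /=; rewrite !mmor_natural.
- by move=> S1 S2 g1 g2 x y /=; rewrite !mmor_circ.
- by move=> S g x /=; rewrite !mmor_contr.
Defined.

Definition ModularOperads (k : fieldType) : category.
Proof.
refine (@Category (modular_operad k) (@modular_operad_mor k)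
  (@modular_operad_id k) (@modular_operad_comp k) _ _ _).
- by move=> *; apply: modular_operad_morP.
- by move=> *; apply: modular_operad_morP.
- by move=> *; apply: modular_operad_morP.
Defined.

(* Main.v *)
(**
An algebra A gives a modular operad with values A(#|S|, g), whose operations are
the values of A on the graphs with one edge.  All composites are then values of A
on graphs, and an axiom of modular operads says that contracting the edges of a
two-edge graph in either order gives the value of the whole graph.  The functor
obtained is fully faithful and essentially surjective.

Full: a morphism of modular operads commutes with the value of every connected
graph, by induction on the number of half-edges.  Permuting the vertices brings
the two ends of an edge to the front, with the same Koszul sign in both algebras;
this edge is then contracted.

Essentially surjective: from a modular operad M, define the value of a connected
graph by contracting its edges in the order prescribed by a binary tree.  The
axioms of M are exactly what is needed to move any edge to the root of the tree,
so the value does not depend on the tree.  Substituting trees into the leaves of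
a tree gives the algebra axioms, and the one-edge graphs give M back.
*)

From HB Require Import structures.
From mathcomp Require Import all_boot all_order all_algebra.
From mathcomp Require Import boolp zify.
Require Import Defs.

Set Implicit Arguments.
Unset Strict Implicit.
Unset Printing Implicit Defensive.

Import GRing.Theory.
Local Open Scope ring_scope.

(** Two obstacles shape the proof. Elements over colors or finite sets that are equal without being
    convertible cannot be compared directly, so on the operad side elements carry their labels and
    genus ([packed]), on the algebra side their color ([pt]), and graphs are presented by lists of
    named half-edges ([reads]). As half-edges are numbered by vertex and then locally, such lists
    determine a graph up to equality, not just up to isomorphism. The second obstacle is that Koszul
    signs make sense on homogeneous inputs only. Identities are checked there and extended by
    multilinearity, and the operations built from an operad sum over all parities of the inputs. For
    that algebra the elementary and the isomorphism axiom are cases of one law valid for every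
    morphism: the value of the source is the value of the target on the values of the fibers, up to
    the Koszul sign of the vertex map. On trees, each joining node carries the sign of a shuffle,
    and these signs add up to that Koszul sign under substitution. The genus of a tree is forced by
    an Euler characteristic count of half-edges. *)

Lemma isom_comp_inj (C : category) (x y z : C) (e : hom y z) (f g : hom x y) :
  is_isom e -> compm e f = compm e g -> f = g.
Proof.
by case=> e' [eK _] /(congr1 (compm e')); rewrite !compmA eK !comp1m.
Qed.

(** The quasi-inverse is made by choice: [G y] is a preimage of [y] up to the isomorphism [eps y],
    and a morphism [u] goes to the lift of its conjugate by [eps]. Functoriality and naturality are
    checked after applying [F], where [GmE] settles them. *)
Lemma fully_faithful_equivalence (C D : category) (F : functor C D) :
  (forall (x y : C) (g : hom (F x) (F y)), exists f : hom x y, fmap F f = g) ->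
  (forall (x y : C) (f f' : hom x y), fmap F f = fmap F f' -> f = f') ->
  (forall y : D, exists x : C, exists e : hom (F x) y, is_isom e) ->
  equivalent_categories C D.
Proof.
move=> full faithful esurj.
pose G y := sval (cid (esurj y)).
pose eps y : hom (F (G y)) y := sval (cid (svalP (cid (esurj y)))).
have epsI y : is_isom (eps y) := svalP (cid (svalP (cid (esurj y)))).
pose eps' y : hom y (F (G y)) := sval (cid (epsI y)).
have epsK y : compm (eps' y) (eps y) = idm _ := proj1 (svalP (cid (epsI y))).
have epsVK y : compm (eps y) (eps' y) = idm _ := proj2 (svalP (cid (epsI y))).
pose lift x y (g : hom (F x) (F y)) : hom x y := sval (cid (full x y g)).
have liftE x y (g : hom (F x) (F y)) : fmap F (lift x y g) = g :=
  svalP (cid (full x y g)).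
pose Gm x y (u : hom x y) := lift _ _ (compm (eps' y) (compm u (eps x))).
have GmE x y (u : hom x y) : compm (eps y) (fmap F (Gm x y u)) = compm u (eps x).
  by rewrite liftE compmA epsVK comp1m.
have Gm1 x : Gm x x (idm x) = idm (G x).
  apply: faithful; apply: (isom_comp_inj (epsI x)).
  by rewrite GmE fmap1 comp1m compm1.
have GmM x y z (u : hom y z) (v : hom x y) :
    Gm x z (compm u v) = compm (Gm y z u) (Gm x y v).
  apply: faithful; apply: (isom_comp_inj (epsI z)).
  by rewrite GmE fmapM compmA GmE -!compmA GmE.
pose GF := @Functor D C G Gm Gm1 GmM.
exists F, GF; split.
  exists (fun x => lift (G (F x)) x (eps (F x))); split.
    move=> x y f; apply: faithful.
    by rewrite /= !fmapM [fmap F (lift _ x _)]liftE [fmap F (lift _ y _)]liftE; apply: GmE.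
  move=> x; exists (lift x (G (F x)) (eps' (F x))).
  by split; apply: faithful; rewrite fmapM !liftE fmap1 ?epsK ?epsVK.
exists eps; split=> [x y u|y]; last exact: epsI.
exact: GmE.
Qed.

(** * Graded vector spaces and multilinear maps *)

Lemma linear0_ (k : fieldType) (V W : lmodType k) (f : V -> W) : linear f -> f 0 = 0.
Proof. by move=> fL; have := fL (-1) 0 0; rewrite !scaleN1r !addNr. Qed.

Lemma linearD_ (k : fieldType) (V W : lmodType k) (f : V -> W) :
  linear f -> forall x y, f (x + y) = f x + f y.
Proof. by move=> fL x y; have := fL 1 x y; rewrite !scale1r. Qed.

Lemma linearZ_ (k : fieldType) (V W : lmodType k) (f : V -> W) :
  linear f -> forall a x, f (a *: x) = a *: f x.
Proof. by move=> fL a x; have := fL a x 0; rewrite (linear0_ fL) !addr0. Qed.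

Lemma linear_sum_ (k : fieldType) (V W : lmodType k) (f : V -> W) :
  linear f -> forall (I : Type) (r : seq I) (P : pred I) (F : I -> V),
  f (\sum_(i <- r | P i) F i) = \sum_(i <- r | P i) f (F i).
Proof.
move=> fL I r P F; apply: (big_morph f); [exact: linearD_|exact: linear0_].
Qed.

Section Graded.
Variables (k : fieldType) (V : gvect k).
Implicit Types (d e : int) (v w : V).

Lemma homog_gcomp d v : homog d (gcomp d v).
Proof. by rewrite /homog gcomp_proj eqxx. Qed.

Lemma homog0 d : homog d (0 : V).
Proof. exact: (linear0_ (@gcomp_linear k V d)). Qed.

Lemma homogZ d a v : homog d v -> homog d (a *: v).
Proof. by rewrite /homog (linearZ_ (@gcomp_linear k V d)) => ->. Qed.

Lemma homog_gcomp0 d e v : homog d v -> d != e -> gcomp e v = 0.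
Proof. by move=> <- de; rewrite gcomp_proj eq_sym (negbTE de). Qed.

(** A chosen finite set of degrees outside which all components vanish. It may contain degrees with
    zero component and depends on the choice, so sums over supports are compared on a common larger
    set. *)
Definition support v : seq int := sval (cid (gcomp_sum v)).

Lemma support_uniq v : uniq (support v).
Proof. by have [] := svalP (cid (gcomp_sum v)). Qed.

Lemma support_sum v : v = \sum_(d <- support v) gcomp d v.
Proof. by have [] := svalP (cid (gcomp_sum v)). Qed.

Lemma support_gcomp d v : d \notin support v -> gcomp d v = 0.
Proof.
move=> dv; rewrite {1}[v]support_sum (linear_sum_ (@gcomp_linear k V d)).
rewrite big_seq big1 // => e ev; rewrite gcomp_proj.
by case: eqP => // de; move: dv; rewrite de ev.
Qed.

(** The even or odd part of [v]. Koszul signs depend on degrees modulo 2 only, so this splitting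
    into two parts is all that a multilinear definition with signs requires. *)
Definition parity (b : bool) v : V :=
  \sum_(d <- support v | odd `|d|%N == b) gcomp d v.

Lemma parity_sub b v (s : seq int) : uniq s -> {subset support v <= s} ->
  parity b v = \sum_(d <- s | odd `|d|%N == b) gcomp d v.
Proof.
move=> us sub; rewrite /parity.
rewrite [RHS](bigID (mem (support v))) /= [X in _ = _ + X]big1 ?addr0; last first.
  by move=> d /andP[_ /support_gcomp].
under [RHS]eq_bigl => d do rewrite andbC.
rewrite -[RHS]big_filter_cond; apply: perm_big; apply: uniq_perm.
- exact: support_uniq.
- exact: filter_uniq.
by move=> d; rewrite mem_filter /=; have [/sub ->|] := boolP (d \in support v).
Qed.

Lemma parity_linear b : linear (parity b).
Proof.
move=> a v w; pose s := undup (support (a *: v + w) ++ support v ++ support w).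
rewrite !(@parity_sub b _ s) ?undup_uniq //; first last.
- by move=> x xs; rewrite mem_undup !mem_cat xs.
- by move=> x xs; rewrite mem_undup !mem_cat xs !orbT.
- by move=> x xs; rewrite mem_undup !mem_cat xs !orbT.
rewrite scaler_sumr -big_split /=; apply: eq_bigr => d _.
exact: gcomp_linear.
Qed.

Lemma parity_homog b d v :
  homog d v -> parity b v = if odd `|d|%N == b then v else 0.
Proof.
move=> dv; rewrite (@parity_sub b _ (undup (d :: support v))) ?undup_uniq //;
  last by move=> x xs; rewrite mem_undup inE xs orbT.
rewrite big_mkcond (bigD1_seq d) ?undup_uniq ?mem_undup ?mem_head //= dv.
by rewrite big1 ?addr0 // => e ed; rewrite (homog_gcomp0 dv) ?if_same // eq_sym.
Qed.

End Graded.

Definition multilinear (k : fieldType) n (V : 'I_n -> gvect k) (W : lmodType k)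
    (F : (forall i, V i) -> W) : Prop :=
  forall (a : forall i, V i) i, linear (fun x : V i => F (dfwith a x)).

Lemma dfwith_id (I : eqType) (T : I -> Type) (a : forall i, T i) i :
  dfwith a (a i) = a.
Proof.
apply: functional_extensionality_dep => j.
by have [->|ij] := eqVneq j i; [rewrite dfwith_in|rewrite dfwith_out // eq_sym].
Qed.

(** Coordinates are made homogeneous one at a time: those of index at least [m] already are, and
    splitting coordinate [m] into its components reduces [m.+1] to [m]. *)
Lemma multilinear_ext (k : fieldType) n (V : 'I_n -> gvect k) (W : lmodType k)
    (F G : (forall i, V i) -> W) : multilinear F -> multilinear G ->
  (forall a (d : 'I_n -> int), (forall i, homog (d i) (a i)) -> F a = G a) ->
  F =1 G.
Proof.
move=> Fl Gl FG.
suff H m : forall a, (forall i : 'I_n, (m <= i)%N -> exists d, homog d (a i)) ->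
    F a = G a.
  by move=> a; apply: (H n) => i; rewrite leqNgt ltn_ord.
elim: m => [|m IHm] a aP.
  have aP' i : exists d, homog d (a i) by apply: aP.
  by apply: (FG a (fun i => sval (cid (aP' i)))) => i; apply: svalP (cid (aP' i)).
have [mn|nm] := ltnP m n; last first.
  by apply: IHm => i mi; apply: aP; rewrite ltn_neqAle mi andbT neq_ltn
    (leq_trans (ltn_ord i) nm) orbT.
pose i := Ordinal mn; rewrite -(dfwith_id a i) [a i]support_sum.
rewrite (linear_sum_ (Fl a i)) (linear_sum_ (Gl a i)); apply: eq_bigr => d _.
apply: IHm => j mj; have [->|ij] := eqVneq j i.
  by exists d; rewrite dfwith_in; exact: homog_gcomp.
rewrite dfwith_out; last by rewrite eq_sym.
by apply: aP; rewrite ltn_neqAle mj andbT; apply: contra ij => /eqP e; exact/eqP/val_inj.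
Qed.

Lemma multilinear0 (k : fieldType) n (V : 'I_n -> gvect k) (W : lmodType k)
    (F : (forall i, V i) -> W) a i : multilinear F -> a i = 0 -> F a = 0.
Proof. by move=> /(_ a i) /linear0_ + ai0; rewrite -ai0 dfwith_id. Qed.

(** * Labelled elements of a functor on finite sets *)

Section Transport.
Variables (k : fieldType) (M : genus_graded_functor k).

Lemma mact_comp (S S' S'' : finType) g g' g'' (f : bij S' S'') (f' : bij S S')
    (e : g' = g'') (e' : g = g') x :
  mact M f e (mact M f' e' x) = mact M (bij_comp f f') (etrans e' e) x.
Proof.
rewrite /mact.
have := @fmapM _ _ M (S, g) (S', g') (S'', g'') (f, e) (f', e').
by move/(congr1 (fun m : gmap _ _ => m x)) => /= ->.
Qed.

Lemma mact_id (S : finType) g (f : bij S S) (e : g = g) x : f =1 id -> mact M f e x = x.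
Proof.
move=> fE; have -> : f = bij_id S by apply: bijP.
rewrite (Prop_irrelevance e erefl) /mact.
by have := @fmap1 _ _ M (S, g) => /= ->.
Qed.

Lemma mact_ext (S S' : finType) g g' (f f' : bij S S') (e e' : g = g') x :
  f =1 f' -> mact M f e x = mact M f' e' x.
Proof. by move=> /bijP ->; rewrite (Prop_irrelevance e e'). Qed.

Definition same_labels (H : Type) (S S' : finType) (l : S -> H) (l' : S' -> H) :=
  exists f : bij S S', l' \o f =1 l.

Lemma same_labels_sym (H : Type) (S S' : finType) (l : S -> H) (l' : S' -> H) :
  same_labels l l' -> same_labels l' l.
Proof.
case=> f fl; exists (@Bij S' S (bij_inv f) f (bijVK f) (bijK f)) => s /=.
by rewrite -fl /= bijVK.
Qed.

Lemma same_labels_trans (H : Type) (S S' S'' : finType) (l : S -> H) (l' : S' -> H)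
    (l'' : S'' -> H) :
  same_labels l l' -> same_labels l' l'' -> same_labels l l''.
Proof.
case=> f fl [f' fl']; exists (bij_comp f' f) => s /=.
by rewrite -fl /= -fl'.
Qed.

Lemma same_labels_bij (H : finType) (S S' : finType) (l : S -> H) (l' : S' -> H) :
  injective l -> injective l' -> (forall h, (h \in codom l) = (h \in codom l')) ->
  same_labels l l'.
Proof.
move=> li l'i im.
have to s : exists s', l' s' == l s.
  have : l s \in codom l' by rewrite -im codom_f.
  by case/codomP => s' ->; exists s'.
have from s' : exists s, l s == l' s'.
  have : l' s' \in codom l by rewrite im codom_f.
  by case/codomP => s ->; exists s.
pose f s := xchoose (to s); pose f' s := xchoose (from s).
have fE s : l' (f s) = l s by apply/eqP/(xchooseP (to s)).
have f'E s : l (f' s) = l' s by apply/eqP/(xchooseP (from s)).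
have fK : cancel f f' by move=> s; apply: li; rewrite f'E fE.
have f'K : cancel f' f by move=> s; apply: l'i; rewrite fE f'E.
by exists (Bij fK f'K).
Qed.

(* Transport along the bijection that respects the labels, and [0] if there is
   no such bijection or if the genera differ. *)
Definition tr (H : Type) (S S' : finType) (l : S -> H) (l' : S' -> H) g g'
    (x : mspace M S g) : mspace M S' g' :=
  match pselect (same_labels l l'), eqVneq g g' with
  | left p, EqNotNeq e => mact M (sval (cid p)) e x
  | _, _ => 0
  end.

(** A bijection compatible with labels is unique when the target labelling is injective, so the one
    chosen inside [tr] acts as [f]. *)
Lemma trE (H : Type) (S S' : finType) (l : S -> H) (l' : S' -> H) g g'
    (f : bij S S') (e : g = g') x :
  injective l' -> l' \o f =1 l -> tr l l' g' x = mact M f e x.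
Proof.
move=> l'i fl; rewrite /tr; case: pselect => [p|[]]; last by exists f.
case: eqVneq => [e'|/eqP /(_ e) []].
apply: mact_ext => s; apply: l'i.
by rewrite [LHS](svalP (cid p) s) -[RHS]/((l' \o f) s) fl.
Qed.

Lemma tr_linear (H : Type) (S S' : finType) (l : S -> H) (l' : S' -> H) g g' :
  linear (@tr H S S' l l' g g').
Proof.
rewrite /tr; case: pselect => [p|_]; last by move=> a x y; rewrite scaler0 addr0.
case: eqVneq => [e|_]; last by move=> a x y; rewrite scaler0 addr0.
exact: gmap_linear.
Qed.

Lemma tr_homog (H : Type) (S S' : finType) (l : S -> H) (l' : S' -> H) g g' d x :
  homog d x -> homog d (@tr H S S' l l' g g' x).
Proof.
move=> xd; rewrite /tr; case: pselect => [p|_]; last exact: homog0.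
case: eqVneq => [e|_]; last exact: homog0.
exact: gmap_homog.
Qed.

Lemma tr_id (H : Type) (S : finType) (l : S -> H) g x : injective l -> @tr H S S l l g g x = x.
Proof. by move=> li; rewrite (@trE _ _ _ _ _ _ _ (bij_id S) erefl) ?mact_id. Qed.

(** If [l'] cannot be matched with [l''], then neither can [l], and both sides take the default
    value 0. *)
Lemma tr_comp (H : Type) (S S' S'' : finType) (l : S -> H) (l' : S' -> H)
    (l'' : S'' -> H) g g' g'' x :
  injective l' -> injective l'' -> same_labels l l' -> g = g' ->
  @tr H S' S'' l' l'' g' g'' (@tr H S S' l l' g g' x) = @tr H S S'' l l'' g g'' x.
Proof.
move=> l'i l''i [f fl] e; case: g' / e.
rewrite (@trE _ _ _ _ _ _ _ f erefl) //.
rewrite /tr; case: pselect => [p|p']; case: pselect => [q|q'] //.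
- case: eqVneq => [e'|//]; rewrite mact_comp; apply: mact_ext => s.
  apply: l''i; rewrite [LHS](svalP (cid p) (f s)) [RHS](svalP (cid q) s).
  exact: fl.
- by case: q'; apply: same_labels_trans p; exists f.
- case: p'; apply: same_labels_trans q; apply: same_labels_sym.
  by exists f.
Qed.

Lemma tr_mactl (H : Type) (S S' S'' : finType) (l : S -> H) (l' : S' -> H)
    (l'' : S'' -> H) g g' g'' (f : bij S S') (e : g = g') x :
  injective l' -> injective l'' -> l' \o f =1 l ->
  @tr H S' S'' l' l'' g' g'' (mact M f e x) = @tr H S S'' l l'' g g'' x.
Proof.
move=> l'i l''i fl; rewrite -(@trE _ _ _ l l' _ _ f e x l'i fl) tr_comp //.
by exists f.
Qed.

End Transport.
Arguments tr {k} M {H S S'} l l' {g g'} x.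

Definition lopt (H : Type) (S : Type) (h : H) (l : S -> H) (s : option S) : H :=
  if s is Some s' then l s' else h.

Definition lsum (H S1 S2 : Type) (l1 : S1 -> H) (l2 : S2 -> H) (s : S1 + S2) : H :=
  match s with inl s1 => l1 s1 | inr s2 => l2 s2 end.

Lemma lopt_inj (H S : Type) (h : H) (l : S -> H) :
  injective l -> (forall s, l s <> h) -> injective (lopt h l).
Proof.
by move=> li lh [x|] [y|] //= => [/li ->|/lh|/esym /lh].
Qed.

Lemma lopt_injr (H S : Type) (h : H) (l : S -> H) : injective (lopt h l) -> injective l.
Proof. by move=> li x y e; have [] := li (Some x) (Some y) e. Qed.

Lemma lopt_neq (H S : Type) (h : H) (l : S -> H) s : injective (lopt h l) -> l s <> h.
Proof. by move=> li e; have := li (Some s) None e. Qed.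

Lemma lsum_inj (H S1 S2 : Type) (l1 : S1 -> H) (l2 : S2 -> H) :
  injective l1 -> injective l2 -> (forall s1 s2, l1 s1 <> l2 s2) ->
  injective (lsum l1 l2).
Proof.
by move=> i1 i2 n [x|x] [y|y] //= => [/i1 ->|/n|/esym /n|/i2 ->].
Qed.

(** * Elements that carry their labels and genus *)

Section Packed.
Variables (k : fieldType) (M : genus_graded_functor k) (H : finType).
Implicit Types (L : {set H}) (h : H).

Definition flags L : finType := {h : H | h \in L}.
Definition lab L : flags L -> H := val.

Lemma lab_inj L : injective (@lab L).
Proof. exact: val_inj. Qed.

(* An element of [M(L; g)] for a finite set of labels [L] and a genus [g].  Keeping
   [L] and [g] in the element removes the bijections and the equalities of genera
   from the axioms of modular operads. *)
Definition packed := {L : {set H} & {g : nat & mspace M (flags L) g}}.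

Definition pack L g (x : mspace M (flags L) g) : packed :=
  existT _ L (existT (fun g => mspace M (flags L) g : Type) g x).

Definition pflags (X : packed) : {set H} := projT1 X.
Definition pgen (X : packed) : nat := projT1 (projT2 X).
Definition pval (X : packed) : mspace M (flags (pflags X)) (pgen X) := projT2 (projT2 X).

Lemma packK X : pack (pval X) = X.
Proof. by case: X => L [g x]. Qed.

(** For injective [l] this is [x] with its inputs renamed along [l]. Elements over different finite
    sets thus become elements of one type, and bijections that merely regroup sets disappear
    ([pk_mact]). *)
Definition pk (S : finType) (l : S -> H) g (x : mspace M S g) : packed :=
  pack (tr M l (@lab [set l s | s : S]) x : mspace M _ g).

Lemma codom_lab L h : (h \in codom (@lab L)) = (h \in L).
Proof.
apply/codomP/idP => [[s ->]|hL]; first exact: (valP s).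
by exists (exist _ h hL).
Qed.

Lemma imset_codom (S : finType) (l : S -> H) h :
  (h \in [set l s | s : S]) = (h \in codom l).
Proof. by apply/imsetP/codomP => [[s _ ->]|[s ->]]; exists s. Qed.

Lemma same_labels_lab (S : finType) (l : S -> H) L : injective l ->
  (forall h, (h \in codom l) = (h \in L)) -> same_labels l (@lab L).
Proof.
by move=> li lL; apply: same_labels_bij => // [|h]; [exact: lab_inj|rewrite codom_lab].
Qed.

Lemma pk_pack (S : finType) (l : S -> H) g (x : mspace M S g) L :
  (forall h, (h \in codom l) = (h \in L)) -> pk l x = pack (tr M l (@lab L) x : mspace M _ g).
Proof.
move=> lL; have -> : L = [set l s | s : S]; last by [].
by apply/setP => h; rewrite -lL imset_codom.
Qed.

Lemma pk_lab L g (x : mspace M (flags L) g) : pk (@lab L) x = pack x.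
Proof.
rewrite (@pk_pack _ _ _ _ L); last exact: codom_lab.
by rewrite tr_id //; apply: lab_inj.
Qed.

Lemma pk_mact (S S' : finType) (l : S -> H) (l' : S' -> H) g g' (f : bij S S')
    (e : g = g') x : injective l' -> l' \o f =1 l -> pk l' (mact M f e x) = pk l x.
Proof.
move=> l'i fl; case: g' / e.
rewrite (@pk_pack _ l' _ _ [set l s | s : S]); last first.
  move=> h; rewrite imset_codom; apply/codomP/codomP => [[s ->]|[s ->]].
    by exists (bij_inv f s); rewrite -fl /= bijVK.
  by exists (f s); rewrite -fl.
rewrite (@tr_mactl _ _ _ _ _ _ l) //; exact: lab_inj.
Qed.

Lemma pk_tr (S S' : finType) (l : S -> H) (l' : S' -> H) g (x : mspace M S g) :
  injective l -> injective l' -> (forall h, (h \in codom l) = (h \in codom l')) ->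
  pk l x = pk l' (tr M l l' x : mspace M S' g).
Proof.
move=> li l'i ll'; case: (same_labels_bij li l'i ll') => f fl.
by rewrite (@trE _ _ _ _ _ _ _ _ _ f erefl) // (pk_mact (l := l)).
Qed.

(** Any packed element can be written over a set of prescribed shape; this is how the flags to be
    glued are exposed as added points of [option]. *)
Lemma pk_view (X : packed) (S : finType) (l : S -> H) :
  injective l -> (forall h, (h \in codom l) = (h \in pflags X)) ->
  X = pk l (tr M (@lab (pflags X)) l (pval X) : mspace M S (pgen X)).
Proof.
move=> li lX; rewrite -{1}[X]packK -pk_lab; apply: pk_tr => // [|h].
  exact: lab_inj.
by rewrite codom_lab lX.
Qed.

Lemma pk_label_ext (S : finType) (l l' : S -> H) g (x : mspace M S g) :
  l =1 l' -> pk l x = pk l' x.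
Proof. by move=> /funext ->. Qed.

Lemma pflags_pk (S : finType) (l : S -> H) g (x : mspace M S g) h :
  (h \in pflags (pk l x)) = (h \in codom l).
Proof. exact: imset_codom. Qed.

Definition pscale (c : k) (X : packed) : packed := pack (c *: pval X).

Lemma pscaleA c d X : pscale c (pscale d X) = pscale (c * d) X.
Proof. by rewrite /pscale /= scalerA. Qed.

Lemma pscale1 X : pscale 1 X = X.
Proof. by rewrite /pscale scale1r packK. Qed.

Lemma pscale_pk c (S : finType) (l : S -> H) g (x : mspace M S g) :
  pscale c (pk l x) = pk l (c *: x).
Proof. by rewrite /pscale /pk /= (linearZ_ (@tr_linear _ M _ _ _ _ _ _ _)). Qed.

End Packed.
Arguments pack {k M H L g} x.
Arguments pk {k M H S} l {g} x.

(** * Gluing of packed elements *)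

Section PackedOps.
Variables (k : fieldType) (M : modular_operad k) (H : finType).
Implicit Types (L : {set H}) (h : H).
Local Notation packed := (packed M H).

(** The flags [h] and [h'] are first moved to the positions of the added points that [circ] glues.
    If one of them is not a flag, no compatible bijection exists and the value is 0. *)
Definition scirc h h' L1 L2 g1 g2 (x : mspace M (flags L1) g1) (y : mspace M (flags L2) g2) :
    mspace M (flags ((L1 :\ h) :|: (L2 :\ h'))) (g1 + g2) :=
  tr M (lsum (@lab _ (L1 :\ h)) (@lab _ (L2 :\ h'))) (@lab _ _)
    (circ (tr M (@lab _ L1) (lopt h (@lab _ (L1 :\ h))) x : mspace M _ g1)
          (tr M (@lab _ L2) (lopt h' (@lab _ (L2 :\ h'))) y : mspace M _ g2)).

Definition scontr h h' L g (x : mspace M (flags L) g) :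
    mspace M (flags (L :\ h :\ h')) (g + 1) :=
  contr M _ _ (tr M (@lab _ L) (lopt h (lopt h' (@lab _ (L :\ h :\ h')))) x : mspace M _ g).

Definition pcirc h h' (X Y : packed) : packed := pack (scirc h h' (pval X) (pval Y)).
Definition pcontr h h' (X : packed) : packed := pack (scontr h h' (pval X)).

Lemma scirc_linearl h h' L1 L2 g1 g2 y : linear (fun x => @scirc h h' L1 L2 g1 g2 x y).
Proof. by move=> a x x'; rewrite /scirc tr_linear circ_linearl tr_linear. Qed.

Lemma scirc_linearr h h' L1 L2 g1 g2 x : linear (@scirc h h' L1 L2 g1 g2 x).
Proof. by move=> a y y'; rewrite /scirc tr_linear circ_linearr tr_linear. Qed.

Lemma scontr_linear h h' L g : linear (@scontr h h' L g).
Proof. by move=> a x y; rewrite /scontr tr_linear gmap_linear. Qed.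

Lemma scirc_homog h h' L1 L2 g1 g2 d e x y :
  homog d x -> homog e y -> homog (d + e) (@scirc h h' L1 L2 g1 g2 x y).
Proof. by move=> xd ye; apply/tr_homog/circ_homog; apply: tr_homog. Qed.

Lemma scontr_homog h h' L g d x : homog d x -> homog d (@scontr h h' L g x).
Proof. by move=> xd; apply/gmap_homog/tr_homog. Qed.

Lemma codom_lopt (S : finType) h (l : S -> H) h' :
  (h' \in codom (lopt h l)) = (h' == h) || (h' \in codom l).
Proof.
apply/codomP/orP => [[[s|] ->]|[/eqP ->|/codomP [s ->]]].
- by right; apply: codom_f.
- by left; apply: eqxx.
- by exists None.
- by exists (Some s).
Qed.

Lemma codom_lsum (S1 S2 : finType) (l1 : S1 -> H) (l2 : S2 -> H) h :
  (h \in codom (lsum l1 l2)) = (h \in codom l1) || (h \in codom l2).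
Proof.
apply/codomP/orP => [[[s|s] ->]|[/codomP [s ->]|/codomP [s ->]]].
- by left; apply: codom_f.
- by right; apply: codom_f.
- by exists (inl s).
- by exists (inr s).
Qed.

Lemma lopt_codomN (S : finType) h (l : S -> H) : injective (lopt h l) -> h \notin codom l.
Proof. by move=> li; apply/negP => /codomP [s] /esym /(lopt_neq li). Qed.

Lemma codom_lopt_remove (S : finType) h (l : S -> H) h' : injective (lopt h l) ->
  (h' \in [set lopt h l s | s : option S] :\ h) = (h' \in codom l).
Proof.
move=> li; rewrite !inE imset_codom codom_lopt.
by have [->|] := eqVneq h' h; rewrite ?(negbTE (lopt_codomN li)).
Qed.

Lemma same_labels_lopt (S S' : finType) h (l : S -> H) (l' : S' -> H) (f : bij S S') :
  l' \o f =1 l -> lopt h l' \o bij_opt f =1 lopt h l.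
Proof. by move=> fl [s|] //=; rewrite -fl. Qed.

Lemma lsum_bij (S1 S1' S2 S2' : finType) (l1 : S1 -> H) (l1' : S1' -> H)
    (l2 : S2 -> H) (l2' : S2' -> H) (f1 : bij S1 S1') (f2 : bij S2 S2') :
  l1' \o f1 =1 l1 -> l2' \o f2 =1 l2 ->
  lsum l1' l2' \o bij_sum f1 f2 =1 lsum l1 l2.
Proof. by move=> fl1 fl2 [s|s] /=; rewrite -?fl1 -?fl2. Qed.

(** By naturality of [circ], gluing may be computed on any labelled representatives in which the
    glued flags are the added points. This lemma and [pcontr_pk] translate each axiom of [M] into an
    equation of packed elements. *)
Lemma pcirc_pk (S1 S2 : finType) h h' (l1 : S1 -> H) (l2 : S2 -> H) g1 g2
    (x : mspace M (option S1) g1) (y : mspace M (option S2) g2) :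
  injective (lopt h l1) -> injective (lopt h' l2) -> injective (lsum l1 l2) ->
  pcirc h h' (pk (lopt h l1) x) (pk (lopt h' l2) y) = pk (lsum l1 l2) (circ x y).
Proof.
move=> i1 i2 i12.
set L1 := [set lopt h l1 s | s : option S1].
set L2 := [set lopt h' l2 s | s : option S2].
have [f1 fl1] : same_labels l1 (@lab _ (L1 :\ h)).
  by apply: same_labels_lab => [|h1]; [exact: lopt_injr i1|rewrite codom_lopt_remove].
have [f2 fl2] : same_labels l2 (@lab _ (L2 :\ h')).
  by apply: same_labels_lab => [|h1]; [exact: lopt_injr i2|rewrite codom_lopt_remove].
have N L h0 : injective (lopt h0 (@lab _ (L :\ h0))).
  apply: lopt_inj; first exact: lab_inj.
  by move=> s; apply/eqP; have := valP s; rewrite !inE => /andP[].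
have lf1 := same_labels_lopt h fl1; have lf2 := same_labels_lopt h' fl2.
rewrite /pcirc /pk /= /scirc -/L1 -/L2.
rewrite [tr M (lab (L := L1)) _ _]tr_comp //; [|exact: lab_inj| | ]; last first.
- by apply: same_labels_lab => // h1; rewrite imset_codom.
- exact: N.
rewrite [tr M (lab (L := L2)) _ _]tr_comp //; [|exact: lab_inj| | ]; last first.
- by apply: same_labels_lab => // h1; rewrite imset_codom.
- exact: N.
rewrite (trE (f := bij_opt f1) (erefl g1)) //; last exact: N.
rewrite (trE (f := bij_opt f2) (erefl g2)) //; last exact: N.
rewrite -circ_natural (@tr_mactl _ _ _ _ _ _ (lsum l1 l2)); last 1 first.
- exact: lsum_bij.
- rewrite -pk_pack // => h1; rewrite codom_lsum !in_setU.
  by rewrite /L1 /L2 !codom_lopt_remove.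
(* Injectivity of the joint labelling of the two remaining flag sets is inherited from [lsum l1 l2]
   along the bijection [bij_sum f1 f2]. *)
- move=> s s' e.
  have [t ts] : exists t, bij_sum f1 f2 t = s by exists (bij_inv (bij_sum f1 f2) s); rewrite bijVK.
  have [t' ts'] : exists t, bij_sum f1 f2 t = s' by exists (bij_inv (bij_sum f1 f2) s'); rewrite bijVK.
  rewrite -ts -ts'; congr (bij_sum f1 f2 _); apply: i12.
  rewrite -!(lsum_bij fl1 fl2) /= -/(bij_sum f1 f2 _).
  by move: e; rewrite -ts -ts'.
- exact: lab_inj.
Qed.

Lemma pcontr_pk (S : finType) h h' (l : S -> H) g (x : mspace M (option (option S)) g) :
  injective (lopt h (lopt h' l)) ->
  pcontr h h' (pk (lopt h (lopt h' l)) x) = pk l (contr M S g x).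
Proof.
move=> i1; have i2 := lopt_injr i1.
set L := [set lopt h (lopt h' l) s | s : option (option S)].
have LE h1 : (h1 \in codom l) = (h1 \in L :\ h :\ h').
  rewrite in_setD1 /L codom_lopt_remove //.
  rewrite codom_lopt; have [->|//] := eqVneq h1 h'.
  by rewrite (negbTE (lopt_codomN i2)).
have [f fl] : same_labels l (@lab _ (L :\ h :\ h')).
  by apply: same_labels_lab => //; exact: lopt_injr i2.
have N : injective (lopt h (lopt h' (@lab _ (L :\ h :\ h')))).
  have vi (s : flags (L :\ h :\ h')) : lab s \in L :\ h :\ h' by exact: (valP s).
  apply: lopt_inj; first apply: lopt_inj; first exact: lab_inj.
  - by move=> s; apply/eqP; have := vi s; rewrite !inE => /andP[].
  - move=> [s|] /=; first by apply/eqP; have := vi s; rewrite !inE => /and3P[].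
    by have := lopt_neq (s := None) i1.
rewrite /pcontr /pk /= /scontr -/L.
rewrite [tr M (lab (L := L)) _ _]tr_comp //; [|exact: lab_inj|]; last first.
- by apply: same_labels_lab => // h1; rewrite imset_codom.
rewrite (trE (f := bij_opt (bij_opt f)) (erefl g)) //; last first.
  by do 2!apply: same_labels_lopt.
rewrite -contr_natural.
rewrite -(@trE _ _ _ _ _ l (@lab _ (L :\ h :\ h'))) //; last exact: lab_inj.
by rewrite -pk_pack.
Qed.

End PackedOps.

(** All regroupings of labels that occur in one axiom factor through a single injective labelling
    [J]. The tactic [relabel] takes the map [i] that says where each label sits in [J] and settles
    the rest by case analysis. *)
Lemma inj_via (A B H : Type) (J : A -> H) (Ji : injective J) (i : B -> A) (m : B -> H) :
  injective i -> J \o i =1 m -> injective m.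
Proof. by move=> ii Jm x y; rewrite -!Jm => /Ji /ii. Qed.

Ltac split_labels :=
  try match goal with |- injective _ => rewrite /injective | |- _ =1 _ => rewrite /eqfun end;
  repeat match goal with
  | |- forall x : ?T, _ =>
    let T' := eval hnf in T in
    lazymatch T' with
    | option _ => case
    | (_ + _)%type => case
    | _ => move=> ?
    end
  end.
Tactic Notation "relabel" constr(J) uconstr(i) := refine (@inj_via _ _ _ _ J i _ _ _);
  [by split_labels; try congruence | by split_labels].

(** * The axioms of modular operads for packed elements *)

Section PackedAxioms.
Variables (k : fieldType) (M : modular_operad k) (H : finType).
Implicit Types (L : {set H}) (h a b c d : H).
Local Notation packed := (packed M H).

Definition phomog (d : int) (X : packed) : Prop := homog d (pval X).

Lemma lopt_step (S : finType) (l : S -> H) (A B : {pred H}) h :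
  h \in A -> (forall x, (x \in B) = (x != h) && (x \in A)) ->
  injective l /\ codom l =i B -> injective (lopt h l) /\ codom (lopt h l) =i A.
Proof.
move=> hA BE [li lB]; split.
  apply: lopt_inj => // s; apply/eqP.
  have := codom_f l s; rewrite lB BE => /andP[].
  by [].
move=> x; rewrite codom_lopt lB BE; case: eqVneq => [->|] //=.
Qed.

Lemma lab_step L : injective (@lab H L) /\ codom (@lab H L) =i L.
Proof. by split; [exact: lab_inj|move=> h; rewrite codom_lab]. Qed.

(** The lemmas [view1] to [view4] expose prescribed flags as outermost added points. Degrees are
    recorded here because the symmetry of [pcirc] carries a sign. *)
Lemma view1 (X : packed) a : a \in pflags X ->
  exists (S : finType) (l : S -> H) (g : nat) (x : mspace M (option S) g),
  [/\ X = pk (lopt a l) x, injective (lopt a l), codom (lopt a l) =i pflags X &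
      forall n : int, phomog n X -> homog n x].
Proof.
move=> aX; pose l := lopt a (@lab H (pflags X :\ a)).
have [li lX] : injective l /\ codom l =i pflags X.
  apply: (lopt_step (B := pflags X :\ a) aX) => [x|]; last exact: lab_step.
  by rewrite in_setD1.
exists (flags (pflags X :\ a)), (@lab H (pflags X :\ a)).
exists (pgen X), (tr M (@lab H _) l (pval X)); split=> //; first exact: pk_view.
by move=> d; apply: tr_homog.
Qed.

Lemma view2 (X : packed) a b : uniq [:: a; b] -> {subset [:: a; b] <= pflags X} ->
  exists (S : finType) (l : S -> H) (g : nat) (x : mspace M (option (option S)) g),
  [/\ X = pk (lopt a (lopt b l)) x, injective (lopt a (lopt b l)) &
      codom (lopt a (lopt b l)) =i pflags X].
Proof.
move=> u sX; pose Y := [set x in pflags X | x \notin [:: a; b]].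
pose l := lopt a (lopt b (@lab H Y)).
have [li lX] : injective l /\ codom l =i pflags X.
  apply: (@lopt_step _ _ _ [set x in pflags X | x != a]).
  - by apply: sX; rewrite inE eqxx.
  - by move=> x; rewrite !inE andbC.
  apply: (@lopt_step _ _ _ Y).
  - by rewrite inE sX ?inE ?eqxx ?orbT //; move: u; rewrite /= inE andbT eq_sym.
  - by move=> x; rewrite !inE negb_or; do !case: (_ \in _); do !case: (_ == _).
  exact: lab_step.
exists (flags Y), (@lab H Y), (pgen X), (tr M (@lab H _) l (pval X)); split=> //.
exact: pk_view.
Qed.

Lemma view3 (X : packed) a b c : uniq [:: a; b; c] -> {subset [:: a; b; c] <= pflags X} ->
  exists (S : finType) (l : S -> H) (g : nat) (x : mspace M (option (option (option S))) g),
  [/\ X = pk (lopt a (lopt b (lopt c l))) x, injective (lopt a (lopt b (lopt c l))) &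
      codom (lopt a (lopt b (lopt c l))) =i pflags X].
Proof.
move=> u sX; pose Y := [set x in pflags X | x \notin [:: a; b; c]].
move: (u); rewrite /= !inE !negb_or !andbT => /andP[/andP[ab ac] bc].
pose l := lopt a (lopt b (lopt c (@lab H Y))).
have [li lX] : injective l /\ codom l =i pflags X.
  apply: (@lopt_step _ _ _ [set x in pflags X | x != a]).
  - by apply: sX; rewrite inE eqxx.
  - by move=> x; rewrite !inE andbC.
  apply: (@lopt_step _ _ _ [set x in pflags X | x \notin [:: a; b]]).
  - by rewrite inE sX ?inE ?eqxx ?orbT // eq_sym ab.
  - by move=> x; rewrite !inE negb_or; do !case: (_ \in _); do !case: (_ == _).
  apply: (@lopt_step _ _ _ Y).
  - by rewrite !inE sX ?inE ?eqxx ?orbT // ![c == _]eq_sym negb_or ac bc.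
  - by move=> x; rewrite !inE !negb_or; do !case: (_ \in _); do !case: (_ == _).
  exact: lab_step.
exists (flags Y), (@lab H Y), (pgen X), (tr M (@lab H _) l (pval X)); split=> //.
exact: pk_view.
Qed.

Lemma view4 (X : packed) a b c d : uniq [:: a; b; c; d] ->
  {subset [:: a; b; c; d] <= pflags X} ->
  exists (S : finType) (l : S -> H)
    (g : nat) (x : mspace M (option (option (option (option S)))) g),
    X = pk (lopt a (lopt b (lopt c (lopt d l)))) x /\
    injective (lopt a (lopt b (lopt c (lopt d l)))).
Proof.
move=> u sX; pose Y := [set x in pflags X | x \notin [:: a; b; c; d]].
move: (u); rewrite /= !inE !negb_or !andbT => /and3P[/and3P[ab ac ad] /andP[bc bd] cd].
pose l := lopt a (lopt b (lopt c (lopt d (@lab H Y)))).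
have [li lX] : injective l /\ codom l =i pflags X.
  apply: (@lopt_step _ _ _ [set x in pflags X | x != a]).
  - by apply: sX; rewrite inE eqxx.
  - by move=> x; rewrite !inE andbC.
  apply: (@lopt_step _ _ _ [set x in pflags X | x \notin [:: a; b]]).
  - by rewrite inE sX ?inE ?eqxx ?orbT // eq_sym ab.
  - by move=> x; rewrite !inE negb_or; do !case: (_ \in _); do !case: (_ == _).
  apply: (@lopt_step _ _ _ [set x in pflags X | x \notin [:: a; b; c]]).
  - by rewrite !inE sX ?inE ?eqxx ?orbT // ![c == _]eq_sym negb_or ac bc.
  - by move=> x; rewrite !inE !negb_or; do !case: (_ \in _); do !case: (_ == _).
  apply: (@lopt_step _ _ _ Y).
  - by rewrite !inE sX ?inE ?eqxx ?orbT // ![d == _]eq_sym !negb_or ad bd cd.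
  - by move=> x; rewrite !inE !negb_or; do !case: (_ \in _); do !case: (_ == _).
  exact: lab_step.
exists (flags Y), (@lab H Y), (pgen X), (tr M (@lab H _) l (pval X)); split=> //.
exact: pk_view.
Qed.

Lemma lsum_disjoint (S1 S2 : finType) (l1 : S1 -> H) (l2 : S2 -> H) (A B : {pred H}) :
  injective l1 -> injective l2 -> codom l1 =i A -> codom l2 =i B -> [disjoint A & B] ->
  injective (lsum l1 l2).
Proof.
move=> i1 i2 c1 c2 /pred0P dis; apply: lsum_inj => // s1 s2 e.
by have := dis (l1 s1); rewrite /= -c1 codom_f -c2 e codom_f.
Qed.

Lemma pcirc_sym (X Y : packed) h h' (dX dY : int) :
  phomog dX X -> phomog dY Y -> h \in pflags X -> h' \in pflags Y ->
  [disjoint pflags X & pflags Y] ->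
  pcirc h h' X Y = pscale ((-1) ^+ absz (dX * dY)) (pcirc h' h Y X).
Proof.
move=> Xd Yd /view1 [S1 [l1 [gx [x [XE i1 c1 hx]]]]] /view1 [S2 [l2 [gy [y [YE i2 c2 hy]]]]] dis.
have J := lsum_disjoint i1 i2 c1 c2 dis.
move: (hx _ Xd) (hy _ Yd) => {}hx {}hy.
have J1 : injective (lsum l1 l2).
  relabel J (fun z : S1 + S2 => match z with inl z => inl (Some z) | inr z => inr (Some z) end).
have J2 : injective (lsum l2 l1).
  relabel J (fun z : S2 + S1 => match z with inl z => inr (Some z) | inr z => inl (Some z) end).
rewrite XE YE !pcirc_pk // pscale_pk (circ_sym hx hy) -!pscale_pk.
congr pscale; apply: pk_mact => //; by split_labels.
Qed.

Lemma pcontr_sym (X : packed) h h' : h != h' -> h \in pflags X -> h' \in pflags X ->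
  pcontr h h' X = pcontr h' h X.
Proof.
move=> hh' hX h'X; have [||S [l [gx [x [XE J cX]]]]] := @view2 X h h'.
- by rewrite /= inE hh'.
- by move=> y; rewrite !inE => /orP[] /eqP ->.
have J' : injective (lopt h' (lopt h l)).
  relabel J (fun z : option (option S) => match z with
     None => Some None | Some None => None | Some (Some z) => Some (Some z) end).
rewrite {1}XE pcontr_pk // -contr_sym.
rewrite -(pcontr_pk (h := h') (h' := h)) // XE; congr pcontr.
by apply: pk_mact => //; split_labels.
Qed.

Lemma pcirc_assoc (X Y Z : packed) h h' p q :
  h \in pflags X -> h' \in pflags Y -> p \in pflags Y -> h' != p -> q \in pflags Z ->
  [disjoint pflags X & pflags Y] -> [disjoint pflags X & pflags Z] ->
  [disjoint pflags Y & pflags Z] ->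
  pcirc h h' X (pcirc p q Y Z) = pcirc p q (pcirc h h' X Y) Z.
Proof.
move=> hX h'Y pY h'p qZ dXY dXZ dYZ.
have [S1 [l1 [gx [x [XE i1 c1 _]]]]] := view1 hX.
have [S3 [l3 [gz [z [ZE i3 c3 _]]]]] := view1 qZ.
(* The flag [p] glued to [Z] is put outermost, as [circ_assoc] expects on its left-hand side; on the
   right-hand side [bij_swap] brings [h'] outermost instead. *)
have [||S2 [l2 [gy [y [YE i2 c2]]]]] := @view2 Y p h'.
- by rewrite /= inE eq_sym h'p.
- by move=> y; rewrite !inE => /orP[] /eqP ->.
have J : injective (lsum (lopt h l1) (lsum (lopt p (lopt h' l2)) (lopt q l3))).
  apply: (lsum_disjoint i1 _ c1 (B := [predU pflags Y & pflags Z])).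
  - exact: lsum_disjoint i2 i3 c2 c3 dYZ.
  - by move=> t; rewrite codom_lsum c2 c3.
  - by rewrite disjoint_sym disjointU !(disjoint_sym _ (mem (pflags X))) dXY.
have J1 : injective (lopt h' (lsum l2 l3)).
  relabel J (fun t : option (S2 + S3) => match t with
     None => inr (inl (Some None)) | Some (inl t) => inr (inl (Some (Some t)))
   | Some (inr t) => inr (inr (Some t)) end).
have J2 : injective (lsum (lopt h' l2) l3).
  relabel J (fun t : option S2 + S3 => match t with
     inl None => inr (inl (Some None)) | inl (Some t) => inr (inl (Some (Some t)))
   | inr t => inr (inr (Some t)) end).
have J3 : injective (lsum l1 (lsum l2 l3)).
  relabel J (fun t : S1 + (S2 + S3) => match t with
     inl t => inl (Some t) | inr (inl t) => inr (inl (Some (Some t)))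
   | inr (inr t) => inr (inr (Some t)) end).
have J4 : injective (lopt h' (lopt p l2)).
  relabel J (fun t : option (option S2) => match t with
     None => inr (inl (Some None)) | Some None => inr (inl None)
   | Some (Some t) => inr (inl (Some (Some t))) end).
have J5 : injective (lsum l1 (lopt p l2)).
  relabel J (fun t : S1 + option S2 => match t with
     inl t => inl (Some t) | inr None => inr (inl None)
   | inr (Some t) => inr (inl (Some (Some t))) end).
have J6 : injective (lopt p (lsum l1 l2)).
  relabel J (fun t : option (S1 + S2) => match t with
     None => inr (inl None) | Some (inl t) => inl (Some t)
   | Some (inr t) => inr (inl (Some (Some t))) end).
have J7 : injective (lsum (lsum l1 l2) l3).
  relabel J (fun t : (S1 + S2) + S3 => match t with
     inl (inl t) => inl (Some t) | inl (inr t) => inr (inl (Some (Some t)))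
   | inr t => inr (inr (Some t)) end).
rewrite XE ZE {1}YE pcirc_pk //.
rewrite -(@pk_mact _ _ _ _ _ _ (lopt h' (lsum l2 l3)) _ _ (bij_optl S2 S3) erefl) //;
  last by split_labels.
rewrite pcirc_pk //.
rewrite -(@pk_mact _ _ _ _ _ _ (lsum (lsum l1 l2) l3) _ _ (bij_sumA S1 S2 S3)
   (addnA _ _ _)) //; last by split_labels.
rewrite circ_assoc -(@pcirc_pk _ _ _ _ _ p q) //; congr pcirc.
rewrite (@pk_mact _ _ _ _ _ (lsum l1 (lopt p l2))) //; last by split_labels.
rewrite -(@pcirc_pk _ _ _ _ _ h h') //; congr pcirc; rewrite [RHS]YE.
by apply: pk_mact => //; split_labels.
Qed.

Lemma pcontr_contr (X : packed) a b c d : uniq [:: a; b; c; d] ->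
  {subset [:: a; b; c; d] <= pflags X} ->
  pcontr c d (pcontr a b X) = pcontr a b (pcontr c d X).
Proof.
move=> u sX; have [S [l [gx [x [XE J]]]]] := view4 u sX.
have J1 : injective (lopt c (lopt d (lopt a (lopt b l)))).
  relabel J (fun t : option (option (option (option S))) => match t with
     None => Some (Some None) | Some None => Some (Some (Some None))
   | Some (Some None) => None | Some (Some (Some None)) => Some None
   | Some (Some (Some (Some t))) => Some (Some (Some (Some t))) end).
rewrite {1}XE pcontr_pk // pcontr_pk; last by exact: lopt_injr (lopt_injr J).
rewrite contr_contr -(pcontr_pk (h := a) (h' := b)); last by exact: lopt_injr (lopt_injr J1).
rewrite -(pcontr_pk (h := c) (h' := d)) //; congr (pcontr _ _ (pcontr _ _ _)); rewrite XE.
by apply: pk_mact => //; split_labels.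
Qed.

Lemma pcontr_circ (X Y : packed) a b c d : a != c -> b != d ->
  a \in pflags X -> c \in pflags X -> b \in pflags Y -> d \in pflags Y ->
  [disjoint pflags X & pflags Y] ->
  pcontr c d (pcirc a b X Y) = pcontr a b (pcirc c d X Y).
Proof.
move=> ac bd aX cX bY dY dis.
have [||S1 [l1 [gx [x [XE i1 c1]]]]] := @view2 X a c.
- by rewrite /= inE ac.
- by move=> y; rewrite !inE => /orP[] /eqP ->.
have [||S2 [l2 [gy [y [YE i2 c2]]]]] := @view2 Y b d.
- by rewrite /= inE bd.
- by move=> y; rewrite !inE => /orP[] /eqP ->.
have J := lsum_disjoint i1 i2 c1 c2 dis.
have J1 : injective (lsum (lopt c l1) (lopt d l2)).
  relabel J (fun t : option S1 + option S2 => match t with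
     inl t => inl (Some t) | inr t => inr (Some t) end).
have J2 : injective (lopt c (lopt d (lsum l1 l2))).
  relabel J (fun t : option (option (S1 + S2)) => match t with
     None => inl (Some None) | Some None => inr (Some None)
   | Some (Some (inl t)) => inl (Some (Some t))
   | Some (Some (inr t)) => inr (Some (Some t)) end).
have J3 : injective (lsum (lopt a l1) (lopt b l2)).
  relabel J (fun t : option S1 + option S2 => match t with
     inl None => inl None | inl (Some t) => inl (Some (Some t))
   | inr None => inr None | inr (Some t) => inr (Some (Some t)) end).
have J4 : injective (lopt a (lopt b (lsum l1 l2))).
  relabel J (fun t : option (option (S1 + S2)) => match t with
     None => inl None | Some None => inr None
   | Some (Some (inl t)) => inl (Some (Some t))
   | Some (Some (inr t)) => inr (Some (Some t)) end).
have J5 : injective (lopt c (lopt a l1)).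
  relabel J (fun t : option (option S1) => match t with
     None => inl (Some None) | Some None => inl None
   | Some (Some t) => inl (Some (Some t)) end).
have J6 : injective (lopt d (lopt b l2)).
  relabel J (fun t : option (option S2) => match t with
     None => inr (Some None) | Some None => inr None
   | Some (Some t) => inr (Some (Some t)) end).
rewrite {1}XE {1}YE pcirc_pk //.
rewrite -(@pk_mact _ _ _ _ _ _ (lopt c (lopt d (lsum l1 l2))) _ _ (bij_opt2 S1 S2) erefl) //;
  last by split_labels.
rewrite pcontr_pk // contr_circ -(pcontr_pk (h := a) (h' := b)) //; congr pcontr.
rewrite (@pk_mact _ _ _ _ _ (lsum (lopt a l1) (lopt b l2))) //; last by split_labels.
rewrite -(@pcirc_pk _ _ _ _ _ c d) //; congr pcirc; rewrite ?XE ?YE;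
  by apply: pk_mact => //; split_labels.
Qed.

Lemma pcirc_contr (X Y : packed) a b u v : uniq [:: u; v; a] ->
  {subset [:: u; v; a] <= pflags X} -> b \in pflags Y ->
  [disjoint pflags X & pflags Y] ->
  pcirc a b (pcontr u v X) Y = pcontr u v (pcirc a b X Y).
Proof.
move=> un sX bY dis.
have [S1 [l1 [gx [x [XE i1 c1]]]]] := view3 un sX.
have [S2 [l2 [gy [y [YE i2 c2 _]]]]] := view1 bY.
have J := lsum_disjoint i1 i2 c1 c2 dis.
have J1 : injective (lopt a l1) by exact: lopt_injr (lopt_injr i1).
have J2 : injective (lsum l1 l2).
  relabel J (fun t : S1 + S2 => match t with
     inl t => inl (Some (Some (Some t))) | inr t => inr (Some t) end).
have J3 : injective (lopt u (lopt v (lsum l1 l2))).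
  relabel J (fun t : option (option (S1 + S2)) => match t with
     None => inl None | Some None => inl (Some None)
   | Some (Some (inl t)) => inl (Some (Some (Some t)))
   | Some (Some (inr t)) => inr (Some t) end).
have J4 : injective (lsum (lopt u (lopt v l1)) l2).
  relabel J (fun t : option (option S1) + S2 => match t with
     inl None => inl None | inl (Some None) => inl (Some None)
   | inl (Some (Some t)) => inl (Some (Some (Some t)))
   | inr t => inr (Some t) end).
have J5 : injective (lopt a (lopt u (lopt v l1))).
  relabel J (fun t : option (option (option S1)) => match t with
     None => inl (Some (Some None)) | Some None => inl None
   | Some (Some None) => inl (Some None)
   | Some (Some (Some t)) => inl (Some (Some (Some t))) end).
rewrite {1}XE YE pcontr_pk // pcirc_pk //.
rewrite -(@pk_mact _ _ _ _ _ _ (lsum l1 l2) _ _ (bij_id _) (addnAC _ _ _)) //.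
rewrite circ_contr -(pcontr_pk (h := u) (h' := v)) //; congr pcontr.
rewrite (@pk_mact _ _ _ _ _ (lsum (lopt u (lopt v l1)) l2)) //; last by split_labels.
rewrite -(@pcirc_pk _ _ _ _ _ a b) //; congr pcirc; rewrite XE.
by apply: pk_mact => //; split_labels.
Qed.

End PackedAxioms.

(** * Contraction trees *)

(* The order in which the edges of a graph are contracted: [Contr h h'] contracts
   the loop with half-edges [h] and [h'], [Circ h h'] the edge joining two
   disjoint subgraphs. *)
Inductive tree (V H : Type) : Type :=
| Leaf (v : V)
| Contr (h h' : H) (t : tree V H)
| Circ (h h' : H) (t1 t2 : tree V H).
Arguments Leaf {V H} v.

Lemma odd_abszD (x y : int) : odd (absz (x + y)) = odd (absz x) (+) odd (absz y).
Proof. lia. Qed.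

Lemma odd_absz_sum (I : finType) (P : pred I) (F : I -> int) :
  odd (absz (\sum_(i | P i) F i)) = \big[addb/false]_(i | P i) odd (absz (F i)).
Proof. by apply: (big_morph (fun x : int => odd (absz x)) odd_abszD). Qed.

Lemma big_disjointU (R : Type) (idx : R) (op : Monoid.com_law idx) (I : finType)
    (A B : {set I}) (F : I -> R) : [disjoint A & B] ->
  \big[op/idx]_(i in A :|: B) F i =
  op (\big[op/idx]_(i in A) F i) (\big[op/idx]_(i in B) F i).
Proof. by move=> dis; rewrite -bigU //; apply: eq_bigl => i; rewrite !inE. Qed.

(** * Shuffle signs *)

Section Sign.
Variables (n : nat) (D : 'I_n -> bool).
Implicit Types (A B : {set 'I_n}).

(* The exponent of the Koszul sign of the shuffle that sorts the juxtaposition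
   of the increasing enumerations of [A] and [B]. *)
Definition sg (A B : {set 'I_n}) : bool :=
  \big[addb/false]_(u in A) \big[addb/false]_(v in B | (v < u)%N) (D u && D v).

Lemma sgUl A A' B : [disjoint A & A'] -> sg (A :|: A') B = sg A B (+) sg A' B.
Proof. by move=> dis; rewrite /sg big_disjointU. Qed.

Lemma sgUr A B B' : [disjoint B & B'] -> sg A (B :|: B') = sg A B (+) sg A B'.
Proof.
move=> dis; rewrite /sg -big_split /=; apply: eq_bigr => u _.
by rewrite !big_mkcondr big_disjointU.
Qed.

(** Every pair of a point of [A] and a point of [B] is an inversion in exactly one of the two
    juxtapositions, so together they count all pairs. *)
Lemma sg_swap A B : [disjoint A & B] ->
  sg A B (+) sg B A =
  (\big[addb/false]_(u in A) D u) && (\big[addb/false]_(v in B) D v).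
Proof.
move=> dis; rewrite /sg.
rewrite [X in _ (+) X](exchange_big_dep (mem A)) /=; last by move=> u v _ /andP[].
rewrite -big_split big_distrl /=; apply: eq_bigr => u uA.
rewrite big_distrr /= [RHS](bigID (fun v : 'I_n => v < u)%N) /=; congr addb.
under eq_bigl => v do rewrite uA /=; apply: eq_big => [v|v _]; last exact: andbC.
case: (boolP (v \in B)) => //= vB; rewrite -leqNgt ltn_neqAle.
case: eqP => // /val_inj uv; move/pred0P: dis => /(_ u) /=.
by rewrite uA uv vB.
Qed.

End Sign.

(** * Combinatorics of contraction trees *)

Section Trees.
Variables (k : fieldType) (M : modular_operad k).
Variables (n : nat) (H : finType) (att : H -> 'I_n) (flip : H -> H).
Hypothesis flipK : involutive flip.
Variables (gen : 'I_n -> nat).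
Local Notation tree := (tree 'I_n H).
Implicit Types (t s : tree) (h p : H).

Definition vflags (v : 'I_n) : {set H} := [set h | att h == v].

Fixpoint tV t : {set 'I_n} :=
  match t with
  | Leaf v => [set v]
  | Contr _ _ t => tV t
  | Circ _ _ t1 t2 => tV t1 :|: tV t2
  end.

Fixpoint tL t : {set H} :=
  match t with
  | Leaf v => vflags v
  | Contr h h' t => tL t :\ h :\ h'
  | Circ h h' t1 t2 => (tL t1 :\ h) :|: (tL t2 :\ h')
  end.

Fixpoint tG t : nat :=
  match t with
  | Leaf v => gen v
  | Contr _ _ t => tG t + 1
  | Circ _ _ t1 t2 => tG t1 + tG t2
  end%N.

Fixpoint wf t : bool :=
  match t with
  | Leaf v => true
  | Contr h h' t => [&& wf t, h' == flip h, h != h', h \in tL t & h' \in tL t]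
  | Circ h h' t1 t2 =>
    [&& wf t1, wf t2, h' == flip h, h \in tL t1, h' \in tL t2 & [disjoint tV t1 & tV t2]]
  end.

(** The half-edges of the edges contracted somewhere in [t]; see [tC_Contr] and [tC_Circ]. *)
Definition tC t : {set H} := [set h | (att h \in tV t) && (h \notin tL t)].

Lemma eq_tC t t' : tV t = tV t' -> tL t = tL t' -> tC t = tC t'.
Proof. by rewrite /tC => -> ->. Qed.

Lemma tL_att t h : h \in tL t -> att h \in tV t.
Proof.
elim: t => [v|p p' t IH|p p' t1 IH1 t2 IH2] /=; first by rewrite !inE.
  by rewrite !inE => /and3P[_ _ /IH].
by rewrite !inE => /orP[/andP[_ /IH1 ->]|/andP[_ /IH2 ->]]; rewrite ?orbT.
Qed.

Lemma tL_disjoint t1 t2 : [disjoint tV t1 & tV t2] -> [disjoint tL t1 & tL t2].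
Proof.
move=> dis; apply/pred0P => h /=; apply/negP => /andP[/tL_att h1 /tL_att h2].
by move/pred0P: dis => /(_ (att h)) /=; rewrite h1 h2.
Qed.

Lemma tV_disj t1 t2 v : [disjoint tV t1 & tV t2] -> v \in tV t1 -> v \in tV t2 -> False.
Proof. by move=> /pred0P /(_ v) /=; case: (_ \in _); case: (_ \in _). Qed.

Lemma tL_disj t1 t2 h : [disjoint tV t1 & tV t2] -> h \in tL t1 -> h \in tL t2 -> False.
Proof. by move=> dis /tL_att h1 /tL_att h2; apply: (tV_disj dis h1 h2). Qed.

Lemma tC_Contr h h' t : wf (Contr h h' t) -> tC (Contr h h' t) = [set h; h'] :|: tC t.
Proof.
move=> /and5P[_ _ _ ht h't]; apply/setP => p; rewrite !inE /= ?inE.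
case: eqVneq => [->|_] /=; first by rewrite (tL_att h't) orbT.
by case: eqVneq => [->|_] /=; rewrite ?(tL_att ht).
Qed.

Lemma tC_Circ h h' t1 t2 : wf (Circ h h' t1 t2) ->
  tC (Circ h h' t1 t2) = [set h; h'] :|: (tC t1 :|: tC t2).
Proof.
move=> /and5P[_ _ _ ht1 /andP[h't2 dis]]; apply/setP => p; rewrite !inE /= ?inE.
case: (eqVneq p h) => [->|_] /=.
  rewrite (tL_att ht1) /=; apply/negP => /andP[_ ht2]; exact: tL_disj dis ht1 ht2.
case: (eqVneq p h') => [->|_] /=.
  rewrite (tL_att h't2) orbT orbF /=; apply/negP => h't1; exact: tL_disj dis h't1 h't2.
case: (boolP (att p \in tV t1)) => [p1|p1] /=.
  have p2 : att p \notin tV t2 by apply/negP => /(tV_disj dis p1).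
  rewrite (negbTE p2) orbF; case: (boolP (p \in tL t2)) => [/tL_att|]; last by rewrite orbF.
  by rewrite (negbTE p2).
case: (boolP (p \in tL t1)) => [/tL_att|//].
by rewrite (negbTE p1).
Qed.

Lemma tC_flip t h : wf t -> h \in tC t -> (flip h \in tC t) && (flip h != h).
Proof.
elim: t h => [v|p p' t IH|p p' t1 IH1 t2 IH2] h.
- by rewrite !inE /= ?inE => _ /andP[->].
- move=> w; rewrite !tC_Contr //; case/and5P: w => w /eqP -> pp' _ _.
  rewrite !inE => /orP[/orP[] /eqP ->|hC].
  + by rewrite eqxx orbT /= eq_sym.
  + by rewrite flipK eqxx.
  by have := IH h w; rewrite !inE hC => /(_ isT) /andP[/andP[-> ->] ->]; rewrite orbT.
- move=> w; rewrite !tC_Circ //; case/and5P: w => w1 w2 /eqP -> ht1 /andP[ht2 dis].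
  have pp : flip p != p.
    by apply/eqP => e; rewrite e in ht2; apply: tL_disj dis ht1 ht2.
  rewrite !inE => /orP[/orP[] /eqP ->|/orP[hC|hC]].
  + by rewrite eqxx orbT /=.
  + by rewrite flipK eqxx /= eq_sym.
  + by have := IH1 h w1; rewrite !inE hC => /(_ isT) /andP[/andP[-> ->] ->]; rewrite !orbT.
  + by have := IH2 h w2; rewrite !inE hC => /(_ isT) /andP[/andP[-> ->] ->]; rewrite !orbT.
Qed.

(** The contracted edges connect the vertices of [t]: a set [P] that no contracted edge leaves
    contains all of them or none. This form allows two trees with the same contracted edges to be
    compared by taking for [P] the vertices of a subtree of one of them. *)
Lemma tV_connected t (P : {set 'I_n}) : wf t ->
  (forall h, h \in tC t -> (att h \in P) = (att (flip h) \in P)) ->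
  (forall u v, u \in tV t -> v \in tV t -> (u \in P) = (v \in P)).
Proof.
elim: t => [x|p p' t IH|p p' t1 IH1 t2 IH2].
- by move=> _ _ u v; rewrite !inE => /eqP -> /eqP ->.
- move=> w PC u v; apply: IH; first by case/and5P: w.
  by move=> h hC; apply: PC; rewrite tC_Contr // inE hC orbT.
move=> w PC.
have H1 : forall u v, u \in tV t1 -> v \in tV t1 -> (u \in P) = (v \in P).
  apply: IH1; first by case/and5P: w.
  by move=> h hC; apply: PC; rewrite tC_Circ // !in_setU hC orbT.
have H2 : forall u v, u \in tV t2 -> v \in tV t2 -> (u \in P) = (v \in P).
  apply: IH2; first by case/and5P: w.
  by move=> h hC; apply: PC; rewrite tC_Circ // !in_setU hC !orbT.
have pP : (att p \in P) = (att p' \in P).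
  have := PC p; rewrite tC_Circ // !inE eqxx => /(_ isT) ->.
  by case/and5P: w => _ _ /eqP ->.
case/and5P: w => w1 w2 _ /tL_att p1 /andP[/tL_att p2 dis].
have H12 : forall u v, u \in tV t1 -> v \in tV t2 -> (u \in P) = (v \in P).
  by move=> u v u1 v2; rewrite (H1 u (att p)) // pP; apply: H2.
move=> u v; rewrite !in_setU => /orP[]u1 /orP[]v1.
- exact: H1.
- exact: H12.
- by rewrite (H12 v u).
- exact: H2.
Qed.

(** Each contraction uses up two half-edges; a loop raises the genus by one, a joining edge lowers
    the excess of vertices over components by one. The relation is multiplied by 2 and written
    without subtraction. It shows that [tG t] depends only on the vertices and legs of [t]. *)
Lemma tree_genus t : wf t ->
  (2 * (tG t + #|tV t|) + #|tL t| =
   2 * (\sum_(v in tV t) gen v + 1) + #|[set h | att h \in tV t]|)%N.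
Proof.
elim: t => [v|p p' t IH|p p' t1 IH1 t2 IH2].
- rewrite /= cards1 big_set1 => _; congr addn; apply: eq_card => h.
  by rewrite !inE.
- move=> /= /and5P[w _ pp' pt p't]; have := IH w; rewrite (cardsD1 p (tL t)) pt.
  rewrite (cardsD1 p' (tL t :\ p)) !inE eq_sym pp' p't /=; lia.
move=> /= /and5P[w1 w2 _ p1 /andP[p'2 dis]].
have := IH1 w1; have := IH2 w2.
rewrite (cardsD1 p (tL t1)) p1 (cardsD1 p' (tL t2)) p'2.
rewrite big_disjointU //= !cardsU.
have -> : tV t1 :&: tV t2 = set0 by apply/eqP; rewrite setI_eq0.
have -> : (tL t1 :\ p) :&: (tL t2 :\ p') = set0.
  apply/setP => h; rewrite !inE; apply/negP => /andP[/andP[_ h1] /andP[_ h2]].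
  exact: tL_disj dis h1 h2.
have -> : [set h | att h \in tV t1 :|: tV t2] =
    [set h | att h \in tV t1] :|: [set h | att h \in tV t2].
  by apply/setP => h; rewrite !inE.
rewrite cardsU (_ : _ :&: _ = set0) ?cards0; last first.
  apply/setP => h; rewrite !inE; apply/negP => /andP[h1 h2]; exact: tV_disj dis h1 h2.
rewrite !subn0 /=; set s1 := (\sum_(i in tV t1) _)%N; set s2 := (\sum_(i in tV t2) _)%N; lia.
Qed.

Lemma tV_nonempty t : exists u, u \in tV t.
Proof.
elim: t => [v|h h' t IH|h h' t1 [u u1] t2 _] /=; [by exists v; rewrite inE|exact: IH|].
by exists u; rewrite inE u1.
Qed.

(** The tree is grown in two stages. As long as a vertex is missing, connectedness yields an edge
    leaving the tree, whose far end is joined as a leaf. Once all vertices are present, the edges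
    left over are contracted as loops. *)
Lemma tree_exists (v0 : 'I_n) :
  (forall u v : 'I_n,
     connect (fun u v => [exists h, (att h == u) && (att (flip h) == v)]) u v) ->
  exists t, [/\ wf t, tV t = setT & tL t = [set h | flip h == h]].
Proof.
move=> conn.
(* Contracted half-edges come in pairs with both vertices in the tree, so a half-edge pointing out
   of the tree is still free. *)
have noC t h : wf t -> att h \in tV t -> att (flip h) \notin tV t -> h \in tL t.
  move=> w ht; apply: contraNT => hN.
  have : h \in tC t by rewrite inE ht.
  by move/(tC_flip w); rewrite inE => /andP[/andP[]].
have [t [w tT]] : exists t, wf t /\ tV t = setT.
  suff S m : forall t, wf t -> (#|~: tV t| <= m)%N -> exists t, wf t /\ tV t = setT.
    by apply: (S _ (Leaf v0) isT (leqnn _)).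
  elim: m => [|m IHm] t w.
    rewrite leqn0 cards_eq0 => /eqP e; exists t; split=> //.
    by rewrite -[tV t]setCK e setC0.
  have [e|] := eqVneq (tV t) setT; first by exists t.
  rewrite eqEsubset subsetT /= => /subsetPn[v _ vt] tm.
  have [u ut] : exists u, u \in tV t.
    exact: tV_nonempty.
  have [h h1 h2] : exists2 h, att h \in tV t & att (flip h) \notin tV t.
    case/connectP: (conn u v) => q; elim: q u ut => [|y q IHq] u ut /=.
      by move=> _ e; rewrite e ut in vt.
    case/andP=> /existsP[h /andP[/eqP e1 /eqP e2]] yq vq.
    have [yt|yt] := boolP (y \in tV t); first exact: IHq yt yq vq.
    by exists h; rewrite ?e1 ?e2.
  apply: (IHm (Circ h (flip h) t (Leaf (att (flip h))))).
    rewrite /= w eqxx (noC _ _ w h1 h2) inE eqxx /=.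
    by rewrite disjoint_sym disjoints1.
  rewrite -ltnS; apply: leq_trans tm; apply: proper_card.
  rewrite /= properE setCS subsetUl /=; apply/subsetPn; exists (att (flip h)).
    by rewrite inE.
  by rewrite !inE eqxx orbT.
(* Second stage: induction on the number of free half-edges, which drops with each loop
   contracted. *)
suff S m : forall t, wf t -> tV t = setT -> (#|tL t| <= m)%N ->
    exists t, [/\ wf t, tV t = setT & tL t = [set h | flip h == h]].
  exact: S w tT (leqnn _).
elim: m => [|m IHm] {tT w}t w tT tm; (have [e|] := eqVneq (tL t) [set h | flip h == h];
  first by exists t).
all: have sub : [set h | flip h == h] \subset tL t.
- apply/subsetP => h; rewrite inE => fh; apply: contraLR fh => hN.
  have : h \in tC t by rewrite inE tT inE.
  by move/(tC_flip w)/andP => [].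
- move: tm; rewrite leqn0 cards_eq0 => /eqP t0.
  by rewrite eqEsubset sub t0 sub0set.
- apply/subsetP => h; rewrite inE => fh; apply: contraLR fh => hN.
  have : h \in tC t by rewrite inE tT inE.
  by move/(tC_flip w)/andP => [].
rewrite eqEsubset sub andbT => /subsetPn[h ht]; rewrite inE => fh.
have fht : flip h \in tL t.
  apply: contraLR ht => hN; have : flip h \in tC t by rewrite inE tT inE.
  by move/(tC_flip w); rewrite flipK inE => /andP[/andP[_ ->]].
apply: (IHm (Contr h (flip h) t)) => //; first by rewrite /= w eqxx eq_sym fh ht fht.
rewrite -ltnS; apply: leq_trans tm; apply: proper_card.
rewrite /= properE; apply/andP; split; first by apply/subsetP => x; rewrite !inE => /and3P[].
by apply/subsetPn; exists h; rewrite ?ht // !inE eqxx andbF.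
Qed.

End Trees.

(** * Values of trees *)

Section TreeValues.
Variables (k : fieldType) (M : modular_operad k).
Variables (n : nat) (H : finType) (att : H -> 'I_n) (gen : 'I_n -> nat).
Local Notation tree := (tree 'I_n H).
Local Notation tL := (tL att).
Local Notation tG := (tG gen).
Implicit Types (t s : tree) (h p : H) (D : 'I_n -> bool).
Local Notation dec := (forall v : 'I_n, mspace M (flags (vflags att v)) (gen v)).

(* The sign in [Circ] reorders the vertices of the two subtrees increasingly; [D]
   gives the parities of the degrees of the decorations. *)
Fixpoint treeval D (a : dec) t : mspace M (flags (tL t)) (tG t) :=
  match t with
  | Leaf v => a v
  | Contr h h' t => scontr h h' (treeval D a t)
  | Circ h h' t1 t2 =>
    (-1) ^+ sg D (tV t1) (tV t2) *: scirc h h' (treeval D a t1) (treeval D a t2)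
  end.

Definition pv D (a : dec) t : packed M H := pack (treeval D a t).

Lemma treeval_ext D (a b : dec) t : (forall v, v \in tV t -> a v = b v) ->
  treeval D a t = treeval D b t.
Proof.
elim: t => [v|h h' t IH|h h' t1 IH1 t2 IH2] ab /=.
- by apply: ab; rewrite inE.
- by rewrite IH.
- by rewrite IH1 ?IH2 // => v vt; apply: ab; rewrite inE vt ?orbT.
Qed.

(** In a well-formed tree each vertex is a leaf exactly once, since the two branches of [Circ] have
    disjoint vertex sets; only the branch containing [u] varies. *)
Lemma treeval_linear flip D (a : dec) t u : wf att flip t -> u \in tV t ->
  linear (fun x : mspace M (flags (vflags att u)) (gen u) => treeval D (dfwith a x) t).
Proof.
have out t' (x : mspace M (flags (vflags att u)) (gen u)) :
    u \notin tV t' -> treeval D (dfwith a x) t' = treeval D a t'.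
  by move=> ut; apply: treeval_ext => v vt; rewrite dfwith_out //; apply: contraNneq ut => ->.
elim: t => [v|h h' t IH|h h' t1 IH1 t2 IH2].
- rewrite inE => _ /eqP e; case: v / e => c x y /=.
  by rewrite !dfwith_in.
- move=> /= /andP[w _] ut c x y; rewrite IH //; exact: scontr_linear.
- move=> /= /and5P[w1 w2 _ _ /andP[_ dis]]; rewrite inE => /orP[u1|u2] c x y.
  + have u2 : u \notin tV t2 by apply/negP => /(tV_disj dis u1).
    rewrite !(out _ _ u2) IH1 // scirc_linearl scalerDr; congr (_ + _).
    by rewrite !scalerA mulrC.
  + have u1 : u \notin tV t1 by apply/negP => /(tV_disj dis); apply.
    rewrite !(out _ _ u1) IH2 // scirc_linearr scalerDr; congr (_ + _).
    by rewrite !scalerA mulrC.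
Qed.

Lemma treeval_homog flip D (a : dec) (d : 'I_n -> int) t : wf att flip t ->
  (forall v, homog (d v) (a v)) -> homog (\sum_(v in tV t) d v) (treeval D a t).
Proof.
move=> + ad; elim: t => [v|h h' t IH|h h' t1 IH1 t2 IH2] /=.
- by rewrite big_set1.
- by move=> /andP[w _]; apply/scontr_homog/IH.
- move=> /and5P[w1 w2 _ _ /andP[_ dis]]; apply: homogZ.
  rewrite big_disjointU //=; apply: scirc_homog; [exact: IH1|exact: IH2].
Qed.

Lemma pcirc_scalel h h' c (X Y : packed M H) :
  pcirc h h' (pscale c X) Y = pscale c (pcirc h h' X Y).
Proof.
rewrite /pcirc /pscale /=; congr pack.
by rewrite (linearZ_ (@scirc_linearl _ _ _ h h' _ _ _ _ (pval Y))).
Qed.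

Lemma pcirc_scaler h h' c (X Y : packed M H) :
  pcirc h h' X (pscale c Y) = pscale c (pcirc h h' X Y).
Proof.
rewrite /pcirc /pscale /=; congr pack.
by rewrite (linearZ_ (@scirc_linearr _ _ _ h h' _ _ _ _ (pval X))).
Qed.

Lemma pcontr_scale h h' c (X : packed M H) :
  pcontr h h' (pscale c X) = pscale c (pcontr h h' X).
Proof.
rewrite /pcontr /pscale /=; congr pack.
by rewrite (linearZ_ (@scontr_linear _ _ _ h h' _ _)).
Qed.

Lemma pv_Contr D a h h' t : pv D a (Contr h h' t) = pcontr h h' (pv D a t).
Proof. by []. Qed.

Lemma pv_Circ D a h h' t1 t2 :
  pv D a (Circ h h' t1 t2) =
  pscale ((-1) ^+ sg D (tV t1) (tV t2)) (pcirc h h' (pv D a t1) (pv D a t2)).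
Proof. by []. Qed.

(** * Independence of the tree *)

Section Uniqueness.
Variables (flip : H -> H) (flipK : involutive flip).
Variables (a : dec) (d : 'I_n -> int).
Hypothesis ad : forall v, homog (d v) (a v).
Let D v := odd (absz (d v)).
Local Notation pv := (pv D a).
Local Notation wf := (wf att flip).
Local Notation tC := (tC att).

(** Packed values carry labels and genus, so equality of [pv] includes equality of the legs
    ([tequiv_tL]). *)
Definition tequiv t t' := [/\ wf t', tV t' = tV t & pv t' = pv t].

Lemma tequiv_refl t : wf t -> tequiv t t.
Proof. by []. Qed.

Lemma tequiv_trans t t' t'' : tequiv t t' -> tequiv t' t'' -> tequiv t t''.
Proof. by move=> [_ e1 e2] [w e3 e4]; split; rewrite ?e3 ?e4. Qed.

Lemma tequiv_tL t t' : tequiv t t' -> tL t' = tL t.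
Proof. by case=> _ _ /(congr1 (@pflags _ _ _)). Qed.

Lemma pv_homog t : wf t -> phomog (\sum_(v in tV t) d v) (pv t).
Proof. by move=> w; apply: treeval_homog w ad. Qed.

Lemma wf_Circ_sym h h' t1 t2 : wf (Circ h h' t1 t2) -> wf (Circ h' h t2 t1).
Proof.
by move=> /= /and5P[-> -> /eqP -> -> /andP[-> +]]; rewrite flipK eqxx disjoint_sym => ->.
Qed.

(** The two shuffle signs differ by the product of the total parities of the branches ([sg_swap]),
    which cancels the sign in the symmetry of [pcirc]. *)
Lemma Circ_sym h h' t1 t2 : wf (Circ h h' t1 t2) ->
  tequiv (Circ h h' t1 t2) (Circ h' h t2 t1).
Proof.
move=> w; split; [exact: wf_Circ_sym|by rewrite /= setUC|].
move: w => /= /and5P[w1 w2 _ ht1 /andP[h't2 dis]].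
rewrite !pv_Circ [in RHS](pcirc_sym (pv_homog w1) (pv_homog w2)) ?tL_disjoint //.
rewrite pscaleA; congr pscale.
rewrite -(signr_odd _ (absz _)) abszM oddM !odd_absz_sum -sg_swap //.
by rewrite -signr_addb addbA addbb addFb.
Qed.

(** The shuffle exponents satisfy a cocycle relation: by biadditivity of [sg], both bracketings
    count the inversions between the three pairs of vertex sets once each. *)
Lemma Circ_assoc h h' p p' z1 z2 y : wf (Circ p p' (Circ h h' z1 z2) y) -> p \in tL z2 ->
  tequiv (Circ p p' (Circ h h' z1 z2) y) (Circ h h' z1 (Circ p p' z2 y)).
Proof.
move=> /= /and5P[/and5P[w1 w2 hh' hz1 /andP[h'z2 d12]] wy pp' pz /andP[p'y dis]] pz2.
have dz1 : [disjoint tV z1 & tV y].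
  by apply: disjointWl dis; apply: subsetUl.
have dz2 : [disjoint tV z2 & tV y].
  by apply: disjointWl dis; apply: subsetUr.
have h'p : h' != p.
  apply/eqP => e; move: pz; rewrite !inE e eqxx /= orbF => /andP[_ pz1].
  exact: tL_disj d12 pz1 pz2.
split.
- rewrite /= w1 w2 hh' hz1 wy pp' pz2 p'y dz2 /= !inE h'p h'z2 /=.
  by rewrite -!setI_eq0 setIUr setU_eq0 !setI_eq0 d12 dz1.
- by rewrite /= setUA.
rewrite !pv_Circ pcirc_scalel pcirc_scaler !pscaleA pcirc_assoc ?tL_disjoint //=.
rewrite -!signr_addb sgUl // sgUr //; congr (pscale (_ ^+ nat_of_bool _) _).
by case: (sg _ (tV z1) (tV z2)); case: (sg _ (tV z1) (tV y)); case: (sg _ (tV z2) (tV y)).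
Qed.

Lemma Contr_sym h h' t : wf (Contr h h' t) -> tequiv (Contr h h' t) (Contr h' h t).
Proof.
move=> /= /and5P[w /eqP -> hh' ht h't]; split=> //=.
  by rewrite w flipK eqxx eq_sym hh' ht h't.
by rewrite !pv_Contr pcontr_sym // eq_sym.
Qed.

Lemma Contr_Contr h h' p p' t : wf (Contr p p' (Contr h h' t)) ->
  tequiv (Contr p p' (Contr h h' t)) (Contr h h' (Contr p p' t)).
Proof.
move=> /= /and5P[/and5P[w eh hh' ht h't] ep pp'].
rewrite !inE => /and3P[ph' ph pt] /and3P[p'h' p'h p't].
split=> //.
  rewrite /= !inE w eh hh' ht h't ep pp' pt p't /=.
  by rewrite ![h == _]eq_sym ![h' == _]eq_sym ph p'h ph' p'h'.
rewrite !pv_Contr; apply: pcontr_contr.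
  by rewrite /= !inE !negb_or pp' hh' ph ph' p'h p'h'.
by move=> x; rewrite !inE => /or4P[] /eqP ->.
Qed.

Lemma Contr_Circl h h' p p' t1 t2 : wf (Contr p p' (Circ h h' t1 t2)) ->
  p \in tL t1 -> p' \in tL t1 ->
  tequiv (Contr p p' (Circ h h' t1 t2)) (Circ h h' (Contr p p' t1) t2).
Proof.
move=> /= /and5P[/and5P[w1 w2 eh h1 /andP[h2 dis]] ep pp' p12 p'12] p1 p'1.
have p2 : p \notin tL t2 by apply/negP => /(tL_disj dis p1).
have p'2 : p' \notin tL t2 by apply/negP => /(tL_disj dis p'1).
move: p12 p'12; rewrite !inE (negbTE p2) (negbTE p'2) !andbF !orbF => /andP[ph _] /andP[p'h _].
split=> //.
  by rewrite /= !inE w1 w2 eh h1 h2 dis ep pp' p1 p'1 ![h == _]eq_sym ph p'h.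
rewrite !pv_Contr !pv_Circ pcontr_scale; congr pscale; rewrite pv_Contr; apply: pcirc_contr => //.
- by rewrite /= !inE !negb_or pp' ph p'h.
- by move=> x; rewrite !inE => /or3P[] /eqP ->.
- exact: tL_disjoint.
Qed.

Lemma Circ_Contr h h' p p' t1 t2 : wf (Circ p p' (Contr h h' t1) t2) ->
  tequiv (Circ p p' (Contr h h' t1) t2) (Contr h h' (Circ p p' t1 t2)).
Proof.
move=> /= /and5P[/and5P[w1 eh hh' h1 h'1] w2 ep p1 /andP[p2 dis]].
move: p1; rewrite !inE => /and3P[ph' ph p1].
have w : wf (Contr h h' (Circ p p' t1 t2)).
  by rewrite /= !inE w1 w2 eh hh' h1 h'1 ep p1 p2 dis ![h == _]eq_sym ![h' == _]eq_sym ph ph' /= ?orbT.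
by have [_ e1 e2] := Contr_Circl w h1 h'1; split.
Qed.

(** The edges [h] and [p] are parallel, both running between the two branches: whichever joins the
    branches, the other becomes a loop. *)
Lemma Contr_Circ h h' p p' t1 t2 : wf (Contr p p' (Circ h h' t1 t2)) ->
  p \in tL t1 -> p' \in tL t2 ->
  tequiv (Contr p p' (Circ h h' t1 t2)) (Contr h h' (Circ p p' t1 t2)).
Proof.
move=> /= /and5P[/and5P[w1 w2 eh h1 /andP[h2 dis]] ep pp' p12 p'12] p1 p'2.
have p2 : p \notin tL t2 by apply/negP => /(tL_disj dis p1).
have p'1 : p' \notin tL t1 by apply/negP => p'1; exact: tL_disj dis p'1 p'2.
have hh' : h != h' by apply/eqP => e; rewrite -e in h2; exact: tL_disj dis h1 h2.
move: p12 p'12; rewrite !inE (negbTE p2) (negbTE p'1) !andbF /= orbF => /andP[ph _] /andP[p'h _].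
split=> //.
  rewrite /= !inE w1 w2 ep p1 p'2 dis eh hh' h1 h2 /=.
  by rewrite eq_sym ph [h' == p']eq_sym p'h /= orbT.
rewrite !pv_Contr !pv_Circ !pcontr_scale; congr pscale.
apply: pcontr_circ => //=; rewrite 1?eq_sym //; exact: tL_disjoint.
Qed.

Lemma tequiv_Contr h h' t t' : tequiv t t' -> wf (Contr h h' t) ->
  tequiv (Contr h h' t) (Contr h h' t').
Proof.
move=> e; have eL := tequiv_tL e; case: e => w eV e /= /and5P[_ eh hh' ht h't].
by split=> //; [rewrite /= w eh hh' eL ht h't|rewrite !pv_Contr e].
Qed.

Lemma tequiv_Circl h h' t t' s : tequiv t t' -> wf (Circ h h' t s) ->
  tequiv (Circ h h' t s) (Circ h h' t' s).
Proof.
move=> e; have eL := tequiv_tL e; case: e => w eV e /= /and5P[_ ws eh ht /andP[h't dis]].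
split=> //; first by rewrite /= w ws eh eL eV ht h't.
- by rewrite /= eV.
- by rewrite !pv_Circ e eV.
Qed.

Definition top h t t' :=
  tequiv t t' /\ ((exists s, t' = Contr h (flip h) s) \/
                  (exists s1 s2, t' = Circ h (flip h) s1 s2)).

(** Once the edge [h] is the root of the left branch it is pulled over the enclosing node: a loop
    commutes with it, and a joining edge is moved by associativity. *)
Lemma top_Circl h p p' t1 t2 : wf (Circ p p' t1 t2) ->
  (exists t', top h t1 t') -> exists t', top h (Circ p p' t1 t2) t'.
Proof.
move=> w [t1' [e1 [[s ts]|[s1 [s2 ts]]]]]; have e := tequiv_Circl e1 w; subst t1'.
  exists (Contr h (flip h) (Circ p p' s t2)); split; last by left; eexists.
  by apply: tequiv_trans (e) _; apply: Circ_Contr; case: e.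
have [w' _ _] := e.
have : p \in tL (Circ h (flip h) s1 s2) by case/and5P: w'.
rewrite inE => /orP[]; rewrite inE => /andP[_ ps]; last first.
  exists (Circ h (flip h) s1 (Circ p p' s2 t2)); split; last by right; do 2!eexists.
  by apply: tequiv_trans (e) _; apply: Circ_assoc.
(* The outer edge starts in the first part [s1], whereas associativity needs it in the second: the
   parts are exchanged before and after. *)
have w1 : wf (Circ h (flip h) s1 s2) by case/andP: w'.
have e2 := tequiv_Circl (Circ_sym w1) w'.
have e3 : tequiv (Circ p p' (Circ (flip h) h s2 s1) t2) (Circ (flip h) h s2 (Circ p p' s1 t2)).
  by apply: Circ_assoc => //; case: e2.
exists (Circ h (flip h) (Circ p p' s1 t2) s2); split; last by right; do 2!eexists.
apply: tequiv_trans e (tequiv_trans e2 (tequiv_trans (e3) _)).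
by apply: Circ_sym; case: e3.
Qed.

(* Each axiom of modular operads exchanges two consecutive contractions, so every
   edge can be moved to the root. *)
Lemma exchange t h : wf t -> h \in tC t -> exists t', top h t t'.
Proof.
elim: t => [v|p p' t IH|p p' t1 IH1 t2 IH2] w.
- by rewrite !inE /= ?inE andbN.
- rewrite (tC_Contr w) !inE => /orP[/orP[/eqP hp|/eqP hp]|hC].
  + rewrite hp; exists (Contr p p' t); split; first exact: tequiv_refl.
    by left; exists t; case/and5P: w => _ /eqP ->.
  + rewrite hp; exists (Contr p' p t); split; first exact: Contr_sym.
    by left; exists t; case/and5P: w => _ /eqP ->; rewrite flipK.
  have w0 : wf t by case/andP: w.
  have [|t' [e0 ts]] := IH w0; first by rewrite inE.
  have e := tequiv_Contr e0 w; have [w1 _ _] := e.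
  case: ts => [[s ts]|[s1 [s2 ts]]]; subst t'.
    exists (Contr h (flip h) (Contr p p' s)); split; last by left; eexists.
    by apply: tequiv_trans (e) _; apply: Contr_Contr.
  have [ws _ _] := e0.
  have pc : (p \in tL s1) || (p \in tL s2).
    by case/and5P: w1 => _ _ _ + _; rewrite !inE => /orP[]/andP[_ ->]; rewrite ?orbT.
  have p'c : (p' \in tL s1) || (p' \in tL s2).
    by case/and5P: w1 => _ _ _ _; rewrite !inE => /orP[]/andP[_ ->]; rewrite ?orbT.
  (* A loop with both ends in one branch is absorbed by that branch; with one end in each it is
     parallel to [h], and the two edges exchange roles. *)
  case/orP: pc => ps; case/orP: p'c => p's.
  + exists (Circ h (flip h) (Contr p p' s1) s2); split; last by right; do 2!eexists.
    by apply: tequiv_trans (e) _; apply: Contr_Circl.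
  + exists (Contr h (flip h) (Circ p p' s1 s2)); split; last by left; do 2!eexists.
    by apply: tequiv_trans (e) _; apply: Contr_Circ.
  + exists (Contr h (flip h) (Circ p' p s1 s2)); split; last by left; do 2!eexists.
    have e1 := Contr_sym w1; have [w2 _ _] := e1.
    by apply: tequiv_trans (tequiv_trans e e1) _; apply: Contr_Circ.
  + have e1 := tequiv_Contr (Circ_sym ws) w1; have [w2 _ _] := e1.
    have e2 := Contr_Circl w2 ps p's; have [w3 _ _] := e2.
    exists (Circ h (flip h) s1 (Contr p p' s2)); split; last by right; do 2!eexists.
    exact: tequiv_trans (tequiv_trans e e1) (tequiv_trans e2 (Circ_sym w3)).
rewrite (tC_Circ w) !in_setU !in_set1 => /orP[/orP[/eqP hp|/eqP hp]|/orP[hC|hC]].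
- rewrite hp; exists (Circ p p' t1 t2); split; first exact: tequiv_refl.
  by right; exists t1, t2; case/and5P: w => _ _ /eqP ->.
- rewrite hp; exists (Circ p' p t2 t1); split; first exact: Circ_sym.
  by right; exists t2, t1; case/and5P: w => _ _ /eqP ->; rewrite flipK.
- apply: (top_Circl w (IH1 _ hC)); by case/andP: w.
have [|t' [e ts]] := top_Circl (wf_Circ_sym w) (IH2 _ hC); first by case/and3P: w.
by exists t'; split=> //; apply: tequiv_trans (Circ_sym w) e.
Qed.

(** Among the contracted edges, [h] is a bridge in the second tree, as removing it separates [s1]
    from [s2]; in the first tree the other contracted edges, those of [s], already connect its two
    ends. The set [tV s1] exhibits the contradiction. *)
Lemma Contr_not_Circ h s s1 s2 :
  wf (Contr h (flip h) s) -> wf (Circ h (flip h) s1 s2) ->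
  tV (Contr h (flip h) s) = tV (Circ h (flip h) s1 s2) ->
  tL (Contr h (flip h) s) = tL (Circ h (flip h) s1 s2) -> False.
Proof.
move=> w w' eV eL.
have eC : tC (Contr h (flip h) s) = tC (Circ h (flip h) s1 s2).
  exact: eq_tC.
have [ws _ _ hs fhs] := and5P w.
have [w1 w2 _ h1 /andP[h2 dis]] := and5P w'.
have : (att h \in tV s1) = (att (flip h) \in tV s1).
  apply: (tV_connected ws _ (tL_att hs) (tL_att fhs)) => x xC.
  have : x \in tC (Circ h (flip h) s1 s2) by rewrite -eC (tC_Contr w) inE xC orbT.
  have xh : x != h by apply: contraTneq xC => ->; rewrite inE hs andbF.
  have xfh : x != flip h by apply: contraTneq xC => ->; rewrite inE fhs andbF.
  rewrite (tC_Circ w') !in_setU !in_set1 (negbTE xh) (negbTE xfh) /= => /orP[] xs.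
    have := tC_flip flipK w1 xs; rewrite !inE => /andP[/andP[-> _] _].
    by move: xs; rewrite inE => /andP[->].
  have := tC_flip flipK w2 xs; rewrite !inE => /andP[/andP[fx _] _].
  move: xs; rewrite inE => /andP[ax _].
  have -> : (att x \in tV s1) = false by apply/negP => /(tV_disj dis); apply.
  by apply/esym/negP => /(tV_disj dis); apply.
rewrite (tL_att h1) => /esym; have := tL_att h2 => a2 a1; exact: tV_disj dis a1 a2.
Qed.

(** The vertices of [s1] are connected to the vertex of [h] by contracted edges other than the
    bridge, and such edges do not leave [tV s1']. By symmetry the bridge alone determines the
    partition of the vertices. *)
Lemma Circ_split h s1 s2 s1' s2' :
  wf (Circ h (flip h) s1 s2) -> wf (Circ h (flip h) s1' s2') ->
  tV (Circ h (flip h) s1 s2) = tV (Circ h (flip h) s1' s2') ->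
  tL (Circ h (flip h) s1 s2) = tL (Circ h (flip h) s1' s2') ->
  tV s1 \subset tV s1'.
Proof.
move=> w w' eV eL.
have eC : tC (Circ h (flip h) s1 s2) = tC (Circ h (flip h) s1' s2').
  exact: eq_tC.
have [w1 w2 _ h1 /andP[h2 dis]] := and5P w.
have [w1' w2' _ h1' /andP[h2' dis']] := and5P w'.
apply/subsetP => v vs; rewrite -(tV_connected w1 _ (tL_att h1) vs) ?tL_att // => x xC.
have : x \in tC (Circ h (flip h) s1' s2') by rewrite -eC (tC_Circ w) !in_setU xC orbT.
have xh : x != h by apply: contraTneq xC => ->; rewrite inE h1 andbF.
have xfh : x != flip h.
  apply: contraTneq xC => ->; rewrite inE; apply/negP => /andP[x1 _].
  exact: tV_disj dis x1 (tL_att h2).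
rewrite (tC_Circ w') !in_setU !in_set1 (negbTE xh) (negbTE xfh) /= => /orP[] xs.
  have := tC_flip flipK w1' xs; rewrite !inE => /andP[/andP[-> _] _].
  by move: xs; rewrite inE => /andP[->].
have := tC_flip flipK w2' xs; rewrite !inE => /andP[/andP[fx _] _].
move: xs; rewrite inE => /andP[ax _].
have -> : (att x \in tV s1') = false by apply/negP => /(tV_disj dis'); apply.
by apply/esym/negP => /(tV_disj dis'); apply.
Qed.

Lemma tL_Circl h h' s1 s2 : wf (Circ h h' s1 s2) ->
  tL s1 = h |: [set x in tL (Circ h h' s1 s2) | att x \in tV s1].
Proof.
move=> /and5P[_ _ _ h1 /andP[_ dis]]; apply/setP => x; rewrite !inE.
have [->|_] := eqVneq x h; first by rewrite h1.
rewrite /=; have [x1|x1] := boolP (x \in tL s1); first by rewrite tL_att.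
rewrite /=; have [x2|//] := boolP (x \in tL s2); last by rewrite andbF.
by apply/esym/negP => /andP[_ /(tV_disj dis)]; apply; exact: tL_att.
Qed.

(** Induction on [t]. With the root edge of [t] moved to the root of [t'], both roots are of the
    same kind, and the branches have the same vertices and legs, so the induction hypothesis applies
    to them. *)
Lemma pv_unique t t' : wf t -> wf t' -> tV t = tV t' -> tL t = tL t' -> pv t = pv t'.
Proof.
elim: t t' => [v|h h' s IH|h h' s1 IH1 s2 IH2] t' w w' eV eL.
- have C0 : tC t' = set0.
    by apply/setP => x; rewrite !inE -eV -eL /= !inE andbN.
  case: t' w' eV C0 {eL} => [v'|p p' t0|p p' t0 t1] w'.
  + by move=> /= /setP /(_ v); rewrite !inE eqxx => /esym /eqP ->.
  + by rewrite (tC_Contr w') => _ /setP /(_ p); rewrite !inE eqxx.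
  + by rewrite (tC_Circ w') => _ /setP /(_ p); rewrite !in_setU !inE eqxx.
- have hC : h \in tC t'.
    have : h \in tC (Contr h h' s) by rewrite (tC_Contr w) !inE eqxx.
    by rewrite (eq_tC eV eL).
  have h'E : h' = flip h by case/and5P: w => _ /eqP.
  subst h'; have [t'' [e ts]] := exchange w' hC.
  have eL' := tequiv_tL e; have [w'' eV' epv] := e.
  case: ts => [[s' ts]|[s1 [s2 ts]]]; subst t''; last first.
    by case: (Contr_not_Circ w w''); rewrite ?eV' ?eL'.
  rewrite -epv !pv_Contr; congr pcontr; apply: IH.
  + by case/andP: w.
  + by case/andP: w''.
  + by rewrite [LHS]eV -eV'.
  have [_ _ _ hs fhs] := and5P w; have [_ _ _ hs' fhs'] := and5P w''.
  apply/setP => x; have := congr1 (fun L : {set H} => x \in L) (etrans eL (esym eL')).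
  rewrite /= !inE; case: eqVneq => [->|_]; first by rewrite fhs fhs'.
  by case: eqVneq => [->|_]; first by rewrite hs hs'.
have hC : h \in tC t'.
  have : h \in tC (Circ h h' s1 s2) by rewrite (tC_Circ w) !inE eqxx.
  by rewrite (eq_tC eV eL).
have h'E : h' = flip h by case/and5P: w => _ _ /eqP.
subst h'; have [t'' [e ts]] := exchange w' hC.
have eL' := tequiv_tL e; have [w'' eV' epv] := e.
case: ts => [[s' ts]|[s1' [s2' ts]]]; subst t''.
  by case: (Contr_not_Circ w'' w); rewrite ?eV' ?eL'.
have eVV : tV (Circ h (flip h) s1 s2) = tV (Circ h (flip h) s1' s2').
  by rewrite eV eV'.
have eLL : tL (Circ h (flip h) s1 s2) = tL (Circ h (flip h) s1' s2').
  by rewrite eL eL'.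
have wS := wf_Circ_sym w; have wS'' := wf_Circ_sym w''.
have eV1 : tV s1 = tV s1'.
  by apply/eqP; rewrite eqEsubset (Circ_split w w'') // (Circ_split w'' w).
have eV2 : tV s2 = tV s2'.
  have H2 : forall s1 s2 s1' s2', wf (Circ h (flip h) s1 s2) ->
     wf (Circ h (flip h) s1' s2') -> tV s1 = tV s1' ->
     tV s1 :|: tV s2 = tV s1' :|: tV s2' -> tV s2 \subset tV s2'.
    move=> r1 r2 r1' r2' /and5P[_ _ _ _ /andP[_ dis]] _ e1 e12.
    apply/subsetP => v v2; have : v \in tV r1 :|: tV r2 by rewrite inE v2 orbT.
    rewrite e12 inE -e1 => /orP[v1|//]; case: (tV_disj dis v1 v2).
  by apply/eqP; rewrite eqEsubset (H2 _ _ _ _ w w'') // (H2 _ _ _ _ w'' w) //.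
rewrite -epv !pv_Circ eV1 eV2; congr (pscale _ (pcirc _ _ _ _)).
  apply: IH1 => //; [by case/andP: w|by case/andP: w''|].
  by rewrite (tL_Circl w) (tL_Circl w'') eLL eV1.
apply: IH2 => //; [by case/and3P: w|by case/and3P: w''|].
have eLS : tL (Circ (flip h) h s2 s1) = tL (Circ (flip h) h s2' s1').
  by move: eLL; rewrite /= ![tL s2 :\ _ :|: _]setUC ![tL s2' :\ _ :|: _]setUC.
by rewrite (tL_Circl wS) (tL_Circl wS'') eLS eV2.
Qed.

End Uniqueness.
End TreeValues.

(** * Substitution of trees *)

Section Relabel.
Variables (k : fieldType) (M : modular_operad k) (H H' : finType).
Variables (r : H -> H') (r_inj : injective r).

Definition prelabel (X : packed M H) : packed M H' := pk (r \o @lab _ _) (pval X).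

Lemma prelabel_pk (S : finType) (l : S -> H) g (x : mspace M S g) : injective l ->
  prelabel (pk l x) = pk (r \o l) x.
Proof.
move=> li; rewrite /prelabel /pk /=.
set L := [set l s | s : S].
have [f fl] : same_labels l (@lab _ L) by apply: same_labels_lab => // h; rewrite imset_codom.
rewrite (trE (f := f) (erefl g)) //; last exact: lab_inj.
rewrite -/(pk _ _) -/(pk (r \o l) x).
apply: pk_mact => [|s]; first exact: inj_comp r_inj (@lab_inj _ _).
by rewrite /= -fl.
Qed.

Lemma pflags_prelabel X : pflags (prelabel X) = r @: pflags X.
Proof.
apply/setP => h; rewrite pflags_pk; apply/codomP/imsetP => [[s ->]|[x xX ->]].
  by exists (lab s) => //; exact: (valP s).
by exists (exist _ x xX).
Qed.

Lemma prelabel_scale c X : prelabel (pscale c X) = pscale c (prelabel X).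
Proof. by rewrite /prelabel pscale_pk. Qed.

Lemma lopt_comp (S : Type) h (l : S -> H) : r \o lopt h l = lopt (r h) (r \o l).
Proof. by apply: funext; case. Qed.

Lemma lsum_comp (S S' : Type) (l : S -> H) (l' : S' -> H) :
  r \o lsum l l' = lsum (r \o l) (r \o l').
Proof. by apply: funext; case. Qed.

Lemma prelabel_pcirc h h' X Y : h \in pflags X -> h' \in pflags Y ->
  [disjoint pflags X & pflags Y] ->
  prelabel (pcirc h h' X Y) = pcirc (r h) (r h') (prelabel X) (prelabel Y).
Proof.
move=> /view1 [S1 [l1 [gx [x [XE i1 c1 _]]]]] /view1 [S2 [l2 [gy [y [YE i2 c2 _]]]]] dis.
have J := lsum_disjoint i1 i2 c1 c2 dis.
have J1 : injective (lsum l1 l2).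
  relabel J (fun z : S1 + S2 => match z with inl z => inl (Some z) | inr z => inr (Some z) end).
rewrite XE YE pcirc_pk // !prelabel_pk // lsum_comp !lopt_comp pcirc_pk //.
- by rewrite -lopt_comp; exact: inj_comp.
- by rewrite -lopt_comp; exact: inj_comp.
- by rewrite -lsum_comp; exact: inj_comp.
Qed.

Lemma prelabel_pcontr h h' X : h != h' -> h \in pflags X -> h' \in pflags X ->
  prelabel (pcontr h h' X) = pcontr (r h) (r h') (prelabel X).
Proof.
move=> hh' hX h'X; have [||S [l [gx [x [XE J cX]]]]] := @view2 _ _ _ X h h'.
- by rewrite /= inE hh'.
- by move=> y; rewrite !inE => /orP[] /eqP ->.
rewrite XE pcontr_pk // !prelabel_pk //; last exact: lopt_injr (lopt_injr J).
rewrite !lopt_comp pcontr_pk //.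
by rewrite -!lopt_comp; exact: inj_comp.
Qed.

End Relabel.

(** * The sign produced by substituting trees *)

Section SubstSign.
Variables (nT nS : nat) (f : 'I_nT -> 'I_nS) (D : 'I_nT -> bool).
Implicit Types (A B : {set 'I_nS}).

Definition dsum A B (R : 'I_nT -> 'I_nT -> bool) : bool :=
  \big[addb/false]_(u | f u \in A) \big[addb/false]_(v | f v \in B) (R u v && (D u && D v)).

Definition inv_rel (u v : 'I_nT) : bool := (u < v)%N && (f v < f u)%N.

(** The exponent of the Koszul sign that sorts the vertices over [A] by their images under [f]. The
    map [f] need not be injective; two vertices with the same image never count as inverted. *)
Definition inv_sign A : bool := dsum A A inv_rel.

Lemma big_preimU A A' (F : 'I_nT -> bool) : [disjoint A & A'] ->
  \big[addb/false]_(u | f u \in A :|: A') F u =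
  \big[addb/false]_(u | f u \in A) F u (+) \big[addb/false]_(u | f u \in A') F u.
Proof.
move=> /pred0P dis; rewrite (bigID (fun u => f u \in A)) /=.
congr addb; apply: eq_bigl => u; rewrite inE; have := dis (f u) => /=;
  by case: (_ \in A); case: (_ \in A').
Qed.

Lemma dsumUl A A' B R : [disjoint A & A'] ->
  dsum (A :|: A') B R = dsum A B R (+) dsum A' B R.
Proof. exact: big_preimU. Qed.

Lemma dsumUr A B B' R : [disjoint B & B'] ->
  dsum A (B :|: B') R = dsum A B R (+) dsum A B' R.
Proof.
move=> dis; rewrite /dsum -big_split; apply: eq_bigr => v _ /=.
exact: big_preimU.
Qed.

Lemma dsumC A B R : dsum A B R = dsum B A (fun u v => R v u).
Proof.
rewrite /dsum exchange_big; apply: eq_bigr => u _; apply: eq_bigr => v _.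
by rewrite [D v && _]andbC.
Qed.

Lemma dsumD A B R R' : dsum A B R (+) dsum A B R' = dsum A B (fun u v => R u v (+) R' u v).
Proof.
rewrite /dsum -big_split; apply: eq_bigr => u _; rewrite -big_split.
by apply: eq_bigr => v _; rewrite /= andb_addl.
Qed.

Lemma eq_dsum A B R R' : (forall u v, f u \in A -> f v \in B -> R u v = R' u v) ->
  dsum A B R = dsum A B R'.
Proof. by move=> RR'; apply: eq_bigr => u uA; apply: eq_bigr => v vB; rewrite RR'. Qed.

Lemma sg_preim A B :
  sg D [set u | f u \in A] [set u | f u \in B] = dsum A B (fun u v => (v < u)%N).
Proof.
rewrite /sg /dsum; apply: eq_big => [u|u _]; first by rewrite inE.
rewrite big_mkcondr; apply: eq_big => [v|v _]; first by rewrite inE.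
by case: (_ < _)%N.
Qed.

(** The parity of a block is the sum of the parities in it, so a product over two blocks distributes
    into a sum over pairs of their vertices. *)
Lemma sg_push A B :
  sg (fun v => \big[addb/false]_(u | f u == v) D u) A B =
  dsum A B (fun u v => (f v < f u)%N).
Proof.
rewrite /sg /dsum (partition_big f (mem A)) //=; apply: eq_bigr => p pA.
rewrite [RHS](eq_bigl (fun u => f u == p)); last first.
  by move=> u; case: eqP => [->|]; rewrite ?pA ?andbF.
rewrite [RHS]exchange_big /= [RHS](partition_big f (mem B)) //= [LHS]big_mkcondr.
apply: eq_bigr => q qB.
rewrite [RHS](eq_bigl (fun u => f u == q)); last first.
  by move=> u; case: eqP => [->|]; rewrite ?qB ?andbF.
rewrite big_distrlr /= [in LHS]exchange_big /=.
case: ifP => qp.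
  apply: eq_bigr => u /eqP uq; apply: eq_bigr => v /eqP vp.
  by rewrite uq vp qp.
rewrite big1 // => u /eqP uq; rewrite big1 // => v /eqP vp.
by rewrite uq vp qp.
Qed.

(** For [u] over [A] and [v] over [B] the order of the vertices and the order of their images
    disagree exactly when the pair is inverted by [f]. Hence the two shuffle exponents differ by the
    mixed inversions. *)
Lemma inv_signU A B : [disjoint A & B] ->
  inv_sign (A :|: B) =
  sg D [set u | f u \in A] [set u | f u \in B]
  (+) sg (fun v => \big[addb/false]_(u | f u == v) D u) A B
  (+) inv_sign A (+) inv_sign B.
Proof.
move=> dis; rewrite sg_preim sg_push /inv_sign dsumUl // !dsumUr //.
have -> : dsum A B (fun u v => (v < u)%N) =
    dsum A B inv_rel (+) dsum B A inv_rel (+) dsum A B (fun u v => (f v < f u)%N).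
  rewrite [dsum B A _]dsumC !dsumD; apply: eq_dsum => u v uA vB; rewrite /inv_rel.
  have : f u != f v.
    by apply/eqP => e; move/pred0P: dis => /(_ (f u)) /=; rewrite uA e vB.
  have [->|uv] := eqVneq u v; first by rewrite eqxx.
  rewrite -!val_eqE /= in uv *.
  by case: (ltngtP u v) uv => //; case: (ltngtP (f u) (f v)).
move: (dsum A A _) (dsum A B inv_rel) (dsum B A _) (dsum B B _) (dsum A B (fun u v : 'I_nT => (f v < f u)%N)).
by do 5!case.
Qed.

End SubstSign.

Section Substitution.
Variables (k : fieldType) (M : modular_operad k).
Variables (nT nS : nat) (HT HS : finType) (attT : HT -> 'I_nT) (attS : HS -> 'I_nS).
Variables (flipT : HT -> HT) (flipS : HS -> HS).
Variables (genT : 'I_nT -> nat) (genS : 'I_nS -> nat).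
Variables (aT : forall v, mspace M (flags (vflags attT v)) (genT v)).
Variables (aS : forall v, mspace M (flags (vflags attS v)) (genS v)).
Variables (r : HS -> HT) (f : 'I_nT -> 'I_nS) (theta : 'I_nS -> tree 'I_nT HT).
Variable (D : 'I_nT -> bool).
Hypothesis r_inj : injective r.
Hypothesis r_flip : forall h, flipS h != h -> r (flipS h) = flipT (r h).
Hypothesis theta_wf : forall v, wf attT flipT (theta v).
Hypothesis theta_V : forall v, tV (theta v) = [set u | f u == v].
Hypothesis theta_pv : forall v, pv D aT (theta v) = prelabel r (pack (aS v)).

Fixpoint subst_tree (s : tree 'I_nS HS) : tree 'I_nT HT :=
  match s with
  | Leaf v => theta v
  | Contr h h' s => Contr (r h) (r h') (subst_tree s)
  | Circ h h' s1 s2 => Circ (r h) (r h') (subst_tree s1) (subst_tree s2)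
  end.

Lemma subst_tV s : tV (subst_tree s) = [set u | f u \in tV s].
Proof.
elim: s => [v|h h' s IH|h h' s1 IH1 s2 IH2] //=.
  by rewrite theta_V; apply/setP => u; rewrite !inE.
by rewrite IH1 IH2; apply/setP => u; rewrite !inE.
Qed.

Lemma imsetD1_inj (L : {set HS}) h : r @: (L :\ h) = (r @: L) :\ r h.
Proof.
apply/setP => x; rewrite !inE; apply/imsetP/andP => [[y]|[xh /imsetP[y yL e]]].
  rewrite !inE => /andP[yh yL] ->; rewrite (inj_eq r_inj) yh; split=> //.
  exact: imset_f.
by exists y => //; rewrite !inE yL andbT; apply: contraNneq xh => <-; rewrite e.
Qed.

Lemma subst_tL s : tL attT (subst_tree s) = r @: tL attS s.
Proof.
elim: s => [v|h h' s IH|h h' s1 IH1 s2 IH2] /=.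
- have := congr1 (@pflags _ _ _) (theta_pv v).
  by rewrite pflags_prelabel.
- by rewrite IH !imsetD1_inj.
- by rewrite IH1 IH2 imsetU !imsetD1_inj.
Qed.

Lemma subst_wf s : wf attS flipS s -> wf attT flipT (subst_tree s).
Proof.
elim: s => [v|h h' s IH|h h' s1 IH1 s2 IH2] //=.
- move=> /and5P[w /eqP e hh' hs h's]; rewrite IH // !subst_tL !(mem_imset _ _ r_inj).
  rewrite hs h's (inj_eq r_inj) hh' e r_flip ?eqxx //.
  by rewrite -e eq_sym.
- move=> /and5P[w1 w2 /eqP e h1 /andP[h2 dis]].
  rewrite IH1 // IH2 // !subst_tL !(mem_imset _ _ r_inj) h1 h2 !subst_tV.
  rewrite e r_flip ?eqxx /=.
    by apply/pred0P => u; rewrite /= !inE; move/pred0P: dis => /(_ (f u)).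
  by apply/eqP => e'; rewrite e e' in h2; exact: tL_disj dis h1 h2.
Qed.

Let DS v := \big[addb/false]_(u | f u == v) D u.

(** At a joining node the substituted tree shuffles vertices where [s] shuffles blocks. By
    [inv_signU] the discrepancies accumulate to the Koszul sign of [f] on the vertices below the
    node. *)
Lemma subst_pv s : wf attS flipS s ->
  pv D aT (subst_tree s) =
  pscale ((-1) ^+ inv_sign f D (tV s)) (prelabel r (pv DS aS s)).
Proof.
elim: s => [v|h h' s IH|h h' s1 IH1 s2 IH2] /=.
- move=> _; rewrite theta_pv /inv_sign /dsum big1 ?expr0 ?pscale1 // => u.
  rewrite inE => /eqP uv; rewrite big1 // => u'; rewrite inE => /eqP uv'.
  by rewrite /inv_rel uv uv' ltnn andbF.
- move=> /and5P[w _ hh' hs h's].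
  by rewrite !pv_Contr IH // pcontr_scale -prelabel_pcontr.
- move=> /and5P[w1 w2 _ h1 /andP[h2 dis]].
  rewrite !pv_Circ IH1 // IH2 // pcirc_scalel pcirc_scaler -prelabel_pcirc //; last first.
    exact: tL_disjoint.
  rewrite prelabel_scale !pscaleA -!signr_addb !subst_tV inv_signU //.
  congr (pscale (_ ^+ nat_of_bool _) _).
  move: (inv_sign _ _ (tV s1)) (inv_sign _ _ (tV s2)) (sg DS _ _) (sg D _ _).
  by do 4!case.
Qed.

End Substitution.

(** * Elements of components with equal colors *)

Section Same.
Variables (k : fieldType) (A : nat * nat -> gvect k).

Definition acast c c' (e : c = c') (x : A c) : A c' :=
  eq_rect c (fun c => A c : Type) x c' e.

Lemma same_acast c c' (e : c = c') (x : A c) : same x (acast e x).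
Proof. by case: c' / e. Qed.

Lemma sameP c c' (x : A c) (y : A c') : same x y -> exists e : c = c', y = acast e x.
Proof.
rewrite /same => xy.
pose P (z : {c & A c : Type}) := exists e : c = projT1 z, projT2 z = acast e x.
have : P (existT _ c x) by exists erefl.
by rewrite xy.
Qed.

Lemma same_eq c (x y : A c) : same x y -> x = y.
Proof. by case/sameP => e ->; rewrite (Prop_irrelevance e erefl). Qed.

Lemma same_color c c' (x : A c) (y : A c') : same x y -> c = c'.
Proof. by case/sameP. Qed.

Lemma acast_linear c c' (e : c = c') : linear (@acast c c' e).
Proof. by case: c' / e. Qed.

Lemma acast_homog c c' (e : c = c') d x : homog d x -> homog d (@acast c c' e x).
Proof. by case: c' / e. Qed.

End Same.

(** * Graphs *)

Section Graph.
Variable (T : ograph).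

Definition local_flags (v : 'I_(nv T)) : seq 'I_(nh T) :=
  [seq h <- enum 'I_(nh T) | att h == v].

Definition leg_label : 'I_(size (legs T)) -> 'I_(nh T) := tnth (in_tuple (legs T)).

Lemma leg_label_inj : injective leg_label.
Proof. by apply/tuple_uniqP; apply: legs_uniq. Qed.

Lemma codom_leg_label h : (h \in codom leg_label) = (flip h == h).
Proof.
rewrite -mem_legs; apply/codomP/idP => [[i ->]|hl]; first exact: mem_tnth.
have /tnthP[i hi] : h \in in_tuple (legs T) by [].
by exists i.
Qed.

Lemma leg_labelE h0 i : leg_label i = nth h0 (legs T) i.
Proof. by rewrite /leg_label (tnth_nth h0). Qed.

Lemma map_val_sig (X : finType) (P : pred X) :
  map val (enum {: {x | P x}}) = [seq x <- enum X | P x].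
Proof. by rewrite map_val_enum_sig enumT. Qed.

End Graph.

Lemma fib_legsE T S (f : premor T S) v :
  map (@fib_h T S f v) (legs (fiber f v)) = map (psi f) (local_flags v).
Proof.
rewrite /= /fib_legs -map_comp.
transitivity (map (psi f) (map \val (enum {: {h : 'I_(nh S) | att h == v}}))).
  rewrite -[RHS]map_comp; apply: eq_map => x.
  by rewrite /= /fib_h enum_rankK.
by rewrite map_val_sig.
Qed.

Lemma source_legsE (T : ggGrc) (v : 'I_(nv T)) :
  map (@fib_h _ _ _ v) (legs (source v)) = local_flags v.
Proof. by rewrite (fib_legsE (premor_id T)) map_id. Qed.

Definition source_label (T : ggGrc) (v : 'I_(nv T)) (i : 'I_(size (legs (source v)))) :
    'I_(nh T) := fib_h (leg_label i).

Lemma source_label_inj (T : ggGrc) (v : 'I_(nv T)) : injective (@source_label T v).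
Proof. by move=> i j e; apply: leg_label_inj; apply: fib_h_inj e. Qed.

Lemma source_labelE (T : ggGrc) (v : 'I_(nv T)) h0
    (i : 'I_(size (legs (source v)))) :
  source_label i = nth h0 (local_flags v) i.
Proof.
rewrite /source_label -source_legsE.
have ii : (i < size (legs (source v)))%N by [].
rewrite (nth_map (leg_label i)) //; by rewrite -leg_labelE.
Qed.

Lemma codom_source_label (T : ggGrc) (v : 'I_(nv T)) h :
  (h \in codom (@source_label T v)) = (att h == v).
Proof.
have -> : (att h == v) = (h \in local_flags v).
  by rewrite mem_filter mem_enum andbT.
rewrite -source_legsE; apply/codomP/mapP => [[i ->]|[j jl ->]].
  by exists (leg_label i) => //; apply: mem_tnth.
have /tnthP[i ji] : j \in in_tuple (legs (source v)) by [].
by exists i; rewrite /source_label /leg_label -ji.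
Qed.

Lemma size_legs (T : ograph) : size (legs T) = #|[set h : 'I_(nh T) | flip h == h]|.
Proof.
by rewrite -(card_uniqP (legs_uniq T)); apply: eq_card => h; rewrite inE mem_legs.
Qed.

Lemma card_edges (T : ograph) : (2 * ne T + size (legs T) = nh T)%N.
Proof.
rewrite size_legs -[RHS]card_ord -(cardsC [set h : 'I_(nh T) | flip h == h]) addnC.
congr addn; rewrite mulnC -sum_nat_const.
pose P := [set h : 'I_(nh T) | flip h != h].
have -> : ~: [set h : 'I_(nh T) | flip h == h] = P by apply/setP => h; rewrite !inE.
rewrite -sum1_card (partition_big_imset (fun h => [set h; flip h])) /=.
rewrite /ne /edges.
have -> : [set [set h; flip h] | h : 'I_(nh T) & flip h != h] =
   [set [set h; flip h] | h in P].
  by apply/setP => e; apply/imsetP/imsetP => -[h]; rewrite !inE => hP ->; exists h; rewrite ?inE.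
apply: eq_bigr => e /imsetP[h hP ->].
rewrite sum1_card; rewrite inE in hP.
have <- : #|[set h; flip h]| = 2%N by rewrite cards2 eq_sym hP.
apply: eq_card => x; rewrite [RHS]unfold_in /= !inE; apply/orP/andP => [|[_ /eqP E]].
  have hP' : h != flip h by rewrite eq_sym.
  by case=> /eqP ->; split; rewrite ?flipK //; apply/eqP/setP => y; rewrite !inE orbC.
have : x \in [set h; flip h] by rewrite -E !inE eqxx.
by rewrite !inE => /orP.
Qed.

Lemma adjacent_sym (T : ograph) : symmetric (@adjacent T).
Proof.
move=> u v; apply/existsP/existsP => -[h /andP[h1 h2]]; exists (flip h);
  by rewrite flipK h1 h2.
Qed.

Lemma connected_n_comp (T : ograph) : connected T -> n_comp (@adjacent T) 'I_(nv T) = 1%N.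
Proof.
case/andP => n0 /forallP conn; pose v0 := Ordinal n0.
have csym : connect_sym (@adjacent T) by apply: sym_connect_sym; exact: adjacent_sym.
rewrite -(n_comp_connect csym v0); apply: eq_n_comp_r => v.
by rewrite !inE; move/forallP: (conn v0) => /(_ v).
Qed.

Lemma connectedP (T : ograph) : connected T -> forall u v, connect (@adjacent T) u v.
Proof. by case/andP=> _ /forallP c u v; move/forallP: (c u). Qed.

Lemma connected_gt0 (T : ograph) : connected T -> (0 < nv T)%N.
Proof. by case/andP. Qed.

Lemma tree_genusE (T : ggGrc) (t : tree 'I_(nv T) 'I_(nh T)) :
  wf (@att T) (@flip T) t -> tV t = setT ->
  tL (@att T) t = [set h | flip h == h] -> tG (@gen T) t = genus T.
Proof.
move=> w tVT tLT.
have E g : (2 * (tG g t + nv T) + size (legs T) =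
            2 * (\sum_(v < nv T) g v + 1) + nh T)%N.
  have := tree_genus g w; rewrite tVT tLT -size_legs cardsT card_ord.
  rewrite (_ : [set h | _] = setT) ?cardsT ?card_ord; last first.
    by apply/setP => h; rewrite !inE.
  by move=> ->; congr (2 * (_ + 1) + _)%N; apply: eq_bigl => v; rewrite inE.
have := E (@gen T); have := E (fun=> 0%N); have := card_edges T.
(* The instance of [E] with zero genera gives [nv T <= ne T + 1], so the truncated subtraction in
   [betti1] is exact. *)
rewrite /genus /betti1 connected_n_comp ?graph_connected //.
rewrite [(\sum_(v < nv T) 0)%N]big1 //; set s := (\sum_(v < nv T) _)%N; lia.
Qed.

Lemma graph_tree (T : ggGrc) : exists t : tree 'I_(nv T) 'I_(nh T),
  [/\ wf (@att T) (@flip T) t, tV t = setT & tL (@att T) t = [set h | flip h == h]].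
Proof.
have c := graph_connected T.
apply: tree_exists (Ordinal (connected_gt0 c)) _; first exact: flipK.
exact: connectedP.
Qed.

Lemma koszul_mono (k : fieldType) n m (f : 'I_n -> 'I_m) d :
  (forall u v : 'I_n, (u <= v)%N -> (f u <= f v)%N) -> koszul k f d = 1.
Proof.
move=> mono; rewrite /koszul big1 // => p /andP[p12].
by rewrite ltnNge mono // ltnW.
Qed.

(** * Pushing inputs forward along a morphism *)

Section Push.
Variables (k : fieldType) (A : nat * nat -> gvect k).
Variable op : forall T : ggGrc, inputs A T -> A (pi0 T).
Hypothesis op_linear : forall T, multilinear (@op T).
Variables (T S : ggGrc) (f : gmor T S).

Definition restrict (v : 'I_(nv S)) (a : inputs A T) : inputs A (gfiber f v) :=
  fun j => acast (esym (pi0_source_fiber (f := f) j)) (a (fib_v j)).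

Arguments restrict : clear implicits.

(** The inputs of the target prescribed by both algebra axioms: in the isomorphism axiom by its
    wording, in the elementary axiom because the operations of the trivial fibers are identities. *)
Definition push (a : inputs A T) : inputs A S :=
  fun v => acast (esym (pi0_source_target f v)) (op (restrict v a)).

Lemma restrictP v (a : inputs A T) (b : inputs A (gfiber f v)) :
  (forall j, same (b j) (a (fib_v j))) -> b = restrict v a.
Proof.
move=> ab; apply: functional_extensionality_dep => j; apply: same_eq.
by rewrite /same (ab j); apply: same_acast.
Qed.

Lemma pushP (a : inputs A T) (c : inputs A S) :
  (forall v, same (c v) (op (restrict v a))) -> c = push a.
Proof.
move=> ac; apply: functional_extensionality_dep => v; apply: same_eq.
by rewrite /same (ac v); apply: same_acast.
Qed.

Lemma same_restrict v (a : inputs A T) j : same (restrict v a j) (a (fib_v j)).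
Proof. by apply/esym/same_acast. Qed.

Lemma same_push (a : inputs A T) v : same (push a v) (op (restrict v a)).
Proof. by apply/esym/same_acast. Qed.

Lemma fib_v_phi v (j : 'I_(nv (gfiber f v))) : phi f (fib_v j) = v.
Proof. exact/eqP/(valP (enum_val j)). Qed.

Lemma fib_v_surj v u : phi f u = v -> exists j : 'I_(nv (gfiber f v)), fib_v j = u.
Proof.
move=> /eqP uv; exists (enum_rank (exist _ u uv : fib_vertex f v)).
by rewrite /fib_v enum_rankK.
Qed.

Lemma fib_v_inj v : injective (@fib_v _ _ f v).
Proof. by move=> i j /val_inj /enum_val_inj. Qed.

Lemma dfwith_linear_at n (V : 'I_n -> gvect k) (a : forall i, V i) i j : j = i ->
  linear (fun x : V i => dfwith a x j).
Proof. by move=> -> c x y; rewrite !dfwith_in. Qed.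

Lemma push_other (a : inputs A T) u (x : A (pi0 (source u))) v : v != phi f u ->
  push (dfwith a x) v = push a v.
Proof.
move=> vu; congr (acast _ (op _)); apply: functional_extensionality_dep => j.
congr acast; rewrite dfwith_out //; apply: contraNneq vu => ->.
by rewrite fib_v_phi.
Qed.

Lemma push_dfwith (a : inputs A T) u (x : A (pi0 (source u))) :
  push (dfwith a x) = dfwith (push a) (push (dfwith a x) (phi f u)).
Proof.
apply: functional_extensionality_dep => v.
have [->|vu] := eqVneq v (phi f u); first by rewrite dfwith_in.
by rewrite dfwith_out 1?eq_sym // push_other.
Qed.

Lemma push_linear (a : inputs A T) u :
  linear (fun x : A (pi0 (source u)) => push (dfwith a x) (phi f u)).
Proof.
have [j ju] := @fib_v_surj (phi f u) u erefl.
have E (x : A (pi0 (source u))) : restrict (phi f u) (dfwith a x) =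
    dfwith (restrict (phi f u) a) (restrict (phi f u) (dfwith a x) j).
  apply: functional_extensionality_dep => i.
  have [->|ij] := eqVneq i j; first by rewrite dfwith_in.
  rewrite dfwith_out 1?eq_sym // /restrict dfwith_out //.
  apply: contraNneq ij => ui; apply/eqP.
  by apply: (@fib_v_inj (phi f u)); rewrite ju.
have Rl : linear (fun x : A (pi0 (source u)) => restrict (phi f u) (dfwith a x) j).
  by move=> c x y; rewrite /restrict (dfwith_linear_at a ju) acast_linear.
move=> c x y; rewrite /push (E (c *: x + y)) Rl op_linear acast_linear.
by rewrite -(E x) -(E y).
Qed.

(** The input at [u] affects only the coordinate [phi f u] of [push], and affects it linearly,
    because [u] is a single vertex of one fiber. *)
Lemma push_multilinear (W : lmodType k) (F : inputs A S -> W) :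
  multilinear F -> multilinear (fun a : inputs A T => F (push a)).
Proof.
move=> Fl a u c x y; rewrite push_dfwith push_linear Fl.
by rewrite -!push_dfwith.
Qed.

Lemma sum_fiber (v : 'I_(nv S)) (R : Type) (idx : R) (m : Monoid.com_law idx)
    (d : 'I_(nv T) -> R) :
  \big[m/idx]_(u | phi f u == v) d u = \big[m/idx]_(j < nv (gfiber f v)) d (fib_v j).
Proof.
rewrite (reindex_omap (@fib_v _ _ f v)
  (fun u => omap enum_rank (insub u : option (fib_vertex f v)))); last first.
  by move=> u uv; rewrite insubT /= /fib_v enum_rankK.
apply: eq_bigl => j; rewrite fib_v_phi eqxx /= /fib_v valK /=.
by rewrite enum_valK eqxx.
Qed.

Lemma push_homog (a : inputs A T) (d : 'I_(nv T) -> int) :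
  (forall (T : ggGrc) (a : inputs A T) (d : 'I_(nv T) -> int),
    (forall i, homog (d i) (a i)) -> homog (\sum_i d i) (op a)) ->
  (forall i, homog (d i) (a i)) ->
  forall v, homog (\sum_(u | phi f u == v) d u) (push a v).
Proof.
move=> oph ad v; apply: acast_homog; rewrite sum_fiber.
by apply: oph => j; apply: acast_homog.
Qed.

(** An order-preserving vertex map has Koszul sign 1, so the law on homogeneous inputs is an
    equality of multilinear maps and extends to all inputs. *)
Lemma push_mono :
  (forall (a : inputs A T) (d : 'I_(nv T) -> int), (forall i, homog (d i) (a i)) ->
     same (op a) (koszul k (phi f) d *: op (push a))) ->
  (forall u v : 'I_(nv T), (u <= v)%N -> (phi f u <= phi f v)%N) ->
  forall a, same (op a) (op (push a)).
Proof.
move=> law mono a.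
have law1 (b : inputs A T) (d : 'I_(nv T) -> int) : (forall i, homog (d i) (b i)) ->
    same (op b) (op (push b)).
  by move=> bd; rewrite -[op (push b)]scale1r -(koszul_mono k d mono); apply: law.
(* Colors are compared by applying the law to the zero input, which is homogeneous. *)
have e : pi0 T = pi0 S.
  apply: (same_color (law1 (fun=> 0) (fun=> 0) _)) => i; exact: homog0.
apply: etrans (same_acast e _) _; rewrite -/(same _ _).
congr existT; move: a; apply: multilinear_ext.
- by move=> a i c x y; rewrite op_linear acast_linear.
- exact: push_multilinear.
- move=> a d ad; apply: same_eq; apply: etrans (esym (same_acast e _)) _.
  exact: law1 ad.
Qed.

End Push.
Arguments restrict {k A T S} f v a.
Arguments push {k A} op {T S} f a.

Lemma pk_tr_gen (k : fieldType) (M : genus_graded_functor k) (H S S' : finType)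
    (l : S -> H) (l' : S' -> H) g g' (x : mspace M S g) : g = g' ->
  injective l -> injective l' -> (forall h, (h \in codom l) = (h \in codom l')) ->
  pk l x = pk l' (tr M l l' x : mspace M S' g').
Proof. by move=> e; case: g' / e; apply: pk_tr. Qed.

(** * Trees of a fiber read in the whole graph *)

Section MapTree.
Variables (k : fieldType) (M : modular_operad k).
Variables (nT nS : nat) (HT HS : finType) (attT : HT -> 'I_nT) (attS : HS -> 'I_nS).
Variables (flipT : HT -> HT) (flipS : HS -> HS).
Variables (genT : 'I_nT -> nat) (genS : 'I_nS -> nat).
Variables (aT : forall v, mspace M (flags (vflags attT v)) (genT v)).
Variables (aS : forall v, mspace M (flags (vflags attS v)) (genS v)).
Variables (r : HS -> HT) (f : 'I_nS -> 'I_nT) (D : 'I_nT -> bool).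
Hypothesis r_inj : injective r.
Hypothesis f_inj : injective f.
Hypothesis f_mono : forall u v : 'I_nS, (f u < f v)%N = (u < v)%N.
(** Restricted to half-edges that are not legs: a leg of a fiber may be half of an edge of the whole
    graph. *)
Hypothesis r_flip : forall h, flipS h != h -> r (flipS h) = flipT (r h).
Hypothesis aST : forall v, pack (aT (f v)) = prelabel r (pack (aS v)).

Fixpoint map_tree (s : tree 'I_nS HS) : tree 'I_nT HT :=
  match s with
  | Leaf v => Leaf (f v)
  | Contr h h' s => Contr (r h) (r h') (map_tree s)
  | Circ h h' s1 s2 => Circ (r h) (r h') (map_tree s1) (map_tree s2)
  end.

Lemma map_tV s : tV (map_tree s) = f @: tV s.
Proof.
elim: s => [v|h h' s IH|h h' s1 IH1 s2 IH2] //=; first by rewrite imset_set1.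
by rewrite IH1 IH2 imsetU.
Qed.

Lemma map_tL s : tL attT (map_tree s) = r @: tL attS s.
Proof.
elim: s => [v|h h' s IH|h h' s1 IH1 s2 IH2] /=.
- by have := congr1 (@pflags _ _ _) (aST v); rewrite pflags_prelabel.
- by rewrite IH !imsetD1_inj.
- by rewrite IH1 IH2 imsetU !imsetD1_inj.
Qed.

Lemma map_disjoint (A B : {set 'I_nS}) : [disjoint A & B] -> [disjoint f @: A & f @: B].
Proof.
move=> /pred0P dis; apply/pred0P => u /=; apply/negP => /andP[/imsetP[x xA ->]].
by rewrite mem_imset // => xB; have := dis x; rewrite /= xA xB.
Qed.

Lemma map_wf s : wf attS flipS s -> wf attT flipT (map_tree s).
Proof.
elim: s => [v|h h' s IH|h h' s1 IH1 s2 IH2] //=.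
- move=> /and5P[w /eqP e hh' hs h's]; rewrite IH // !map_tL !(mem_imset _ _ r_inj).
  rewrite hs h's (inj_eq r_inj) hh' e r_flip ?eqxx //.
  by rewrite -e eq_sym.
- move=> /and5P[w1 w2 /eqP e h1 /andP[h2 dis]].
  rewrite IH1 // IH2 // !map_tL !(mem_imset _ _ r_inj) h1 h2 !map_tV.
  rewrite e r_flip ?eqxx ?map_disjoint //.
  by apply/eqP => e'; rewrite e e' in h2; exact: tL_disj dis h1 h2.
Qed.

Lemma map_sg (A B : {set 'I_nS}) : sg D (f @: A) (f @: B) = sg (D \o f) A B.
Proof.
rewrite /sg big_imset /=; last by move=> x y _ _; apply: f_inj.
apply: eq_bigr => u _; rewrite big_mkcondr big_imset /=; last by move=> x y _ _; apply: f_inj.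
by rewrite [RHS]big_mkcondr; apply: eq_bigr => v _; rewrite f_mono.
Qed.

Lemma map_pv s : wf attS flipS s ->
  pv D aT (map_tree s) = prelabel r (pv (D \o f) aS s).
Proof.
elim: s => [v|h h' s IH|h h' s1 IH1 s2 IH2] /=.
- by move=> _; rewrite [LHS]aST.
- move=> /and5P[w _ hh' hs h's].
  by rewrite !pv_Contr IH // -prelabel_pcontr.
- move=> /and5P[w1 w2 _ h1 /andP[h2 dis]].
  rewrite !pv_Circ IH1 // IH2 // -prelabel_pcirc //; last exact: tL_disjoint.
  by rewrite -prelabel_scale !map_tV map_sg.
Qed.

End MapTree.

(** * The algebra of a modular operad *)

Lemma ord_sorted_eq n (s t : seq 'I_n) :
  sorted (fun x y : 'I_n => x < y)%N s -> sorted (fun x y : 'I_n => x < y)%N t ->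
  s =i t -> s = t.
Proof.
apply: irr_sorted_eq => [x y z|x]; [exact: ltn_trans|exact: ltnn].
Qed.

Lemma ord_enum_sorted n : sorted (fun x y : 'I_n => x < y)%N (enum 'I_n).
Proof. by have := iota_ltn_sorted 0 n; rewrite -val_enum_ord sorted_map. Qed.

Lemma fib_h_mono T S (f : premor T S) v (i j : 'I_(nh (fiber f v))) :
  (i < j)%N -> (fib_h i < fib_h j)%N.
Proof. exact: enum_val_sig_mono. Qed.

Lemma fib_v_mono T S (f : premor T S) v (i j : 'I_(nv (fiber f v))) :
  (fib_v i < fib_v j)%N = (i < j)%N.
Proof.
apply/idP/idP => [|/enum_val_sig_mono //].
by rewrite ltnNge [(i < j)%N]ltnNge; apply: contra; rewrite leq_eqVlt
  => /predU1P[/val_inj -> //|/enum_val_sig_mono /ltnW].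
Qed.

Lemma fib_local_flags T S (f : premor T S) v (j : 'I_(nv (fiber f v))) :
  map (@fib_h _ _ f v) (local_flags j) = local_flags (fib_v j).
Proof.
have tr n : transitive (fun x y : 'I_n => x < y)%N by move=> y x z; apply: ltn_trans.
apply: ord_sorted_eq.
- rewrite sorted_map; apply: (@sub_sorted _ (fun x y : 'I__ => x < y)%N).
    by move=> x y; apply: fib_h_mono.
  by apply: sorted_filter; [exact: tr|exact: ord_enum_sorted].
- by apply: sorted_filter; [exact: tr|exact: ord_enum_sorted].
move=> h; rewrite mem_filter mem_enum andbT.
have attE (i : 'I_(nh (fiber f v))) : fib_v (att i) = att (fib_h i).
  by rewrite /fib_v /= /fib_att enum_rankK.
apply/mapP/eqP => [[i]|hj].
  by rewrite mem_filter => /andP[/eqP <- _] ->; rewrite attE.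
have hv : phi f (att h) == v by rewrite hj; apply: (valP (enum_val j)).
have hE : fib_h (enum_rank (exist _ h hv : fib_half f v)) = h by rewrite /fib_h enum_rankK.
exists (enum_rank (exist _ h hv : fib_half f v)) => //.
rewrite mem_filter mem_enum andbT; apply/eqP/enum_val_inj/val_inj.
by rewrite -[LHS]/(fib_v _) attE hE.
Qed.

Lemma size_local_flags (T : ggGrc) (v : 'I_(nv T)) :
  size (local_flags v) = size (legs (source v)).
Proof. by rewrite -source_legsE size_map. Qed.

Section MOAlgebra.
Variables (k : fieldType) (M : modular_operad k).

Definition mo_car (c : nat * nat) : gvect k := mspace M 'I_c.1 c.2.

Definition decorate (T : ggGrc) (a : inputs mo_car T) (v : 'I_(nv T)) :
    mspace M (flags (vflags (@att T) v)) (gen v) :=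
  tr M (@source_label T v) (@lab _ _) (a v).

Lemma pack_decorate (T : ggGrc) (a : inputs mo_car T) v :
  pack (decorate a v) = pk (@source_label T v) (a v).
Proof.
rewrite /decorate.
rewrite (@pk_tr_gen _ _ _ _ _ _ (@lab _ (vflags (@att T) v)) _ (gen v)) ?pk_lab //.
- by have := pi0_source v => /(congr1 snd).
- exact: source_label_inj.
- exact: lab_inj.
- by move=> h; rewrite codom_source_label codom_lab inE.
Qed.

Lemma decorate_homog (T : ggGrc) (a : inputs mo_car T) v d :
  homog d (a v) -> homog d (decorate a v).
Proof. exact: tr_homog. Qed.

Lemma decorate_dfwith (T : ggGrc) (a : inputs mo_car T) u (x : mo_car (pi0 (source u))) :
  decorate (dfwith a x) = dfwith (decorate a) (decorate (dfwith a x) u).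
Proof.
apply: functional_extensionality_dep => v.
have [->|vu] := eqVneq v u; first by rewrite dfwith_in.
by rewrite dfwith_out 1?eq_sym // /decorate dfwith_out // eq_sym.
Qed.

Definition gtree (T : ggGrc) : tree 'I_(nv T) 'I_(nh T) := sval (cid (graph_tree T)).

Lemma gtree_wf (T : ggGrc) : wf (@att T) (@flip T) (gtree T).
Proof. by have [] := svalP (cid (graph_tree T)). Qed.

Lemma gtree_V (T : ggGrc) : tV (gtree T) = setT.
Proof. by have [] := svalP (cid (graph_tree T)). Qed.

Lemma gtree_L (T : ggGrc) : tL (@att T) (gtree T) = [set h | flip h == h].
Proof. by have [] := svalP (cid (graph_tree T)). Qed.

Definition talpha (T : ggGrc) (D : 'I_(nv T) -> bool) (a : inputs mo_car T) :
    mo_car (pi0 T) :=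
  tr M (@lab _ _) (@leg_label T) (treeval D (decorate a) (gtree T)).

(* Signs depend on degrees; summing over all parities gives a multilinear map, of
   which a single summand survives on homogeneous inputs. *)
Definition galpha (T : ggGrc) (a : inputs mo_car T) : mo_car (pi0 T) :=
  \sum_(D : {ffun 'I_(nv T) -> bool}) talpha D (fun i => parity (D i) (a i)).

Lemma talpha_multilinear (T : ggGrc) (D : 'I_(nv T) -> bool) : multilinear (@talpha T D).
Proof.
move=> a u c x y; rewrite /talpha -tr_linear; congr tr.
have dE : decorate (dfwith a (c *: x + y)) u =
    c *: decorate (dfwith a x) u + decorate (dfwith a y) u.
  by rewrite /decorate !dfwith_in tr_linear.
have uT : u \in tV (gtree T) by rewrite gtree_V inE.
rewrite (decorate_dfwith a (c *: x + y)) (decorate_dfwith a x) (decorate_dfwith a y).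
by rewrite dE (treeval_linear _ _ (gtree_wf T) uT).
Qed.

Lemma galpha_multilinear (T : ggGrc) : multilinear (@galpha T).
Proof.
move=> a u c x y; rewrite /galpha scaler_sumr -big_split; apply: eq_bigr => D _ /=.
have E (z : mo_car (pi0 (source u))) :
    (fun i => parity (D i) (dfwith a z i)) =
    dfwith (fun i => parity (D i) (a i)) (parity (D u) z).
  apply: functional_extensionality_dep => v.
  have [->|vu] := eqVneq v u; first by rewrite !dfwith_in.
  by rewrite !dfwith_out 1?eq_sym.
by rewrite !E parity_linear talpha_multilinear.
Qed.

Definition dpar n (d : 'I_n -> int) : 'I_n -> bool := fun i => odd (absz (d i)).

Lemma galphaE (T : ggGrc) (a : inputs mo_car T) (d : 'I_(nv T) -> int) :
  (forall i, homog (d i) (a i)) -> galpha a = talpha (dpar d) a.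
Proof.
move=> ad; rewrite /galpha (bigD1 [ffun i => dpar d i]) //= big1 ?addr0.
  congr (talpha _ _); first by apply: funext => i; rewrite ffunE.
  apply: functional_extensionality_dep => i.
  by rewrite ffunE (parity_homog _ (ad i)) eqxx.
move=> D DN; have [i iN] : exists i, D i != dpar d i.
  apply/existsP; apply: contraNT DN => /existsPn DE; apply/eqP/ffunP => i.
  by rewrite ffunE; have := DE i; rewrite negbK => /eqP.
apply: (multilinear0 (i := i)); first exact: talpha_multilinear.
by rewrite (parity_homog _ (ad i)) eq_sym (negbTE iN).
Qed.

Lemma galpha_homog (T : ggGrc) (a : inputs mo_car T) (d : 'I_(nv T) -> int) :
  (forall i, homog (d i) (a i)) -> homog (\sum_i d i) (galpha a).
Proof.
move=> ad; rewrite (galphaE ad); apply: tr_homog.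
have -> : \sum_i d i = \sum_(i in tV (gtree T)) d i.
  by apply: eq_bigl => i; rewrite gtree_V inE.
by apply: treeval_homog (gtree_wf T) _ => v; apply: decorate_homog.
Qed.

(** By [pv_unique] every tree that exhausts the graph computes its value, not only the chosen
    [gtree]. *)
Lemma pk_talpha (T : ggGrc) (a : inputs mo_car T) (d : 'I_(nv T) -> int) t :
  (forall i, homog (d i) (a i)) -> wf (@att T) (@flip T) t -> tV t = setT ->
  tL (@att T) t = [set h | flip h == h] ->
  pk (@leg_label T) (talpha (dpar d) a) = pv (dpar d) (decorate a) t.
Proof.
move=> ad w tVT tLT; rewrite /talpha -(@pk_tr_gen _ _ _ _ _ (@lab _ _)).
- rewrite pk_lab; apply: (@pv_unique _ _ _ _ _ _ _ (@flipK T) _ d) => //.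
  + by move=> v; apply: decorate_homog.
  + exact: gtree_wf.
  + by rewrite gtree_V.
  + by rewrite gtree_L.
- by rewrite (tree_genusE (gtree_wf T)) ?gtree_V ?gtree_L.
- exact: lab_inj.
- exact: leg_label_inj.
- by move=> h; rewrite codom_lab codom_leg_label gtree_L inE.
Qed.

Lemma pk_same (H : finType) c c' (l : 'I_c.1 -> H) (l' : 'I_c'.1 -> H)
    (x : mo_car c) (y : mo_car c') : same x y ->
  (forall i j, val i = val j -> l i = l' j) -> pk l x = pk l' y.
Proof.
case/sameP => e -> {y}; subst c' => ll' /=.
by apply: pk_label_ext => i; apply: ll'.
Qed.

Lemma pk_inj (H S : finType) (l : S -> H) g (x y : mspace M S g) : injective l ->
  pk l x = pk l y -> x = y.
Proof.
move=> li exy; pose un (X : packed M H) : mspace M S g := tr M (@lab _ _) l (pval X).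
have unE z : un (pk l z) = z.
  rewrite /un /= tr_comp ?tr_id //; first exact: lab_inj.
  by apply: same_labels_lab => // h; rewrite imset_codom.
by rewrite -[x]unE exy unE.
Qed.

Lemma same_pk (H : finType) c c' (l : 'I_c.1 -> H) (l' : 'I_c'.1 -> H)
    (x : mo_car c) (y : mo_car c') : c = c' -> injective l ->
  (forall i j, val i = val j -> l i = l' j) -> pk l x = pk l' y -> same x y.
Proof.
move=> e li; subst c' => ll'.
have -> : pk l' y = pk l y by apply: pk_label_ext => i; apply/esym/ll'.
by move/(pk_inj li) ->.
Qed.

(** Trees of the fibers substituted into the leaves of a tree of [S] form a tree of [T]. It computes
    the left-hand side by independence of the tree and the right-hand side by [subst_pv]. *)
Lemma galpha_law (T S : ggGrc) (f : gmor T S) (a : inputs mo_car T) (d : 'I_(nv T) -> int) :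
  (forall i, homog (d i) (a i)) ->
  same (galpha a) (koszul k (phi f) d *: galpha (push galpha f a)).
Proof.
move=> ad.
pose dS v := \sum_(u | phi f u == v) d u.
have cd v : homog (dS v) (push galpha f a v).
  by apply: push_homog ad v; exact: galpha_homog.
pose dF v := d \o @fib_v _ _ f v.
have bd v (j : 'I_(nv (gfiber f v))) : homog (dF v j) (restrict f v a j) by apply: acast_homog.
pose theta v := map_tree (@fib_h _ _ f v) (@fib_v _ _ f v) (gtree (gfiber f v)).
have fib_mono v (u w : 'I_(nv (gfiber f v))) := fib_v_mono (f := f) u w.
have theta_V v : tV (theta v) = [set u | phi f u == v].
  rewrite map_tV (gtree_V (gfiber f v)); apply/setP => u; rewrite inE.
  apply/imsetP/eqP => [[j _ ->]|/fib_v_surj[j <-]]; first exact: fib_v_phi.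
  by exists j; rewrite ?inE.
have fib_flip v (h : 'I_(nh (gfiber f v))) : flip h != h -> fib_h (flip h) = flip (fib_h h).
  rewrite -(inj_eq (@fib_h_inj _ _ f v)) [fib_h (flip h)]fib_h_flip /cut.
  by case: ifP => //; rewrite eqxx.
have aE v (j : 'I_(nv (gfiber f v))) : pack (decorate a (fib_v j)) =
    prelabel (@fib_h _ _ f v) (pack (decorate (restrict f v a) j)).
  rewrite !pack_decorate prelabel_pk; [|exact: fib_h_inj|exact: source_label_inj].
  apply: esym; apply: (pk_same (same_restrict (f:=f) a j)) => i i' ii' /=.
  rewrite (source_labelE (source_label i) i) (source_labelE (fib_h (source_label i)) i').
  rewrite -fib_local_flags -ii' (nth_map (source_label i)) //.
  rewrite (@size_local_flags (gfiber f v) j); exact: (ltn_ord i).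
have r_inj := psi_inj (p := f).
(* The tree over [v] evaluates to the pushed input at [v]. The inputs match because the global order
   of a fiber is the local order of the target. *)
have theta_pv v : pv (dpar d) (decorate a) (theta v) =
    prelabel (psi f) (pack (decorate (push galpha f a) v)).
  rewrite /theta (map_pv _ _ _ _ (aE v) (gtree_wf (gfiber f v)));
    [|exact: fib_h_inj|exact: fib_v_inj|exact: fib_mono].
  rewrite -[dpar d \o _]/(dpar (dF v)).
  rewrite -(pk_talpha (bd v)) ?gtree_V ?gtree_L //; last exact: gtree_wf.
  rewrite -(galphaE (bd v)) prelabel_pk; [|exact: fib_h_inj|exact: leg_label_inj].
  rewrite pack_decorate prelabel_pk //; last exact: source_label_inj.
  apply/esym/(pk_same (same_push galpha f a v)) => i i' ii' /=.
  have lE := fib_legsE f v; rewrite -source_legsE -map_comp in lE.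
  rewrite /source_label (leg_labelE (leg_label i)) (leg_labelE (leg_label i')).
  have si : (i < size (legs (source v)))%N by [].
  have si' : (i' < size (legs (fiber f v)))%N by [].
  rewrite -(nth_map _ (fib_h (leg_label i')) _ si') lE -ii'.
  by rewrite (nth_map (leg_label i)).
have theta_wf v : wf (@att T) (@flip T) (theta v).
  apply: (map_wf (flipS := @flip (fiber f v)) _ _ _ (aE v)) => //;
    [exact: fib_h_inj|exact: fib_v_inj|exact: fib_flip|exact: gtree_wf].
pose sub := subst_tree (psi f) theta (gtree S).
have sub_wf : wf (@att T) (@flip T) sub.
  apply: (subst_wf (flipS := @flip S) r_inj _ theta_wf theta_V theta_pv (gtree_wf S)).
  by move=> h _; apply: psi_flip.
have sub_V : tV sub = setT.
  by rewrite (subst_tV _ theta_V) gtree_V; apply/setP => u; rewrite !inE.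
have sub_L : tL (@att T) sub = [set h | flip h == h].
  rewrite (subst_tL r_inj theta_pv) gtree_L; apply/setP => h; rewrite inE -mem_legs.
  rewrite -(psi_legs f); apply/imsetP/mapP => -[x xS ->]; exists x => //;
    by move: xS; rewrite inE -mem_legs.
have := subst_pv r_inj theta_V theta_pv (gtree_wf S).
rewrite -(pk_talpha ad sub_wf sub_V sub_L) gtree_V.
have -> : (fun v => \big[addb/false]_(u | phi f u == v) dpar d u) = dpar dS.
  by apply: funext => v; rewrite /dpar /dS odd_absz_sum.
rewrite -(pk_talpha cd) ?gtree_V ?gtree_L //; last exact: gtree_wf.
rewrite prelabel_pk //; last exact: leg_label_inj.
rewrite pscale_pk -(galphaE ad) -(galphaE cd) => E.
(* The product of signs over inverted pairs is rewritten as one sign whose exponent is the sum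
   modulo 2 over all pairs of vertices. *)
have -> : koszul k (phi f) d = (-1) ^+ inv_sign (phi f) (dpar d) setT.
  rewrite /koszul /inv_sign /dsum.
  rewrite (eq_bigr (fun p => (-1) ^+ (dpar d p.1 && dpar d p.2))); last first.
    by move=> p _; rewrite -signr_odd abszM oddM.
  rewrite -(big_morph _ (@signr_addb k) (erefl ((-1) ^+ false : k))).
  congr (_ ^+ nat_of_bool _).
  rewrite -(pair_big_dep xpredT (fun u v : 'I_(nv T) => (u < v)%N && (phi f v < phi f u)%N)
     (fun u v => dpar d u && dpar d v)) /=.
  apply: eq_big => [u|u _]; first by rewrite inE.
  rewrite big_mkcond; apply: eq_big => [v|v _]; first by rewrite inE.
  by rewrite /inv_rel; case: (_ && (_ < _)%N).
apply: (@same_pk _ (pi0 T) (pi0 S) _ _ _ _ _ _ _ E).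
- congr pair; first by rewrite -(psi_legs f) size_map.
  by have := congr1 (@pgen _ _ _) E.
- exact: leg_label_inj.
move=> i j ij; rewrite /= (leg_labelE (psi f (leg_label j)) i) (leg_labelE (leg_label j) j).
by rewrite (_ : nat_of_ord i = j) // -(psi_legs f) (nth_map (leg_label j)).
Qed.

End MOAlgebra.

Lemma trivial_local_flags (U : ggGrc) (i : 'I_(nv U)) :
  is_trivial U -> local_flags i = legs U.
Proof.
case=> nvE _ ->; rewrite /local_flags; apply/all_filterP/allP => h _.
by apply/eqP/ord_eq1.
Qed.

Lemma multilinear_coord (k : fieldType) n (V : 'I_n -> gvect k) (i : 'I_n) :
  n = 1%N -> multilinear (fun a : forall i, V i => a i).
Proof. by move=> n1 a j; apply: dfwith_linear_at; apply: ord_eq1. Qed.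

Section MOAlgebra.
Variables (k : fieldType) (M : modular_operad k).

Lemma galpha_unit (U : ggGrc) : is_trivial U ->
  forall (a : inputs (mo_car M) U) (i : 'I_(nv U)), same (galpha a) (a i).
Proof.
move=> trU a i; have [nvE neE legsE] := trU.
have e : pi0 U = pi0 (source i) by rewrite pi0_trivial.
have setT1 : [set i] = setT by apply/setP => j; rewrite !inE (ord_eq1 j i nvE) eqxx.
have flipE h : flip h = h :> 'I_(nh U).
  by apply/eqP; rewrite -mem_legs legsE mem_enum.
apply: etrans (same_acast e _) _; congr existT; move: a.
apply: multilinear_ext; [|exact: multilinear_coord|].
  by move=> a j c x y; rewrite galpha_multilinear acast_linear.
move=> a d ad; apply: same_eq; apply: etrans (esym (same_acast e _)) _.
have := @pk_talpha _ _ _ _ _ (Leaf i) ad isT setT1.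
rewrite -galphaE // => E.
have {}E : pk (@leg_label U) (galpha a) = pk (@source_label U i) (a i).
  rewrite E; first exact: pack_decorate.
  by apply/setP => h; rewrite !inE (ord_eq1 (att h) i nvE) flipE !eqxx.
apply: (@same_pk _ _ _ (pi0 U) (pi0 (source i)) _ _ _ _ e _ _ E).
  exact: leg_label_inj.
move=> j j' jj'; rewrite (leg_labelE (leg_label j)) (source_labelE (leg_label j)).
by rewrite (trivial_local_flags _ trU) (_ : nat_of_ord j = j').
Qed.

Lemma galpha_elem (T S : ggGrc) (f : gmor T S) (i : 'I_(nv S)) :
    is_elementary f i ->
    forall (a : inputs (mo_car M) T) (b : inputs (mo_car M) (gfiber f i))
      (c : inputs (mo_car M) S),
      (forall j, same (b j) (a (fib_v j))) ->
      same (c i) (galpha b) ->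
      (forall u, phi f u != i -> same (c (phi f u)) (a u)) ->
    same (galpha a) (galpha c).
Proof.
move=> [mono triv _] a b c ba cb ca.
(* Away from [i] the fiber is trivial, so by [galpha_unit] the pushed input is the original one. *)
have -> : c = push (@galpha k M) f a.
  apply: pushP => v; have [->|vi] := eqVneq v i.
    by rewrite /same cb -(restrictP ba).
  have [u uv] := phi_surj f v; have [j ju] := fib_v_surj uv.
  rewrite /same (galpha_unit (triv v vi) _ j) (same_restrict a j).
  have cw w : w = v -> same (c w) (a (fib_v j)) -> same (c v) (a (fib_v j)) by move=> ->.
  by apply: cw (fib_v_phi j) (ca _ _); rewrite fib_v_phi.
apply: (push_mono (@galpha_multilinear k M) _ mono).
by move=> a' d; apply: galpha_law.
Qed.

Lemma galpha_iso (T S : ggGrc) (w : gmor T S) : is_iso w ->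
    forall (a : inputs (mo_car M) T) (d : 'I_(nv T) -> int)
      (b : forall v, inputs (mo_car M) (gfiber w v)) (c : inputs (mo_car M) S),
      (forall u, homog (d u) (a u)) ->
      (forall v j, same (b v j) (a (fib_v j))) ->
      (forall v, same (c v) (galpha (b v))) ->
    same (galpha a) (koszul k (phi w) d *: galpha c).
Proof.
move=> _ a d b c ad ba cb.
have -> : c = push (@galpha k M) w a.
  by apply: pushP => v; rewrite /same cb -(restrictP (ba v)).
exact: galpha_law.
Qed.

Definition mo_algebra : algebra k :=
  @Algebra k (mo_car M) (@galpha k M) (@galpha_multilinear k M) (@galpha_homog k M)
    galpha_unit galpha_elem galpha_iso.

End MOAlgebra.

(** * Graphs presented by lists of half-edges *)

Lemma nth_map_ord n (X : Type) (x0 : X) (f : 'I_n -> X) (v : 'I_n) :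
  nth x0 [seq f i | i <- enum 'I_n] v = f v.
Proof. by rewrite (nth_map v) ?size_enum_ord // nth_ord_enum. Qed.

Lemma fib_v_enum T S (f : premor T S) v :
  map (@fib_v _ _ f v) (enum 'I_(nv (fiber f v))) = [seq u <- enum 'I_(nv T) | phi f u == v].
Proof.
have tr n : transitive (fun x y : 'I_n => x < y)%N by move=> y x z; apply: ltn_trans.
apply: ord_sorted_eq.
- rewrite sorted_map; apply: (@sub_sorted _ (fun x y : 'I__ => x < y)%N).
    by move=> x y /=; rewrite fib_v_mono.
  exact: ord_enum_sorted.
- by apply: sorted_filter; [exact: tr|exact: ord_enum_sorted].
move=> u; rewrite mem_filter mem_enum andbT.
apply/mapP/idP => [[j _ ->]|uv]; first exact: (valP (enum_val j)).
exists (enum_rank (exist _ u uv : fib_vertex f v)); first by rewrite mem_enum.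
by rewrite /fib_v enum_rankK.
Qed.

(** By [att_mono] the half-edges at each vertex form an interval and the intervals follow the order
    of the vertices, so the local lists concatenate to the full numbering. *)
Lemma flatten_local_flags T :
  flatten [seq local_flags v | v <- enum 'I_(nv T)] = enum 'I_(nh T).
Proof.
have step (m : nat) (s : seq 'I_(nh T)) : sorted (fun x y : 'I_(nh T) => x < y)%N s ->
    [seq h <- s | (att h < m.+1)%N] =
    [seq h <- s | (att h < m)%N] ++ [seq h <- s | (att h == m :> nat)].
  elim: s => //= h s IH hs; have {}IH := IH (path_sorted hs).
  have hs' : all (fun x : 'I_(nh T) => att h <= att x)%N s.
    have tr : transitive (fun x y : 'I_(nh T) => x < y)%N by move=> y x z; apply: ltn_trans.
    apply: sub_all (order_path_min tr hs) => x hx; apply: att_mono; exact: ltnW.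
  case: (ltngtP (att h) m) => hm.
  - by rewrite ltnS (ltnW hm) IH.
  - rewrite ltnS leqNgt hm /= IH; congr cat.
  - rewrite ltnS hm leqnn /= IH.
    suff -> : [seq x <- s | (att x < m)%N] = [::] by [].
    rewrite -(filter_pred0 s); apply: eq_in_filter => x xs.
    by move/allP: hs' => /(_ x xs); rewrite hm leqNgt => /negbTE ->.
have H (m : nat) (s : seq 'I_(nh T)) : sorted (fun x y : 'I_(nh T) => x < y)%N s ->
    flatten [seq [seq h <- s | (att h == v :> nat)] | v <- iota 0 m] =
    [seq h <- s | (att h < m)%N].
  move=> ss; elim: m => [|m IH]; first by rewrite /= -(filter_pred0 s).
  by rewrite step // -IH -addn1 iotaD map_cat flatten_cat /= cats0.
rewrite -[RHS](@filter_predT _ (enum 'I_(nh T))).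
rewrite -[RHS](@eq_filter _ (fun h => (att h < nv T)%N)); last first.
  by move=> h; rewrite /= ltn_ord.
rewrite -H; last exact: ord_enum_sorted.
by rewrite -val_enum_ord -map_comp.
Qed.

Section Reads.
Variable H : finType.
Implicit Types (T S F : ograph) (fl : H -> H) (lg w : seq H) (vs : seq (seq H)) (gs : seq nat).

(* [l] identifies [T] with the graph whose vertices have the lists of half-edges
   [vs] and the genera [gs], with involution [fl] and legs [lg]. *)
Definition reads_by T fl lg vs gs (l : 'I_(nh T) -> H) : Prop :=
  [/\ injective l, forall h, l (flip h) = fl (l h), lg = map l (legs T),
      vs = [seq map l (local_flags v) | v <- enum 'I_(nv T)] &
      gs = [seq gen v | v <- enum 'I_(nv T)]].

Definition reads T fl lg vs gs : Prop := exists l, @reads_by T fl lg vs gs l.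

Lemma reads_flatten T fl lg vs gs l : @reads_by T fl lg vs gs l ->
  flatten vs = map l (enum 'I_(nh T)).
Proof. by case=> _ _ _ -> _; rewrite map_comp -map_flatten flatten_local_flags. Qed.

Lemma reads_mem T fl lg vs gs l : @reads_by T fl lg vs gs l ->
  forall h, h \in flatten vs <-> exists i, h = l i.
Proof.
move=> /reads_flatten -> h; split => [/mapP[i _ ->]|[i ->]]; first by exists i.
by apply: map_f; rewrite mem_enum.
Qed.

Lemma reads_size T fl lg vs gs : reads T fl lg vs gs ->
  [/\ size vs = nv T, size gs = nv T & size (flatten vs) = nh T].
Proof.
move=> [l lr]; have fE := congr1 size (reads_flatten lr).
rewrite size_map size_enum_ord in fE; rewrite fE; case: lr => _ _ _ -> ->.
by rewrite 2!size_map !size_enum_ord.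
Qed.

Lemma reads_nth T fl lg vs gs l (v : 'I_(nv T)) : @reads_by T fl lg vs gs l ->
  nth [::] vs v = map l (local_flags v) /\ nth 0%N gs v = gen v.
Proof.
by case=> _ _ _ -> ->; rewrite !nth_map_ord.
Qed.

(** Exactly what lists must satisfy to present a graph, connected or not; see [reads_rwf] and
    [reads_exists]. *)
Definition rwf fl lg vs gs : Prop :=
  [/\ uniq (flatten vs), forall h, h \in flatten vs -> fl h \in flatten vs /\ fl (fl h) = h,
      uniq lg, forall h, (h \in lg) = (h \in flatten vs) && (fl h == h) &
      size gs = size vs].

Lemma reads_rwf T fl lg vs gs : reads T fl lg vs gs -> rwf fl lg vs gs.
Proof.
move=> r; have [sv sg sf] := reads_size r; case: r => l lr.
have fE := reads_flatten lr; have mE := reads_mem lr.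
case: lr => li lf lgE vsE gsE; split.
- by rewrite fE map_inj_uniq // enum_uniq.
- move=> h /mE[i ->]; rewrite -!lf flipK; split=> //; apply/mE; by eexists.
- by rewrite lgE map_inj_uniq // legs_uniq.
- move=> h; apply/idP/andP.
    rewrite lgE => /mapP[i il ->]; split; first by apply/mE; eexists.
    by rewrite -lf; apply/eqP; congr l; apply/eqP; rewrite -mem_legs.
  case=> /mE[i ->]; rewrite -lf (inj_eq li) -mem_legs lgE => il; exact: map_f.
- by rewrite sg sv.
Qed.

(** The concatenated lists fix the numbering of the half-edges, so the labellings agree position by
    position and all fields are determined. Equality, rather than isomorphism, makes the value of an
    algebra on lists well defined. *)
Lemma reads_inj T T' fl lg vs gs : reads T fl lg vs gs -> reads T' fl lg vs gs -> T = T'.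
Proof.
move=> r r'; have [sv sg sf] := reads_size r; have [sv' sg' sf'] := reads_size r'.
case: r r' => l lr [l' lr'].
case: T l lr sv sg sf => n m at1 fl1 lg1 gn1 am fk lu lm l lr /= sv sg sf.
case: T' l' lr' sv' sg' sf' => n' m' at' fl' lg' gn' am' fk' lu' lm' l' lr' /= sv' sg' sf'.
have en : n = n' by rewrite -sv.
have em : m = m' by rewrite -sf.
clear sv sg sf sv' sg' sf'; subst n' m'.
have fE := reads_flatten lr; rewrite (reads_flatten lr') /= in fE.
have ll' : l' = (l : 'I_m -> H) :> ('I_m -> H).
  apply: funext => i; have := congr1 (fun s => nth (l i) s i) fE.
  by rewrite !nth_map_ord.
subst l'.
have atE : at1 = at'.
  apply: funext => h; apply: val_inj => /=.
  have [v1 _] := @reads_nth (OGraph gn1 am fk lu lm) _ _ _ _ l (at1 h) lr.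
  have [v2 _] := @reads_nth (OGraph gn' am' fk' lu' lm') _ _ _ _ l (at1 h) lr'.
  have : l h \in nth [::] vs (at1 h).
    by rewrite v1 map_f // mem_filter eqxx mem_enum.
  case: lr => li _ _ _ _; rewrite v2 (mem_map li) mem_filter => /andP[/eqP /= -> _].
  by [].
case: lr lr' => li lf lgE _ gE [_ lf' lgE' _ gE'] /=.
have flE : fl1 = fl' by apply: funext => h; apply: li; rewrite lf /= lf'.
have lgEE : lg1 = lg'.
  by apply: (inj_map li); rewrite -[LHS]lgE -[RHS]lgE'.
have gnE : gn1 = gn'.
  apply: funext => v; have := congr1 (fun s => nth 0%N s v) (etrans (esym gE) gE').
  by rewrite /= !nth_map_ord.
subst at' fl' lg' gn'.
by congr OGraph; apply: Prop_irrelevance.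
Qed.

Definition vidx vs (x : H) : nat := find (fun s : seq H => x \in s) vs.

Arguments vidx : simpl never.

Lemma vidx_filter vs v : uniq (flatten vs) ->
  [seq x <- flatten vs | vidx vs x == v] = nth [::] vs v.
Proof.
elim: vs v => [|s vs IH] v; first by rewrite nth_nil.
rewrite /= cat_uniq => /and3P[_ dis u].
have E : {in flatten vs, forall x, vidx (s :: vs) x = (vidx vs x).+1}.
  move=> x xv; rewrite /vidx /=; case: ifP => // xs.
  by case/hasP: dis; exists x.
have E0 : {in s, forall x, vidx (s :: vs) x = 0%N}.
  by move=> x xs; rewrite /vidx /= xs.
rewrite filter_cat; case: v => [|v] /=.
  rewrite (eq_in_filter (a2 := predT)) ?filter_predT; last by move=> x /E0 ->.
  rewrite (eq_in_filter (a2 := pred0)) ?filter_pred0 ?cats0 //; last by move=> x /E ->.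
rewrite (eq_in_filter (a2 := pred0)) ?filter_pred0 /=; last by move=> x /E0 ->.
by rewrite -IH //; apply: eq_in_filter => x /E ->.
Qed.

Lemma vidx_mono vs x0 i j : uniq (flatten vs) -> (i <= j)%N -> (j < size (flatten vs))%N ->
  (vidx vs (nth x0 (flatten vs) i) <= vidx vs (nth x0 (flatten vs) j))%N.
Proof.
elim: vs i j => [|s vs IH] i j //=; rewrite cat_uniq => /and3P[_ dis u] ij.
rewrite size_cat => js; rewrite !nth_cat.
have E x : x \in flatten vs -> vidx (s :: vs) x = (vidx vs x).+1.
  move=> xv; rewrite /vidx /=; case: ifP => // xs.
  by case/hasP: dis; exists x.
have [is_|si] := ltnP i (size s); first by rewrite {1}/vidx /= mem_nth.
have is' : (i - size s < size (flatten vs))%N by lia.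
have js' : (j - size s < size (flatten vs))%N by lia.
rewrite ltnNge (leq_trans si ij) /= !E ?mem_nth // ltnS.
by apply: IH => //; lia.
Qed.

Lemma reads_exists fl lg vs gs : rwf fl lg vs gs -> exists T, reads T fl lg vs gs.
Proof.
case=> u flP lu lgP sg.
pose F := flatten vs; pose l (i : 'I_(size F)) : H := tnth (in_tuple F) i.
have lF i : l i \in F by apply: mem_tnth.
have li : injective l by apply/tuple_uniqP.
have lx x0 (i : 'I_(size F)) : l i = nth x0 F i by rewrite /l (tnth_nth x0).
have vidx_lt x : x \in F -> (vidx vs x < size vs)%N.
  by move=> /flattenP[s svs xs]; rewrite -has_find; apply/hasP; exists s.
have inv x : x \in F -> exists i, l i == x.
  by move=> xF; have /tnthP[i ->] : x \in in_tuple F by []; exists i.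
pose at_ i : 'I_(size vs) := Ordinal (vidx_lt _ (lF i)).
pose transp i : 'I_(size F) := xchoose (inv _ (proj1 (flP _ (lF i)))).
have flE i : l (transp i) = fl (l i) by apply/eqP/(xchooseP (inv _ (proj1 (flP _ (lF i))))).
have lgF h : h \in lg -> h \in F by rewrite lgP => /andP[].
pose lgs : seq 'I_(size F) := pmap (fun h => [pick i | l i == h]) lg.
have lgsE : map l lgs = lg.
  rewrite /lgs; elim: (lg) lgF => //= h s IH sF.
  case: pickP => [i /eqP <-|no]; first by rewrite /= IH // => x xs; apply: sF; rewrite inE xs orbT.
  by have [i il] := inv h (sF h (mem_head _ _)); rewrite no in il.
have am (h h' : 'I_(size F)) : (h <= h')%N -> (at_ h <= at_ h')%N.
  by move=> hh'; have := vidx_mono (l h) u hh' (ltn_ord h'); rewrite -!lx.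
have fk : involutive transp by move=> i; apply: li; rewrite !flE (proj2 (flP _ (lF i))).
have lgu : uniq lgs by rewrite -(map_inj_uniq li) lgsE.
have lgm h : (h \in lgs) = (transp h == h).
  by rewrite -(mem_map li) lgsE lgP lF /= -(inj_eq li) flE.
pose T := OGraph (fun v : 'I_(size vs) => nth 0%N gs v) am fk lgu lgm.
exists T, l; split=> //.
- apply: (@eq_from_nth _ [::]); first by rewrite size_map size_enum_ord.
  move=> v vlt; rewrite (nth_map_ord _ _ (Ordinal vlt)).
  have FE : flatten vs = map l (enum 'I_(size F)) := esym (map_tnth_enum (in_tuple F)).
  rewrite -vidx_filter // {1}FE filter_map.
  by congr map; apply: eq_filter => i.
- apply: (@eq_from_nth _ 0%N); first by rewrite size_map size_enum_ord sg.
  move=> v; rewrite sg => vlt; by rewrite (nth_map_ord _ _ (Ordinal vlt)).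
Qed.

(** The fiber over [v] is read off the lists without renaming: the vertex lists over [v], with the
    list of [v] itself as legs. *)
Lemma fiber_reads T S (f : premor T S) v fl fl' lg lg' vs vs' gs gs' l l' :
  @reads_by T fl lg vs gs l -> @reads_by S fl' lg' vs' gs' l' ->
  (forall h, l (psi f h) = l' h) ->
  forall flF, (forall h,
     h \in flatten [seq nth [::] vs (u : 'I_(nv T)) | u <- enum 'I_(nv T) & phi f u == v] ->
     flF h = if h \in nth [::] vs' v then h else fl h) ->
  reads (fiber f v) flF (nth [::] vs' v)
    [seq nth [::] vs (u : 'I_(nv T)) | u <- enum 'I_(nv T) & phi f u == v]
    [seq nth 0%N gs (u : 'I_(nv T)) | u <- enum 'I_(nv T) & phi f u == v].
Proof.
move=> r r' ll' flF flFE; have [v' _] := reads_nth v r'.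
have [li lf _ _ _] := r; have [li' _ _ _ _] := r'.
have vsE : [seq nth [::] vs (u : 'I_(nv T)) | u <- enum 'I_(nv T) & phi f u == v] =
    [seq map (l \o @fib_h _ _ f v) (@local_flags (fiber f v) j) | j <- enum 'I_(nv (fiber f v))].
  rewrite -fib_v_enum -map_comp; apply: eq_map => j /=.
  by rewrite map_comp fib_local_flags; have [-> _] := reads_nth (fib_v j) r.
exists (l \o @fib_h _ _ f v); split => //.
- exact: inj_comp li (@fib_h_inj _ _ f v).
- move=> h; rewrite [LHS]/= [fib_h (flip h)]fib_h_flip flFE /cut; last first.
    rewrite vsE map_comp -map_flatten; apply: map_f.
    by rewrite flatten_local_flags mem_enum.
  rewrite v'; have -> : (fib_h h \in codom (psi f)) = ((l \o fib_h (v := v)) h \in map l' (local_flags v)).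
    apply/codomP/mapP => [[x hx]|[x _]].
      exists x; last by rewrite /= hx ll'.
      rewrite mem_filter mem_enum andbT -(phi_att f) -hx; exact: (valP (enum_val h)).
    by rewrite -ll' => /li hx; exists x.
  by case: ifP => //; rewrite lf.
- transitivity (map l (map (@fib_h _ _ f v) (legs (fiber f v)))); last by rewrite -map_comp.
  by rewrite fib_legsE -map_comp v'; apply: eq_map => x; exact: esym (ll' x).
- rewrite -fib_v_enum -map_comp; apply: eq_map => j /=.
  by have [_ ->] := reads_nth (fib_v j) r.
Qed.

(** When both graphs are named by the same set, [psi] is inclusion of names, and a morphism comes
    down to a compatible vertex map. *)
Lemma premor_reads T S fl lg vs vs' gs gs' l l' (p : 'I_(nv T) -> 'I_(nv S)) :
  @reads_by T fl lg vs gs l -> @reads_by S fl lg vs' gs' l' ->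
  (forall v, exists u, p u = v) ->
  (forall h, exists i, l i == l' h) ->
  (forall i h, l i = l' h -> p (att i) = att h) ->
  (forall i, (forall h, l i <> l' h) -> p (att i) = p (att (flip i))) ->
  exists f : premor T S, phi f = p /\ forall h, l (psi f h) = l' h.
Proof.
move=> [li lf lgE _ _] [li' lf' lgE' _ _] psurj ex patt pcon.
pose q h := xchoose (ex h); have qE h : l (q h) = l' h by apply/eqP/(xchooseP (ex h)).
have qi : injective q by move=> x y e; apply: li'; rewrite -!qE e.
have qf h : q (flip h) = flip (q h) by apply: li; rewrite lf !qE lf'.
have ql : map q (legs S) = legs T.
  apply: (inj_map li); rewrite -map_comp -lgE lgE'; apply: eq_map => h; exact: qE.
have qa h : p (att (q h)) = att h by apply: patt.
have qc i : i \notin codom q -> p (att i) = p (att (flip i)).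
  move=> iq; apply: pcon => h e; case/negP: iq; apply/codomP; exists h.
  by apply: li; rewrite qE.
by exists (PreMor qi qf ql psurj qa qc).
Qed.

Lemma premor_connected T S (f : premor T S) : connected T -> connected S.
Proof.
case/andP=> n0 /forallP conn; apply/andP; split.
  exact: leq_ltn_trans (leq0n _) (ltn_ord (phi f (Ordinal n0))).
apply/forallP => u; apply/forallP => v.
have [u' <-] := phi_surj f u; have [v' <-] := phi_surj f v.
case/connectP: (forallP (conn u') v') => s; elim: s u' => [|y s IH] x /=.
  by move=> _ ->.
case/andP=> /existsP[h /andP[/eqP hx /eqP hy]] ys vE.
apply: connect_trans (IH y ys vE).
have [/codomP[z zE]|hN] := boolP (h \in codom (psi f)).
  apply: connect1; apply/existsP; exists z; rewrite -hx -hy zE phi_att eqxx /=.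
  by rewrite -(phi_att f) psi_flip.
by rewrite -hx -hy (phi_contr hN) connect0.
Qed.

End Reads.

Lemma ggGrc_eq (T S : ggGrc) : graph T = graph S -> T = S.
Proof.
case: T S => [T cT] [S cS] /= e; case: S / e cS => cS.
by congr GgGrc; apply: Prop_irrelevance.
Qed.

Lemma ne_fiber_full T S (f : premor T S) v :
  (forall h, h \in codom (psi f)) -> ne (fiber f v) = 0%N.
Proof.
by move=> full; apply: ne_flip => h; apply: fib_h_inj; rewrite fib_h_flip /cut full.
Qed.

Lemma card_fiber_inj T S (f : premor T S) v : injective (phi f) -> nv (fiber f v) = 1%N.
Proof.
move=> inj; have [u uv] := phi_surj f v.
rewrite /= card_sig -(card1 u); apply: eq_card => x.
by rewrite !inE -uv (inj_eq inj).
Qed.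

Lemma genus_fiber_bij T S (f : premor T S) v : injective (phi f) ->
  (forall h, h \in codom (psi f)) -> forall j : 'I_(nv (fiber f v)),
  genus (fiber f v) = gen (fib_v j).
Proof.
move=> inj full j; have n1 := card_fiber_inj v inj.
rewrite genus_ne0 ?ne_fiber_full //.
rewrite (eq_bigr (fun=> gen (fib_v j))) => [|i _]; last by rewrite (ord_eq1 i j n1).
by rewrite sum_nat_const card_ord n1 mul1n.
Qed.

Lemma bij_is_iso (T S : ggGrc) (f : gmor T S) : injective (phi f) ->
  (forall h, h \in codom (psi f)) -> is_iso f.
Proof.
move=> inj full.
have exq h : exists x, psi f x == h by have /codomP[x ->] := full h; exists x.
have exp v : exists u, phi f u == v by have [u <-] := phi_surj f v; exists u.
pose q h := xchoose (exq h); have qE h : psi f (q h) = h by apply/eqP/(xchooseP (exq h)).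
pose p v := xchoose (exp v); have pE v : phi f (p v) = v by apply/eqP/(xchooseP (exp v)).
have qK : cancel (psi f) q by move=> x; apply: (psi_inj (p := f)); rewrite qE.
have pK : cancel (phi f) p by move=> x; apply: inj; rewrite pE.
have q_inj : injective q := can_inj qE.
have q_flip h : q (flip h) = flip (q h) by apply: (psi_inj (p := f)); rewrite psi_flip !qE.
have q_legs : map q (legs T) = legs S by rewrite -(psi_legs f) mapK.
have p_surj v : exists u, p u = v by exists (phi f v); rewrite pK.
have p_att h : p (att (q h)) = att h by rewrite -(phi_att f) in pK *; rewrite -[RHS]pK -{2}(qE h) phi_att.
have q_full h : h \in codom q by apply/codomP; exists (psi f h); rewrite qK.
have p_contr h : h \notin codom q -> p (att h) = p (att (flip h)) by rewrite q_full.
pose w0 : premor S T := PreMor q_inj q_flip q_legs p_surj p_att p_contr.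
have p_inj : injective (phi w0) := can_inj pE.
have c0 v : connected (fiber w0 v) by apply: connected1; apply: card_fiber_inj.
have g0 v : genus (fiber w0 v) = gen v.
  have j0 : 'I_(nv (fiber w0 v)) by rewrite card_fiber_inj //; exact: ord0.
  rewrite (genus_fiber_bij p_inj q_full j0).
  have jv : p (fib_v j0) = v by apply/eqP/(valP (enum_val j0)).
  have i0 : 'I_(nv (fiber f (fib_v j0))) by rewrite card_fiber_inj //; exact: ord0.
  rewrite -(fiber_genus f) (genus_fiber_bij inj full i0); congr gen.
  apply: inj; have := pE (fib_v j0); rewrite jv => ->.
  exact/eqP/(valP (enum_val i0)).
by exists (GMor c0 g0); split.
Qed.

Lemma corolla_facts (H : finType) (T : ograph) l g :
  reads T (@id H) l [:: l] [:: g] ->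
  [/\ nv T = 1%N, is_trivial T, genus T = g & connected T].
Proof.
move=> r; have [sv sg _] := reads_size r; case: r => m mr.
have fE := reads_flatten mr; case: mr => mi mf lE _ gE.
have neT : ne T = 0%N by apply: ne_flip => h; apply: mi; rewrite mf.
have n1 : nv T = 1%N by rewrite -sv.
split=> //.
- split=> //; apply: (inj_map mi); rewrite -lE -fE /= cats0 //.
- rewrite genus_ne0 //; have := congr1 sumn gE; rewrite /= addn0 => ->.
  by rewrite sumnE big_map big_enum.
- exact: connected1.
Qed.

(** * Algebra operations on lists of elements *)

Section AlgebraLists.
Variables (k : fieldType) (A : algebra k).

(* Elements that carry their color, so that no cast is needed along equalities of
   colors. *)
Definition pt := {c : nat * nat & A c : Type}.
Definition mkpt c (x : A c) : pt := existT _ c x.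
Definition pt0 : pt := mkpt (0 : A (0, 0)%N).

(* [0] if [p] does not have color [c]. *)
Definition get c (p : pt) : A c :=
  if pselect (projT1 p = c) is left e then acast e (projT2 p) else 0.

Lemma getK c (x : A c) : get c (mkpt x) = x.
Proof.
rewrite /get; case: pselect => [e|[]//]; by rewrite (Prop_irrelevance e erefl).
Qed.

Lemma mkpt_get c (p : pt) : projT1 p = c -> mkpt (get c p) = p.
Proof.
move=> e; rewrite /get; case: pselect => // e'; case: p e e' => c' x /= _ e'.
by apply: esym; apply: same_acast.
Qed.

Lemma mkpt_inj c (x y : A c) : mkpt x = mkpt y -> x = y.
Proof. exact: same_eq. Qed.

Definition inp (T : ggGrc) (s : seq pt) : inputs A T :=
  fun i => get _ (nth pt0 s i).
Arguments inp : clear implicits.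
Definition al (T : ggGrc) (s : seq pt) : pt := mkpt (alpha (inp T s)).
Definition good (T : ggGrc) (s : seq pt) : Prop :=
  forall v : 'I_(nv T), projT1 (nth pt0 s v) = pi0 (source v).

Lemma inp_same (T : ggGrc) (s : seq pt) (v : 'I_(nv T)) : good T s -> mkpt (inp T s v) = nth pt0 s v.
Proof. by move=> gs; rewrite mkpt_get. Qed.

Arguments al : clear implicits.
Definition sub (T S : ggGrc) (f : gmor T S) (X : Type) (x0 : X) (s : seq X) (v : 'I_(nv S)) :=
  [seq nth x0 s (u : 'I_(nv T)) | u <- enum 'I_(nv T) & phi f u == v].

Lemma nth_sub (T S : ggGrc) (f : gmor T S) (X : Type) (x0 : X) (s : seq X) (v : 'I_(nv S))
  (j : 'I_(nv (gfiber f v))) : nth x0 (sub f x0 s v) j = nth x0 s (fib_v j).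
Proof.
by rewrite /sub -fib_v_enum -map_comp nth_map_ord.
Qed.

Lemma sub_good (T S : ggGrc) (f : gmor T S) s v : good T s ->
  good (gfiber f v) (sub f pt0 s v).
Proof. by move=> gs j; rewrite nth_sub gs pi0_source_fiber. Qed.

Lemma restrict_inp (T S : ggGrc) (f : gmor T S) s v : good T s ->
  restrict f v (inp T s) = inp (gfiber f v) (sub f pt0 s v).
Proof.
move=> gs; apply/esym/restrictP => j.
by rewrite /same -!/(mkpt _) inp_same ?nth_sub ?inp_same //; apply: sub_good.
Qed.

Definition pushed (T S : ggGrc) (f : gmor T S) (s : seq pt) : seq pt :=
  [seq al (gfiber f v) (sub f pt0 s v) | v <- enum 'I_(nv S)].

Lemma push_inp (T S : ggGrc) (f : gmor T S) s : good T s ->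
  inp S (pushed f s) = push (@alpha k A) f (inp T s).
Proof.
move=> gs; apply: pushP => v; rewrite restrict_inp // /inp /pushed nth_map_ord.
by rewrite /same -!/(mkpt _) mkpt_get //= (pi0_source_target f v).
Qed.

Lemma al_unit (U : ggGrc) p : is_trivial U -> good U [:: p] -> al U [:: p] = p.
Proof.
move=> trU gU; have [n1 _ _] := trU.
have i : 'I_(nv U) by rewrite n1; exact: ord0.
have iE : nat_of_ord i = 0%N by have := ltn_ord i; rewrite {2}n1; case: (nat_of_ord i).
have := alpha_unit trU (inp U [:: p]) i; rewrite /same -!/(mkpt _) inp_same // iE.
exact.
Qed.

Lemma al_elem (T S : ggGrc) (f : gmor T S) i s : is_elementary f i -> good T s ->
  al T s = al S (pushed f s).
Proof.
move=> el gs; rewrite /al push_inp //; apply: (alpha_elem el (b := restrict f i (inp T s))).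
- exact: same_restrict.
- exact: same_push.
move=> u ui; have [j ju] := @fib_v_surj _ _ f (phi f u) u erefl.
have [_ triv _] := el.
apply: etrans (same_push _ f _ (phi f u)) _.
apply: etrans (alpha_unit (triv _ ui) _ j) _.
apply: etrans (same_restrict _ j) _.
by rewrite ju.
Qed.

Definition pt_scale (c : k) (p : pt) : pt := mkpt (c *: projT2 p).
Definition pthomog (d : int) (p : pt) := homog d (projT2 p).

Lemma get_homog c d p : pthomog d p -> homog d (get c p).
Proof. by move=> pd; rewrite /get; case: pselect => [e|_]; [exact: acast_homog|exact: homog0]. Qed.

Lemma al_iso (T S : ggGrc) (f : gmor T S) s (d : 'I_(nv T) -> int) : is_iso f -> good T s ->
  (forall u : 'I_(nv T), pthomog (d u) (nth pt0 s u)) ->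
  al T s = pt_scale (koszul k (phi f) d) (al S (pushed f s)).
Proof.
move=> iso gs sd; rewrite /al push_inp //.
apply: (alpha_iso iso (b := fun v => restrict f v (inp T s))).
- by move=> u; apply: get_homog.
- by move=> v j; apply: same_restrict.
- by move=> v; apply: same_push.
Qed.

Lemma al_iso_mono (T S : ggGrc) (f : gmor T S) s : is_iso f -> good T s ->
  (forall u v : 'I_(nv T), (u <= v)%N -> (phi f u <= phi f v)%N) ->
  al T s = al S (pushed f s).
Proof.
move=> iso gs mono; rewrite /al push_inp //.
apply: (push_mono (@alpha_linear k A) _ mono) => a d ad.
apply: (alpha_iso iso (b := fun v => restrict f v a)) => //.
- by move=> v j; apply: same_restrict.
- by move=> v; apply: same_push.
Qed.

End AlgebraLists.
Arguments inp {k A} T s.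
Arguments al {k A} T s.
Arguments get {k A} c p.
Arguments mkpt {k A c} x.
Arguments pt0 {k A}.
Arguments pushed {k A T S} f s.

Section Vidx.
Variable H : finType.
Implicit Types (vs : seq (seq H)) (x : H).

Lemma vidx_cat vs vs' x :
  vidx (vs ++ vs') x = if x \in flatten vs then vidx vs x else (size vs + vidx vs' x)%N.
Proof.
rewrite /vidx find_cat; congr (if _ then _ else _).
by apply/hasP/flattenP => -[s ss xs]; exists s.
Qed.

Lemma vidx_cons s vs x : vidx (s :: vs) x = if x \in s then 0%N else (vidx vs x).+1.
Proof. by []. Qed.

Lemma vidx_lt vs x : x \in flatten vs -> (vidx vs x < size vs)%N.
Proof. by move=> /flattenP[s svs xs]; rewrite -has_find; apply/hasP; exists s. Qed.

Lemma nth_vidx vs x : x \in flatten vs -> x \in nth [::] vs (vidx vs x).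
Proof.
move=> /flattenP[s svs xs].
by apply: (@nth_find _ [::] (fun s : seq H => x \in s)); apply/hasP; exists s.
Qed.

Lemma vidx_eq vs x v : uniq (flatten vs) -> x \in nth [::] vs v -> vidx vs x = v.
Proof.
move=> u; rewrite -vidx_filter // mem_filter => /andP[/eqP ->]. by [].
Qed.

Lemma reads_att (T : ograph) fl lg vs gs l i : @reads_by H T fl lg vs gs l ->
  nat_of_ord (att i) = vidx vs (l i).
Proof.
move=> r; have [u _ _ _ _] := reads_rwf (ex_intro _ l r).
apply/esym/(vidx_eq u); have [-> _] := reads_nth (att i) r.
by rewrite map_f // mem_filter eqxx mem_enum.
Qed.

End Vidx.

Ltac lia_if := repeat (case: ifPn => ?); lia.

(* The order-preserving map that collapses the [nF] positions from [n1] on to one. *)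
Definition block_pos (n1 nF u : nat) : nat :=
  if (u < n1)%N then u else if (u < n1 + nF)%N then n1 else (u - nF).+1.

Lemma block_pos_lt n1 nF u : (u < n1)%N -> block_pos n1 nF u = u.
Proof. by rewrite /block_pos => ->. Qed.

Lemma block_pos_in n1 nF u : (u < nF)%N -> block_pos n1 nF (n1 + u) = n1.
Proof. by rewrite /block_pos => u1; lia_if. Qed.

Lemma block_pos_ge n1 nF u : block_pos n1 nF (n1 + (nF + u)) = (n1 + u).+1.
Proof. by rewrite /block_pos; lia_if. Qed.

Lemma block_pos1_inj n1 : injective (block_pos n1 1).
Proof. by move=> u v; rewrite /block_pos; lia_if. Qed.

Lemma block_pos_bound n1 nF n2 u : (0 < nF)%N -> (u < n1 + (nF + n2))%N ->
  (block_pos n1 nF u < n1 + n2.+1)%N.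
Proof. by move=> nF0 ul; rewrite /block_pos; lia_if. Qed.

Lemma block_pos_surj n1 nF n2 v : (0 < nF)%N -> (v < n1 + n2.+1)%N ->
  exists2 u, (u < n1 + (nF + n2))%N & block_pos n1 nF u = v.
Proof.
move=> nF0 vl; case: (leqP v n1) => vn.
  by exists v; rewrite ?/block_pos; [lia|lia_if].
by exists (v + nF).-1; rewrite ?/block_pos; [lia|lia_if].
Qed.

Lemma block_pos_mono n1 nF u v : (u <= v)%N -> (block_pos n1 nF u <= block_pos n1 nF v)%N.
Proof. by move=> uv; rewrite /block_pos; lia_if. Qed.

Lemma filter_block_pos n1 nF n2 v : (0 < nF)%N -> (v < n1 + n2.+1)%N ->
  [seq u <- iota 0 (n1 + (nF + n2)) | block_pos n1 nF u == v] =
  if v == n1 then iota n1 nF else [:: if (v < n1)%N then v else (v + nF).-1].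
Proof.
move=> nF0 vn; apply: (@irr_sorted_eq _ ltn ltn_trans ltnn).
- by apply: sorted_filter; [exact: ltn_trans|exact: iota_ltn_sorted].
- by case: ifP => // _; exact: iota_ltn_sorted.
move=> u; rewrite mem_filter mem_iota /block_pos.
have [->|vn1] := eqVneq v n1; rewrite ?mem_iota ?inE; lia_if.
Qed.

Lemma map_filter_enum n (X : Type) (F : nat -> X) (P : pred nat) :
  [seq F (val u) | u <- enum 'I_n & P (val u)] = [seq F u | u <- iota 0 n & P u].
Proof. by rewrite -val_enum_ord filter_map -map_comp. Qed.

Lemma sub_block n (X : Type) (x0 xF : X) s1 sF s2 v :
  n = size (s1 ++ sF ++ s2) -> (0 < size sF)%N ->
  (v < size s1 + (size s2).+1)%N ->
  [seq nth x0 (s1 ++ sF ++ s2) (val u) | u <- enum 'I_n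
     & block_pos (size s1) (size sF) (val u) == v] =
  if v == size s1 then sF else [:: nth x0 (s1 ++ xF :: s2) v].
Proof.
move=> -> sF0 vn; rewrite (map_filter_enum _ (fun u => nth x0 (s1 ++ sF ++ s2) u)
  (fun u => block_pos (size s1) (size sF) u == v)) !size_cat filter_block_pos //.
case: (eqVneq v (size s1)) => [_|vn1].
  have le : (size sF <= size (s1 ++ sF ++ s2) - size s1)%N.
    by rewrite !size_cat addKn leq_addr.
  by rewrite map_nth_iota // drop_size_cat // take_size_cat.
rewrite /=; case: (ltnP v (size s1)) => vl; rewrite !nth_cat; first by rewrite vl.
have -> : ((v + size sF).-1 < size s1)%N = false by lia.
have -> : (v < size s1)%N = false by lia.
have -> : ((v + size sF).-1 - size s1 < size sF)%N = false by lia.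
have -> : (v - size s1 = (v - size s1).-1.+1)%N by lia.
by rewrite /=; congr (_ :: _); congr nth; lia.
Qed.

(** The count of [tree_genus] with zero genera: the number of loops in an exhausting tree, which is
    [ne T + 1 - nv T], is nonnegative. *)
Lemma connected_nv_le (T : ggGrc) : (nv T <= ne T + 1)%N.
Proof.
have [t [w tV1 tL1]] := graph_tree T.
have := tree_genus (fun=> 0%N) w; rewrite tV1 tL1 -size_legs cardsT card_ord.
rewrite (_ : [set h | _] = setT) ?cardsT ?card_ord; last by apply/setP => h; rewrite !inE.
by have := card_edges T; rewrite big1 //; lia.
Qed.

Lemma edge_ne (T : ograph) h : flip h != h :> 'I_(nh T) -> (0 < ne T)%N.
Proof.
move=> fh; rewrite card_gt0; apply/set0Pn; exists [set h; flip h].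
by apply/imsetP; exists h; rewrite ?inE.
Qed.

(** * Contraction of a block of vertices and renumbering of vertices *)

Section GraphLaws.
Variable H : finType.
Implicit Types (fl : H -> H) (lg w : seq H) (vs : seq (seq H)) (gs : seq nat).

(** Collapses a connected subgraph [F] that occupies consecutive vertices. The subgraph has its own
    involution [flF]: half-edges listed in [w] are cut into legs, even if they lie on edges of
    [T]. *)
Lemma graph_sub (T F : ggGrc) fl flF lg w vs1 vsF vs2 gs1 gsF gs2 :
  reads T fl lg (vs1 ++ vsF ++ vs2) (gs1 ++ gsF ++ gs2) ->
  size gs1 = size vs1 -> size gsF = size vsF ->
  reads F flF w vsF gsF ->
  (forall h, h \in flatten vsF -> flF h = if h \in w then h else fl h) ->
  exists (S : ggGrc) (f : gmor T S),
  [/\ reads S fl lg (vs1 ++ w :: vs2) (gs1 ++ genus F :: gs2),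
      forall v : 'I_(nv S), nat_of_ord v = size vs1 -> gfiber f v = F,
      forall v : 'I_(nv S), nat_of_ord v <> size vs1 -> is_trivial (gfiber f v),
      forall u, nat_of_ord (phi f u) = block_pos (size vs1) (size vsF) u &
      ne F = 0%N -> is_iso f].
Proof.
move=> rT sg1 sgF rF flFE.
have [sT _ _] := reads_size rT; have [sF _ _] := reads_size rF.
have nF0 : (0 < size vsF)%N by rewrite sF; apply: connected_gt0; apply: graph_connected.
have [u flP ulg lgP sg] := reads_rwf rT; have [uF flPF uw wP _] := reads_rwf rF.
have wF x : x \in w -> x \in flatten vsF by rewrite wP => /andP[].
have flF_in x : x \in flatten vsF -> x \notin w -> fl x \in flatten vsF.
  by move=> xF xw; have := proj1 (flPF x xF); rewrite flFE // (negbTE xw).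
have flF_ne x : x \in flatten vsF -> x \notin w -> fl x != x.
  move=> xF xw; move: (xw); rewrite wP xF /= flFE // (negbTE xw).
  by [].
have memT x : (x \in flatten (vs1 ++ vsF ++ vs2)) =
    [|| x \in flatten vs1, x \in flatten vsF | x \in flatten vs2].
  by rewrite !flatten_cat !mem_cat.
have memS x : (x \in flatten (vs1 ++ w :: vs2)) =
    [|| x \in flatten vs1, x \in w | x \in flatten vs2].
  by rewrite flatten_cat /= !mem_cat.
have ST x : x \in flatten (vs1 ++ w :: vs2) -> x \in flatten (vs1 ++ vsF ++ vs2).
  by rewrite memT memS => /or3P[->|/wF ->|->]; rewrite ?orbT.
move: (u); rewrite !flatten_cat !cat_uniq => /and3P[u1 dis1 /and3P[_ disF u2]].
have d1 x : x \in flatten vs1 -> (x \in flatten vsF) || (x \in flatten vs2) -> False.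
  by move=> x1 x2; case/hasP: dis1; exists x; rewrite ?mem_cat.
have d2 x : x \in flatten vsF -> x \in flatten vs2 -> False.
  by move=> x1 x2; case/hasP: disF; exists x.
have notS x : x \in flatten vsF -> x \notin w -> x \notin flatten (vs1 ++ w :: vs2).
  move=> xF xw; rewrite memS (negbTE xw) /=; apply/negP => /orP[x1|x2].
    by apply: (d1 x x1); rewrite xF.
  exact: d2 xF x2.
have outS x : x \in flatten (vs1 ++ vsF ++ vs2) -> x \notin flatten (vs1 ++ w :: vs2) ->
    x \in flatten vsF /\ x \notin w.
  rewrite memT memS !negb_or => /or3P[x1|x1|x1] /and3P[n1 n2 n3] //.
    by rewrite x1 in n1.
  by rewrite x1 in n3.
have wfS : rwf fl lg (vs1 ++ w :: vs2) (gs1 ++ genus F :: gs2).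
  split.
  - rewrite flatten_cat /= !cat_uniq u1 uw u2 andbT /=; apply/andP; split.
      apply/hasP => -[x]; rewrite mem_cat => xx x1; apply: (d1 x x1).
      by case/orP: xx => [/wF ->|->] //; rewrite orbT.
    by apply/hasP => -[x x2 /wF xF]; exact: d2 xF x2.
  - move=> x xS; have [fx ffx] := flP x (ST x xS); split=> //.
    have [//|/(outS _ fx)[fF fw]] := boolP (fl x \in flatten (vs1 ++ w :: vs2)).
    have xF : x \in flatten vsF by rewrite -ffx; apply: flF_in.
    have [xw|xw] := boolP (x \in w); last by case/negP: (notS _ xF xw).
    have := proj2 (flPF _ fF); rewrite (flFE _ fF) (negbTE fw) ffx flFE // xw => e.
    by rewrite -e xw in fw.
  - exact: ulg.
  - move=> h; rewrite lgP; apply/andP/andP => -[hT hh]; split=> //; last exact: ST.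
    have [//|/(outS _ hT)[hF hw]] := boolP (h \in flatten (vs1 ++ w :: vs2)).
    by have := flF_ne h hF hw; rewrite hh.
  - by move: sg; rewrite !size_cat /= sg1 sgF => /addnI/addnI ->.
have [S0 [l' rS]] := reads_exists wfS; have [l rTl] := rT.
have [sS _ _] := reads_size (ex_intro _ l' rS).
set n1 := size vs1; set nF := size vsF; set n2 := size vs2.
have nvT : nv T = (n1 + (nF + n2))%N by rewrite -sT !size_cat.
have nvS : nv S0 = (n1 + n2.+1)%N by rewrite -sS size_cat.
have bp (i : 'I_(nv T)) : (block_pos n1 nF i < nv S0)%N.
  by rewrite nvS; apply: block_pos_bound => //; rewrite -nvT.
pose p (i : 'I_(nv T)) := Ordinal (bp i).
have p_surj v : exists i, p i = v.
  have vS := ltn_ord v; rewrite {2}nvS in vS.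
  have [i iT iE] := block_pos_surj nF0 vS; rewrite -nvT in iT.
  by exists (Ordinal iT); apply: ord_inj.
have labT x : x \in flatten (vs1 ++ vsF ++ vs2) -> exists i, l i == x.
  by case/(reads_mem rTl) => i ->; exists i.
have lF i : l i \in flatten (vs1 ++ vsF ++ vs2) by apply/(reads_mem rTl); exists i.
have lS h : l' h \in flatten (vs1 ++ w :: vs2) by apply/(reads_mem rS); exists h.
have ex h : exists i, l i == l' h by apply/labT/ST.
have v1 x : x \in flatten vs1 -> (vidx vs1 x < n1)%N := @vidx_lt _ vs1 x.
have vF x : x \in flatten vsF -> (vidx vsF x < nF)%N := @vidx_lt _ vsF x.
have pF i : l i \in flatten vsF -> nat_of_ord (p (att i)) = n1.
  move=> iF; rewrite /= (reads_att _ rTl) !vidx_cat iF ifF.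
    by rewrite block_pos_in // vF.
  by apply/negP => i1; apply: (d1 _ i1); rewrite iF.
have patt i h : l i = l' h -> p (att i) = att h.
  move=> ih; apply: ord_inj.
  rewrite (reads_att _ rS) -ih; have := lS h; rewrite -ih memS => /or3P[x1|xw|x2].
  - by rewrite /= (reads_att _ rTl) !vidx_cat x1 block_pos_lt // v1.
  - have xF := wF _ xw; rewrite pF // vidx_cat ifF.
      by rewrite vidx_cons xw addn0.
    by apply/negP => i1; apply: (d1 _ i1); rewrite xF.
  - have xN1 : (l i \in flatten vs1) = false.
      by apply/negP => i1; apply: (d1 _ i1); rewrite x2 orbT.
    have xNF : (l i \in flatten vsF) = false by apply/negP => /d2; apply.
    have xNw : (l i \in w) = false by apply: contraFF xNF => /wF.
    rewrite /= (reads_att _ rTl) !vidx_cat xN1 xNF.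
    by rewrite vidx_cons xNw block_pos_ge addnS.
have pcon i : (forall h, l i <> l' h) -> p (att i) = p (att (flip i)).
  move=> iS; have [iF iw] : l i \in flatten vsF /\ l i \notin w.
    by apply: outS => //; apply/negP => /(reads_mem rS)[h ih]; exact: iS h ih.
  apply: ord_inj; rewrite pF // pF //.
  by have [_ -> _ _ _] := rTl; apply: flF_in.
have [f0 [fp fl_]] := premor_reads rTl rS p_surj ex patt pcon.
have cS : connected S0 := premor_connected f0 (graph_connected T).
have fE u0 : nat_of_ord (phi f0 u0) = block_pos n1 nF u0 by rewrite fp.
have subE (X : Type) (x0 xF : X) s1 sF' s2 (v : 'I_(nv S0)) :
    size s1 = n1 -> size sF' = nF -> size s2 = n2 ->
    [seq nth x0 (s1 ++ sF' ++ s2) (i : 'I_(nv T)) | i <- enum 'I_(nv T) & phi f0 i == v] =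
    if nat_of_ord v == n1 then sF' else [:: nth x0 (s1 ++ xF :: s2) v].
  move=> e1 eF e2.
  rewrite (@eq_filter _ _ (fun i => block_pos (size s1) (size sF') (val i) == v)).
    rewrite (sub_block x0 xF) ?e1 ?eF ?e2 //; first by rewrite !size_cat e1 eF e2.
    by rewrite -nvS.
  by move=> i; rewrite -val_eqE /= fE e1 eF.
have sg2 : size gs2 = n2.
  by move: sg; rewrite !size_cat sg1 sgF => /addnI/addnI.
(* The fiber and [F] are read by the same lists, so [reads_inj] makes them equal. *)
have fibF v : nat_of_ord v = n1 -> fiber f0 v = F.
  move=> vn; apply: (@reads_inj _ _ _ flF w vsF gsF) => //.
  have wE : nth [::] (vs1 ++ w :: vs2) v = w by rewrite vn nth_cat ltnn subnn.
  have := @fiber_reads _ _ _ f0 v _ _ _ _ _ _ _ _ _ _ rTl rS fl_ flF.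
  rewrite wE (subE _ _ [::] _ _ _ _ erefl erefl erefl).
  rewrite (subE _ _ 0%N _ _ _ _ sg1 sgF sg2) vn eqxx; apply.
  by move=> h hF; rewrite flFE.
have fibN v : nat_of_ord v <> n1 -> [/\ nv (fiber f0 v) = 1%N, is_trivial (fiber f0 v),
    genus (fiber f0 v) = gen v & connected (fiber f0 v)].
  move=> vn; have [_ <-] := reads_nth v rS.
  apply: (@corolla_facts H _ (nth [::] (vs1 ++ w :: vs2) v)).
  have := @fiber_reads _ _ _ f0 v _ _ _ _ _ _ _ _ _ _ rTl rS fl_ id.
  rewrite (subE _ _ w _ _ _ _ erefl erefl erefl).
  rewrite (subE _ _ (genus F) _ _ _ _ sg1 sgF sg2) (negbTE (introN eqP vn)); apply.
  by move=> h; rewrite /= cats0 => ->.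
pose S := GgGrc cS.
have fc v : connected (fiber f0 v).
  have [vn|/eqP vn] := eqVneq (nat_of_ord v) n1; last by have [] := fibN v vn.
  by rewrite fibF //; apply: graph_connected.
have fg v : genus (fiber f0 v) = gen v.
  have [vn|/eqP vn] := eqVneq (nat_of_ord v) n1; last by have [] := fibN v vn.
  have [_ <-] := reads_nth v rS; rewrite fibF //.
  by rewrite vn /n1 -sg1 nth_cat ltnn subnn.
pose f : gmor T S := @GMor T S f0 fc fg.
exists S, f; split.
- by exists l'.
- by move=> v vn; apply: ggGrc_eq; apply: fibF.
- by move=> v vn; have [] := fibN v vn.
- exact: fE.
(* A connected graph without edges has one vertex, and all its half-edges survive as legs, so both
   components of [f] are bijective. *)
move=> ne0; have nF1 : nF = 1%N.
  apply/eqP; rewrite eqn_leq nF0 andbT.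
  by have := connected_nv_le F; rewrite ne0 -sF.
apply: bij_is_iso => [i j /(congr1 val) /= |h].
  by rewrite !fE nF1 => /block_pos1_inj; apply: ord_inj.
have [lF0 rlF] := rF; have [_ lFf _ _ _] := rlF.
have lh : l h \in flatten (vs1 ++ w :: vs2).
  have [//|/(outS _ (lF h))[hF hw]] := boolP (l h \in _).
  have [x hx] := (proj1 (reads_mem rlF _) hF).
  have : flip x != x.
    move: hF hw; rewrite hx => hF hw; apply/eqP => xx; have := flF_ne _ hF hw.
    by have := lFf x; rewrite xx flFE // (negbTE hw) => <-; rewrite eqxx.
  by move/edge_ne; rewrite ne0.
have [x hx] := proj1 (reads_mem rS _) lh.
apply/codomP; exists x; have [li _ _ _ _] := rTl.
by apply: li; rewrite hx fl_.
Qed.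

End GraphLaws.

Section GraphPerm.
Variable H : finType.
Implicit Types (fl : H -> H) (lg w : seq H) (vs : seq (seq H)) (gs : seq nat).

Lemma perm_nth (X : Type) (x0 : X) (s : seq X) (Is : seq nat) (u : nat) : u \in Is ->
  nth x0 [seq nth x0 s i | i <- Is] (index u Is) = nth x0 s u.
Proof. by move=> uI; rewrite (nth_map 0%N) ?index_mem // nth_index. Qed.

(** The list [Is] enumerates the old vertices in their new order, hence the new position of a vertex
    is its [index] in [Is]. *)
Lemma graph_perm (T : ggGrc) fl lg vs gs (Is : seq nat) :
  reads T fl lg vs gs -> perm_eq Is (iota 0 (size vs)) ->
  exists (S : ggGrc) (w : gmor T S),
  [/\ reads S fl lg [seq nth [::] vs i | i <- Is] [seq nth 0%N gs i | i <- Is],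
      forall u, nat_of_ord (phi w u) = index (nat_of_ord u) Is, is_iso w &
      forall v, is_trivial (gfiber w v)].
Proof.
move=> rT pI; have [sT sgT _] := reads_size rT.
set vs' := map _ Is; set gs' := [seq nth _ gs i | i <- Is].
have sI : size Is = nv T by rewrite (perm_size pI) size_iota.
have mI u : (u \in Is) = (u < nv T)%N by rewrite (perm_mem pI) mem_iota sT.
have uI : uniq Is by rewrite (perm_uniq pI) iota_uniq.
have pvs : perm_eq vs' vs.
  have := perm_map (nth [::] vs) pI; rewrite -/vs'.
  by rewrite -[X in perm_eq _ X]/(mkseq (nth [::] vs) (size vs)) mkseq_nth.
have pfl : perm_eq (flatten vs') (flatten vs) by exact: perm_flatten.
have fm x : (x \in flatten vs') = (x \in flatten vs) := perm_mem pfl x.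
have [u flP ulg lgP sg] := reads_rwf rT.
have wfS : rwf fl lg vs' gs'.
  split=> //.
  - by rewrite (perm_uniq pfl).
  - by move=> h; rewrite !fm => /flP.
  - by move=> h; rewrite fm.
  - by rewrite !size_map.
have [S0 [l' rS]] := reads_exists wfS; have [l rTl] := rT.
have [sS _ _] := reads_size (ex_intro _ l' rS).
have nvS : nv S0 = nv T by rewrite -sS size_map.
have bp (i : 'I_(nv T)) : (index (nat_of_ord i) Is < nv S0)%N.
  by apply: (@leq_trans (size Is)); rewrite ?index_mem ?mI // sI nvS.
pose p (i : 'I_(nv T)) := Ordinal (bp i).
have p_inj : injective p.
  move=> i j /(congr1 val) /= e; apply: ord_inj.
  by rewrite -(nth_index 0%N (_ : nat_of_ord i \in Is)) ?mI // e nth_index ?mI.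
have p_surj v : exists i, p i = v.
  have vI : (nth 0%N Is v < nv T)%N by rewrite -mI mem_nth // sI -nvS.
  by exists (Ordinal vI); apply: ord_inj; rewrite /= index_uniq // sI -nvS.
have labT x : x \in flatten vs -> exists i, l i == x.
  by case/(reads_mem rTl) => i ->; exists i.
have lF i : l i \in flatten vs by apply/(reads_mem rTl); exists i.
have lS h : l' h \in flatten vs by rewrite -fm; apply/(reads_mem rS); exists h.
have ex h : exists i, l i == l' h by apply/labT/lS.
have patt i h : l i = l' h -> p (att i) = att h.
  move=> ih; apply: ord_inj; rewrite (reads_att _ rS) -ih /=.
  apply/esym/vidx_eq; first by rewrite (perm_uniq pfl).
  rewrite perm_nth ?mI //; have [-> _] := reads_nth (att i) rTl.
  by rewrite map_f // mem_filter eqxx mem_enum.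
have pcon i : (forall h, l i <> l' h) -> p (att i) = p (att (flip i)).
  move=> iS; have := lF i; rewrite -fm => /(reads_mem rS)[h ih].
  by case: (iS h).
have [f0 [fp fl_]] := premor_reads rTl rS p_surj ex patt pcon.
have cS : connected S0 := premor_connected f0 (graph_connected T).
have fib v : [/\ nv (fiber f0 v) = 1%N, is_trivial (fiber f0 v),
    genus (fiber f0 v) = gen v & connected (fiber f0 v)].
  have [_ <-] := reads_nth v rS.
  apply: (@corolla_facts H _ (nth [::] vs' v)).
  have := @fiber_reads _ _ _ f0 v _ _ _ _ _ _ _ _ _ _ rTl rS fl_ id.
  have [i iv] := p_surj v.
  have -> : [seq j <- enum 'I_(nv T) | phi f0 j == v] = [:: i].
    rewrite fp -iv (eq_filter (a2 := pred1 i)) ?filter_pred1_uniq ?enum_uniq ?mem_enum //.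
    by move=> j; rewrite /= (inj_eq p_inj).
  rewrite /= cats0 -iv perm_nth ?mI // perm_nth ?mI //; apply.
  by move=> h ->.
pose S := GgGrc cS.
have fc v : connected (fiber f0 v) by have [] := fib v.
have fg v : genus (fiber f0 v) = gen v by have [] := fib v.
pose f : gmor T S := @GMor T S f0 fc fg.
exists S, f; split.
- by exists l'.
- by move=> i; rewrite /= fp.
- apply: bij_is_iso => [|h]; first by rewrite /= fp.
  have := lF h; rewrite -fm => /(reads_mem rS)[x hx].
  apply/codomP; exists x; have [li _ _ _ _] := rTl.
  by apply: li; rewrite hx fl_.
- by move=> v; have [] := fib v.
Qed.

End GraphPerm.

Section ListLaws.
Variables (k : fieldType) (A : algebra k).

(* A vertex: its list of half-edges and its decoration. *)
Definition dvert (H : finType) := (seq H * pt A)%type.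
Definition dv0 (H : finType) : dvert H := ([::], pt0).
Definition dgs (H : finType) (ds : seq (dvert H)) : seq nat := [seq (projT1 d.2).2 | d <- ds].
Definition fitting (H : finType) (d : dvert H) : bool := (projT1 d.2).1 == size d.1.

Definition rds (H : finType) (T : ograph) (fl : H -> H) (lg : seq H) (ds : seq (dvert H)) : Prop :=
  reads T fl lg (unzip1 ds) (dgs ds) /\ all (@fitting H) ds.

Lemma rds_size (H : finType) (T : ograph) (fl : H -> H) lg ds : rds T fl lg ds -> size ds = nv T.
Proof. by case=> /reads_size[<- _ _] _; rewrite size_map. Qed.

Lemma rds_good (H : finType) (T : ggGrc) (fl : H -> H) lg ds : rds T fl lg ds ->
  good T (unzip2 ds).
Proof.
move=> r v; have sds := rds_size r; case: r => [[l rl] fit].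
have vds : (v < size ds)%N by rewrite sds.
have [e1 e2] := reads_nth v rl.
have := all_nthP (dv0 H) fit v vds => /eqP.
rewrite /unzip2 (nth_map (dv0 H)) // /fitting.
rewrite /unzip1 (nth_map (dv0 H)) // in e1; rewrite e1 size_map.
rewrite /dgs (nth_map (dv0 H)) // in e2.
have := pi0_source v; rewrite (surjective_pairing (pi0 (source v))) => -[_ g2].
move=> e; rewrite [LHS]surjective_pairing e e2 size_local_flags.
by rewrite [RHS]surjective_pairing /= -g2.
Qed.

Lemma reads_size_legs (H : finType) (T : ograph) (fl : H -> H) lg vs gs :
  reads T fl lg vs gs -> size lg = size (legs T).
Proof. by case=> l [_ _ -> _ _]; rewrite size_map. Qed.

(** The algebra axioms in the form used below: inside a graph, a block of vertices may be replaced
    by one vertex decorated with the value of the block. No sign appears since the order of the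
    blocks is kept. *)
Lemma law_sub (H : finType) (T F : ggGrc) (fl flF : H -> H) lg w ds1 dsF ds2 :
  rds T fl lg (ds1 ++ dsF ++ ds2) -> rds F flF w dsF ->
  (forall h, h \in flatten (unzip1 dsF) -> flF h = if h \in w then h else fl h) ->
  exists S : ggGrc, rds S fl lg (ds1 ++ (w, al F (unzip2 dsF)) :: ds2) /\
   al T (unzip2 (ds1 ++ dsF ++ ds2)) = al S (unzip2 (ds1 ++ (w, al F (unzip2 dsF)) :: ds2)).
Proof.
move=> rT rF flFE; have gT := rds_good rT; have gF := rds_good rF.
have sT := rds_size rT; have sF := rds_size rF.
case: rT => rT fT; case: rF => rF fF.
rewrite /unzip1 /dgs !map_cat -/(unzip1 _) in rT.
have [||S [f [rS fF1 fN fp fiso]]] := graph_sub rT _ _ rF flFE; rewrite ?size_map //.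
have nF0 : (0 < size dsF)%N by rewrite sF; apply: connected_gt0; apply: graph_connected.
rewrite size_map in fF1; rewrite size_map in fN; rewrite !size_map in fp.
have RS : rds S fl lg (ds1 ++ (w, al F (unzip2 dsF)) :: ds2).
  split; first by rewrite /unzip1 /dgs !map_cat.
  move: fT; rewrite !all_cat /= => /and3P[-> _ ->]; rewrite andbT /=.
  by rewrite /fitting /= (reads_size_legs rF).
exists S; split=> //.
have -> : al S (unzip2 (ds1 ++ (w, al F (unzip2 dsF)) :: ds2)) =
    al S (pushed f (unzip2 (ds1 ++ dsF ++ ds2))).
  congr (al S _); apply: (@eq_from_nth _ pt0).
    by rewrite [RHS]size_map size_enum_ord -(rds_size RS) size_map.
  move=> v vlt; rewrite size_map (rds_size RS) in vlt.
  rewrite (nth_map_ord _ _ (Ordinal vlt)).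
  have g' := @sub_good _ _ _ _ f _ (Ordinal vlt) gT.
  move: g'; rewrite /sub.
  rewrite (@eq_filter _ _ (fun u => block_pos (size (unzip2 ds1)) (size (unzip2 dsF)) (val u) == v));
    last by move=> u; rewrite -val_eqE /= fp !size_map.
  rewrite /unzip2 !map_cat -/unzip2.
  rewrite (sub_block pt0 (al F (unzip2 dsF))); last 1 first.
  - by rewrite !size_map; have := vlt; rewrite -(rds_size RS) size_cat.
  - rewrite size_map; case: eqVneq => [vn|vn].
      by move=> _; rewrite fF1 //= nth_cat vn size_map ltnn subnn.
    by move=> g'; rewrite al_unit //; apply: fN; apply/eqP.
  - by rewrite !size_cat !size_map -sT !size_cat.
  - by rewrite size_map.
(* An elementary morphism needs an edge in its fiber. For an edgeless [F] the morphism is an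
   order-preserving isomorphism, and the isomorphism axiom gives the same equation. *)
have [ne0|ne1] := posnP (ne F).
  apply: al_iso_mono; [exact: fiso|exact: gT|move=> u v uv; rewrite !fp].
  exact: block_pos_mono.
have iS : (size ds1 < nv S)%N by rewrite -(rds_size RS) size_cat /= addnS ltnS leq_addr.
apply: (@al_elem _ _ _ _ f (Ordinal iS)) => //; split.
- by move=> u v uv; rewrite !fp; apply: block_pos_mono.
- by move=> v vi; apply: fN; apply/eqP; rewrite -val_eqE in vi.
- by rewrite fF1.
Qed.

Lemma law_perm (H : finType) (T : ggGrc) (fl : H -> H) lg ds (Is : seq nat) :
  rds T fl lg ds -> perm_eq Is (iota 0 (size ds)) ->
  exists (S : ggGrc) (f : gmor T S),
  [/\ rds S fl lg [seq nth (dv0 H) ds i | i <- Is],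
      forall u, nat_of_ord (phi f u) = index (nat_of_ord u) Is &
      forall d : 'I_(nv T) -> int,
      (forall u : 'I_(nv T), pthomog (d u) (nth pt0 (unzip2 ds) u)) ->
      al T (unzip2 ds) = pt_scale (koszul k (phi f) d)
        (al S (unzip2 [seq nth (dv0 H) ds i | i <- Is]))].
Proof.
move=> rT pI; have gT := rds_good rT; have sT := rds_size rT.
case: rT => rT fT.
have [|S [f [rS fp fiso triv]]] := graph_perm rT (Is := Is); first by rewrite size_map.
have mI u : (u \in Is) = (u < size ds)%N by rewrite (perm_mem pI) mem_iota.
have RS : rds S fl lg [seq nth (dv0 H) ds i | i <- Is].
  split; last first.
    apply/allP => d /mapP[i iI ->]; apply: (allP fT); apply: mem_nth.
    by rewrite -mI.
  rewrite /unzip1 /dgs -!map_comp.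
  rewrite (eq_in_map _ (nth [::] (unzip1 ds)) Is).1; last first.
    by move=> i; rewrite mI => id; rewrite /unzip1 (nth_map (dv0 H)).
  rewrite (eq_in_map _ (nth 0%N (dgs ds)) Is).1 //.
  by move=> i; rewrite mI => id; rewrite /dgs (nth_map (dv0 H)).
exists S, f; split=> // d dh.
rewrite (al_iso fiso gT dh); congr (pt_scale _ (al S _)).
apply: (@eq_from_nth _ pt0).
  by rewrite size_map size_enum_ord size_map (rds_size RS).
move=> v; rewrite size_map size_enum_ord => vlt.
rewrite (nth_map_ord _ _ (Ordinal vlt)).
have g' := @sub_good _ _ _ _ f _ (Ordinal vlt) gT; move: g'; rewrite /sub.
have [i iv] := phi_surj f (Ordinal vlt).
have -> : [seq j <- enum 'I_(nv T) | phi f j == Ordinal vlt] = [:: i].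
  rewrite -iv (eq_filter (a2 := pred1 i)) ?filter_pred1_uniq ?enum_uniq ?mem_enum //.
  move=> j /=; apply/eqP/eqP => [/(congr1 val) /=|-> //]; rewrite !fp => e.
  by apply: ord_inj; rewrite -(nth_index 0%N (_ : nat_of_ord j \in Is)) ?mI ?sT // e
    nth_index // mI sT.
move=> g' /=; rewrite al_unit //.
have <- : index (nat_of_ord i) Is = v by rewrite -fp iv.
rewrite /unzip2 -map_comp (nth_map 0%N) ?index_mem ?mI ?sT // nth_index ?mI ?sT //.
by rewrite (nth_map (dv0 H)) ?sT.
Qed.

Lemma rds_relabel (H H' : finType) (r : H -> H') (T : ograph) (fl : H -> H) (fl' : H' -> H') lg ds :
  injective r -> (forall h, h \in flatten (unzip1 ds) -> fl' (r h) = r (fl h)) ->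
  rds T fl lg ds -> rds T fl' (map r lg) [seq (map r d.1, d.2) | d <- ds].
Proof.
move=> ri flr [[l rl] fit]; split; last first.
  rewrite all_map; apply: sub_all fit => d; by rewrite /fitting /= size_map.
have mE := reads_mem rl; case: rl => li lf lgE vE gE.
exists (r \o l); split.
- exact: inj_comp.
- by move=> h /=; rewrite lf flr //; apply/mE; exists h.
- by rewrite lgE -map_comp.
- have -> : unzip1 [seq (map r d.1, d.2) | d <- ds] = map (map r) (unzip1 ds).
    by rewrite /unzip1 -!map_comp.
  rewrite vE -map_comp.
  by apply: eq_map => v /=; rewrite -map_comp.
- by rewrite -gE /dgs -map_comp.
Qed.

Lemma rds_ext (H : finType) (T : ograph) (fl fl' : H -> H) lg ds :
  (forall h, h \in flatten (unzip1 ds) -> fl' h = fl h) ->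
  rds T fl lg ds -> rds T fl' lg ds.
Proof.
move=> flE [[l rl] fit]; split=> //; have mE := reads_mem rl; case: rl => li lf lgE vE gE.
by exists l; split=> // h; rewrite lf flE //; apply/mE; exists h.
Qed.

Lemma rds_inj (H : finType) (T S : ggGrc) (fl : H -> H) lg ds :
  rds T fl lg ds -> rds S fl lg ds -> T = S.
Proof. by move=> [rT _] [rS _]; apply/ggGrc_eq/(reads_inj rT rS). Qed.

(* The junk value [pt0] is taken when the lists do not present a connected graph. *)
Definition gval (H : finType) (fl : H -> H) (lg : seq H) (ds : seq (dvert H)) : pt A :=
  if pselect (exists T : ggGrc, rds T fl lg ds) is left e then al (sval (cid e)) (unzip2 ds)
  else pt0.

Definition gok (H : finType) (fl : H -> H) (lg : seq H) (ds : seq (dvert H)) : Prop :=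
  exists T : ggGrc, rds T fl lg ds.

Lemma gvalE (H : finType) (T : ggGrc) (fl : H -> H) lg ds :
  rds T fl lg ds -> gval fl lg ds = al T (unzip2 ds).
Proof.
move=> r; rewrite /gval; case: pselect => [e|[]]; last by exists T.
by rewrite (rds_inj (svalP (cid e)) r).
Qed.

Lemma gval_sub (H : finType) (fl flF : H -> H) lg w ds1 dsF ds2 :
  gok fl lg (ds1 ++ dsF ++ ds2) -> gok flF w dsF ->
  (forall h, h \in flatten (unzip1 dsF) -> flF h = if h \in w then h else fl h) ->
  gok fl lg (ds1 ++ (w, gval flF w dsF) :: ds2) /\
  gval fl lg (ds1 ++ dsF ++ ds2) = gval fl lg (ds1 ++ (w, gval flF w dsF) :: ds2).
Proof.
move=> [T rT] [F rF] flFE; have [S [rS E]] := law_sub rT rF flFE.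
rewrite (gvalE rF) (gvalE rS) (gvalE rT) E; split=> //; by exists S.
Qed.

Lemma gval_relabel (H H' : finType) (r : H -> H') (fl : H -> H) (fl' : H' -> H') lg ds :
  injective r -> (forall h, h \in flatten (unzip1 ds) -> fl' (r h) = r (fl h)) ->
  gok fl lg ds -> gok fl' (map r lg) [seq (map r d.1, d.2) | d <- ds] /\
  gval fl' (map r lg) [seq (map r d.1, d.2) | d <- ds] = gval fl lg ds.
Proof.
move=> ri flr [T rT]; have rT' := rds_relabel ri flr rT.
split; first by exists T.
by rewrite (gvalE rT) (gvalE rT') /unzip2 -map_comp.
Qed.

Lemma gval_ext (H : finType) (fl fl' : H -> H) lg ds :
  (forall h, h \in flatten (unzip1 ds) -> fl' h = fl h) ->
  gok fl lg ds -> gok fl' lg ds /\ gval fl' lg ds = gval fl lg ds.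
Proof.
move=> flE [T rT]; have rT' := rds_ext flE rT; split; first by exists T.
by rewrite (gvalE rT) (gvalE rT').
Qed.

End ListLaws.

Lemma genusE (T : ggGrc) : (genus T + nv T = \sum_(v < nv T) gen v + ne T + 1)%N.
Proof.
rewrite /genus /betti1 connected_n_comp ?graph_connected //.
by have := connected_nv_le T; set s := (\sum_(v < nv T) _)%N; lia.
Qed.

(** Sufficient for the graphs of the operad axioms, in each of which some vertex is joined to all
    others. *)
Lemma star_connected (H : finType) (T : ograph) (fl : H -> H) lg vs gs i0 :
  reads T fl lg vs gs -> (i0 < size vs)%N ->
  (forall i, (i < size vs)%N -> i <> i0 ->
     exists2 h, h \in nth [::] vs i0 & fl h \in nth [::] vs i) ->
  connected T.
Proof.
move=> r i0s star; have [sv _ _] := reads_size r; case: r => l rl.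
rewrite sv in i0s; pose v0 := Ordinal i0s.
have lE h v : l h \in nth [::] vs (nat_of_ord v) -> att h = v.
  have [li _ _ _ _] := rl; have [-> _] := reads_nth v rl.
  by rewrite mem_map // mem_filter => /andP[/eqP].
have c v : connect (@adjacent T) v0 v.
  have [->|vv] := eqVneq v v0; first exact: connect0.
  have vs_ : (v < size vs)%N by rewrite sv.
  have [|h h0 hv] := star v vs_; first by apply/eqP; rewrite -val_eqE in vv.
  apply: connect1; have [x hx] : exists x, h = l x.
    by apply/(reads_mem rl); apply/flattenP; exists (nth [::] vs i0); rewrite ?mem_nth // sv.
  rewrite hx in h0 hv; have [_ lf _ _ _] := rl; rewrite -lf in hv.
  apply/existsP; exists x; by rewrite (lE x v0 h0) (lE _ v hv) !eqxx.
have cs : connect_sym (@adjacent T) by apply: sym_connect_sym; exact: adjacent_sym.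
apply/andP; split; first exact: leq_ltn_trans (leq0n _) i0s.
apply/forallP => u; apply/forallP => v.
by apply: (connect_trans (y := v0)); rewrite ?c // cs c.
Qed.

(** * Values on lists and changes of local and global order *)

Section Act.
Variables (k : fieldType) (A : algebra k).
Local Notation pt := (pt A).
Local Notation dvert := (dvert A).

Lemma rds_pi0 (H : finType) (T : ggGrc) (fl : H -> H) lg (ds : seq (dvert H)) g :
  rds T fl lg ds ->
  (2 * (g + size ds) + size lg = 2 * (sumn (dgs ds) + 1) + size (flatten (unzip1 ds)))%N ->
  pi0 T = (size lg, g).
Proof.
move=> r; have sT := rds_size r; case: r => r _.
have [_ _ sf] := reads_size r; have sl := reads_size_legs r.
rewrite /pi0 sl sf sT; case: r => l [_ _ _ _ gE].
have -> : sumn (dgs ds) = (\sum_(v < nv T) gen v)%N by rewrite gE sumnE big_map big_enum.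
have := genusE T; have := card_edges T; set s := (\sum_(v < nv T) _)%N.
by move=> e1 e2 e3; congr pair; lia.
Qed.

Lemma gval_tag (H : finType) (fl : H -> H) lg (ds : seq (dvert H)) g : gok fl lg ds ->
  (2 * (g + size ds) + size lg = 2 * (sumn (dgs ds) + 1) + size (flatten (unzip1 ds)))%N ->
  projT1 (gval fl lg ds) = (size lg, g).
Proof. by move=> [T r] e; rewrite (gvalE r) /= (rds_pi0 r e). Qed.

Lemma gok_intro (H : finType) (fl : H -> H) lg (ds : seq (dvert H)) i0 :
  uniq (flatten (unzip1 ds)) ->
  (forall h, h \in flatten (unzip1 ds) -> fl h \in flatten (unzip1 ds) /\ fl (fl h) = h) ->
  uniq lg ->
  (forall h, (h \in lg) = (h \in flatten (unzip1 ds)) && (fl h == h)) ->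
  all (@fitting _ A H) ds -> (i0 < size ds)%N ->
  (forall i, (i < size ds)%N -> i <> i0 ->
     exists2 h, h \in nth [::] (unzip1 ds) i0 & fl h \in nth [::] (unzip1 ds) i) ->
  gok fl lg ds.
Proof.
move=> u flP ul lgP fit i0s star.
have wf : rwf fl lg (unzip1 ds) (dgs ds) by split=> //; rewrite !size_map.
have [T rT] := reads_exists wf.
have cT : connected T.
  by apply: (star_connected (i0 := i0) rT) => [|i]; rewrite size_map //; apply: star.
by exists (GgGrc cT).
Qed.

Lemma get_linear c c' : linear (fun x : A c => get c' (mkpt x)).
Proof.
rewrite /get /=; case: pselect => [e|_] a x y; first exact: acast_linear.
by rewrite scaler0 addr0.
Qed.

Lemma gval_linear (H : finType) (fl : H -> H) lg (ds1 ds2 : seq (dvert H)) w c c' :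
  gok fl lg (ds1 ++ (w, mkpt (0 : A c)) :: ds2) ->
  linear (fun x : A c => get c' (gval fl lg (ds1 ++ (w, mkpt x) :: ds2))).
Proof.
move=> [T r0].
have r (x : A c) : rds T fl lg (ds1 ++ (w, mkpt x) :: ds2).
  case: r0 => r0 f0; split; first by move: r0; rewrite /unzip1 /dgs !map_cat.
  by move: f0; rewrite !all_cat.
have iT : (size ds1 < nv T)%N by rewrite -(rds_size r0) size_cat /= addnS ltnS leq_addr.
pose i := Ordinal iT.
have E (x : A c) : inp T (unzip2 (ds1 ++ (w, mkpt x) :: ds2)) =
    dfwith (inp T (unzip2 (ds1 ++ (w, mkpt (0 : A c)) :: ds2)))
      (get (pi0 (source i)) (mkpt x)).
  apply: functional_extensionality_dep => j.
  have [->|ij] := eqVneq j i.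
    by rewrite dfwith_in /inp /unzip2 map_cat nth_cat size_map ltnn subnn.
  rewrite dfwith_out 1?eq_sym // /inp; congr get.
  rewrite /unzip2 !map_cat !nth_cat size_map; case: ltnP => // ji.
  have -> : (j - size ds1 = (j - size ds1).-1.+1)%N; last by [].
  have : nat_of_ord j != size ds1 by apply: contra ij => /eqP e; apply/eqP/ord_inj.
  by move: ji; rewrite leq_eqVlt eq_sym => /orP[-> //|lt] _; rewrite prednK // subn_gt0.
move=> a x y; rewrite !(gvalE (r _)) /al (E (a *: x + y)) (E x) (E y).
by rewrite get_linear alpha_linear get_linear.
Qed.

Lemma gval_homog (H : finType) (fl : H -> H) lg (ds : seq (dvert H)) (d : nat -> int) :
  gok fl lg ds -> (forall i, (i < size ds)%N -> pthomog (d i) (nth pt0 (unzip2 ds) i)) ->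
  pthomog (\sum_(i < size ds) d i) (gval fl lg ds).
Proof.
move=> [T r] dh; rewrite (gvalE r) (rds_size r).
apply: alpha_homog => i; apply: get_homog; apply: dh.
by rewrite (rds_size r).
Qed.

(* The value of the corolla with half-edges [w] at its vertex and legs [w']. *)
Definition act (H : finType) (w w' : seq H) (p : pt) : pt := gval id w' [:: (w, p)].

Lemma act_ok (H : finType) (w w' : seq H) (p : pt) : uniq w -> perm_eq w w' ->
  (projT1 p).1 = size w -> gok id w' [:: (w, p)].
Proof.
move=> u pw sp; apply: (@gok_intro _ _ _ _ 0).
- by rewrite /= cats0.
- by [].
- by rewrite -(perm_uniq pw).
- by move=> h; rewrite /= cats0 eqxx andbT (perm_mem pw).
- by rewrite /= /fitting sp eqxx.
- by [].
- by case.
Qed.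

Lemma act_tag (H : finType) (w w' : seq H) (p : pt) : uniq w -> perm_eq w w' ->
  (projT1 p).1 = size w -> projT1 (act w w' p) = (size w', (projT1 p).2).
Proof.
move=> u pw sp; apply: gval_tag; first exact: act_ok.
by rewrite /dgs /= cats0 (perm_size pw) addn0.
Qed.

Lemma act_id (H : finType) (w : seq H) (p : pt) : uniq w -> (projT1 p).1 = size w ->
  act w w p = p.
Proof.
move=> u sp; have [T r] := act_ok u (perm_refl w) sp.
rewrite /act (gvalE r); apply: al_unit; last exact: rds_good r.
case: r => r _; suff [_ + _ _] : [/\ nv T = 1%N, is_trivial T, genus T = (projT1 p).2
  & connected T] by [].
exact: corolla_facts r.
Qed.

Lemma gok_legs (H : finType) (fl : H -> H) lg w (ds : seq (dvert H)) :
  gok fl lg ds -> perm_eq lg w -> gok fl w ds.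
Proof.
move=> [T [[l rl] fit]] pw; have [li lf lE vE gE] := rl.
have wE h : h \in w -> exists i, l i == h.
  by rewrite -(perm_mem pw) lE => /mapP[i _ ->]; exists i.
pose ls : seq 'I_(nh T) := pmap (fun h => [pick i | l i == h]) w.
have lsE : map l ls = w.
  rewrite /ls; elim: (w) wE => //= h s IH sF.
  case: pickP => [i /eqP <-|no]; first by rewrite /= IH // => x xs; apply: sF; rewrite inE xs orbT.
  by have [i il] := sF h (mem_head _ _); rewrite no in il.
have uls : uniq ls.
  rewrite -(map_inj_uniq li) lsE -(perm_uniq pw) lE map_inj_uniq //; exact: legs_uniq.
have mls h : (h \in ls) = (flip h == h).
  by rewrite -(mem_map li) lsE -(perm_mem pw) lE (mem_map li) mem_legs.
pose T' := OGraph (@gen T) (@att_mono T) (@flipK T) uls mls.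
have cT' : connected T' by have := graph_connected T.
by exists (GgGrc cT'); split=> //; exists l; split.
Qed.

Lemma legs_fixed (H : finType) (fl : H -> H) lg (ds : seq (dvert H)) h :
  gok fl lg ds -> h \in lg -> fl h = h.
Proof.
case=> T [[l rl] _]; case: rl => _ lf -> _ _ /mapP[i].
by rewrite mem_legs => /eqP fi ->; rewrite -lf fi.
Qed.

Lemma gok_uniq_legs (H : finType) (fl : H -> H) lg (ds : seq (dvert H)) : gok fl lg ds -> uniq lg.
Proof. by case=> T [/reads_rwf[]]. Qed.

Lemma gok_fit (H : finType) (fl : H -> H) lg (ds : seq (dvert H)) : gok fl lg ds ->
  (projT1 (gval fl lg ds)).1 = size lg.
Proof. by case=> T r; rewrite (gvalE r) /=; case: r => /reads_size_legs ->. Qed.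

(** The whole graph, with legs ordered by [lg], is collapsed inside the same graph with legs ordered
    by [w]; what remains is the corolla defining [act]. *)
Lemma gval_leg (H : finType) (fl : H -> H) lg w (ds : seq (dvert H)) :
  gok fl lg ds -> perm_eq lg w -> act lg w (gval fl lg ds) = gval fl w ds.
Proof.
move=> okd pw; have okw := gok_legs okd pw.
have okT : gok fl w ([::] ++ ds ++ [::]) by rewrite /= cats0.
have [|_] := gval_sub okT okd.
  by move=> h _; case: ifP => // /(legs_fixed okd).
rewrite /= cats0 => ->; apply/esym; apply: (proj2 (gval_ext _ _)).
  by move=> h /=; rewrite cats0 => /(legs_fixed okd).
apply: act_ok pw (gok_fit okd); exact: gok_uniq_legs okd.
Qed.

Lemma act_act (H : finType) (w w' w'' : seq H) (p : pt) : uniq w -> perm_eq w w' ->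
  perm_eq w' w'' -> (projT1 p).1 = size w -> act w' w'' (act w w' p) = act w w'' p.
Proof. by move=> u pw pw' sp; apply: gval_leg pw'; apply: act_ok. Qed.

Lemma act_relabel (H H' : finType) (r : H -> H') (w w' : seq H) (p : pt) : injective r ->
  uniq w -> perm_eq w w' -> (projT1 p).1 = size w ->
  act (map r w) (map r w') p = act w w' p.
Proof.
move=> ri u pw sp; have okp := act_ok u pw sp.
exact: (proj2 (gval_relabel ri (fun _ _ => erefl) okp)).
Qed.

(** The collapsed block is a single corolla that compares two local orders at one vertex. *)
Lemma gval_local (H : finType) (fl : H -> H) lg (ds1 ds2 : seq (dvert H)) w w' p :
  gok fl lg (ds1 ++ (w, p) :: ds2) -> perm_eq w w' ->
  gok fl lg (ds1 ++ (w', act w w' p) :: ds2) /\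
  gval fl lg (ds1 ++ (w', act w w' p) :: ds2) = gval fl lg (ds1 ++ (w, p) :: ds2).
Proof.
move=> okd pw.
have uw : uniq w.
  case: okd => T [/reads_rwf[+ _ _ _ _] _].
  by rewrite /unzip1 map_cat flatten_cat /= !cat_uniq => /and3P[_ _ /andP[]].
have sp : (projT1 p).1 = size w.
  by case: okd => T [_]; rewrite all_cat /= => /and3P[_ /eqP].
have [|ok' E] := @gval_sub _ _ _ fl id lg w' ds1 [:: (w, p)] ds2 okd (act_ok uw pw sp).
  by move=> h /=; rewrite cats0 (perm_mem pw) => ->.
by split=> //; rewrite -E.
Qed.

End Act.

(** * The modular operad of an algebra *)

Lemma uniq_map_enum (S H : finType) (l : S -> H) : injective l -> uniq (map l (enum S)).
Proof. by move=> li; rewrite map_inj_uniq // enum_uniq. Qed.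

Lemma mem_map_enum (S H : finType) (l : S -> H) h :
  (h \in map l (enum S)) = (h \in codom l).
Proof.
apply/mapP/codomP => [[s _ ->]|[s ->]]; exists s => //; by rewrite mem_enum.
Qed.

Lemma perm_map_bij (S S' H : finType) (l : S' -> H) (f : bij S S') : injective l ->
  perm_eq (map (l \o f) (enum S)) (map l (enum S')).
Proof.
move=> li; apply: uniq_perm.
- by apply: uniq_map_enum; apply: inj_comp li (can_inj (bijK f)).
- exact: uniq_map_enum.
move=> h; rewrite !mem_map_enum; apply/codomP/codomP => [[s ->]|[s ->]].
  by exists (f s).
by exists (bij_inv f s); rewrite /= bijVK.
Qed.

Local Notation en S := (enum (S%type : finType)).

Section operad_of.
Variables (k : fieldType) (A : algebra k).
Local Notation dvert := (dvert A).

Definition car (S : finType) (g : nat) : gvect k := A (#|S|, g).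

(* [x] has its inputs labelled by [S]; through [l] they become half-edges, which are
   then listed in the order [w]. *)
Definition rd (S H : finType) (l : S -> H) (w : seq H) g (x : car S g) : pt A :=
  act (map l (enum S)) w (mkpt x).

Lemma car_fit (S : finType) g (x : car S g) : (projT1 (mkpt x)).1 = size (enum S).
Proof. by rewrite /= cardE. Qed.

Lemma rd_tag (S H : finType) (l : S -> H) (w : seq H) g (x : car S g) :
  injective l -> perm_eq (map l (enum S)) w -> projT1 (rd l w x) = (size w, g).
Proof. by move=> li pw; rewrite /rd act_tag ?uniq_map_enum ?(size_map l) ?car_fit. Qed.

Lemma rd_self (S H : finType) (l : S -> H) g (x : car S g) : injective l ->
  rd l (map l (enum S)) x = mkpt x.
Proof. by move=> li; rewrite /rd act_id ?uniq_map_enum ?(size_map l) ?car_fit. Qed.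

Lemma act_rd (S H : finType) (l : S -> H) (w w' : seq H) g (x : car S g) :
  injective l -> perm_eq (map l (enum S)) w -> perm_eq w w' ->
  act w w' (rd l w x) = rd l w' x.
Proof. by move=> li pw pw'; rewrite /rd act_act ?uniq_map_enum ?(size_map l) ?car_fit. Qed.

Lemma rd_inj (S H : finType) (l : S -> H) (w : seq H) g (x y : car S g) :
  injective l -> perm_eq (map l (enum S)) w -> rd l w x = rd l w y -> x = y.
Proof.
move=> li pw e; apply: mkpt_inj; rewrite -(rd_self x li) -(rd_self y li).
have pw' : perm_eq w (map l (enum S)) by rewrite perm_sym.
by rewrite -(act_rd x li pw pw') -(act_rd y li pw pw') e.
Qed.

Lemma eq_rd (S H : finType) (l l' : S -> H) (w : seq H) g (x : car S g) :
  l =1 l' -> rd l w x = rd l' w x.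
Proof. by move=> /funext ->. Qed.

Lemma rd_relabel (S H H' : finType) (l : S -> H) (r : H -> H') (w : seq H) g (x : car S g) :
  injective l -> injective r -> perm_eq (map l (enum S)) w ->
  rd (r \o l) (map r w) x = rd l w x.
Proof.
move=> li ri pw; rewrite /rd -(act_relabel ri _ pw) ?uniq_map_enum ?(size_map l) ?car_fit //.
by rewrite -map_comp.
Qed.

(** As a space [car S g] depends on the cardinality of [S] only. The set [S] enters through the
    order of [enum S], and [f] acts by the corolla that compares the two orders. *)
Definition fmapA (S S' : finType) g g' (f : bij S S') (e : g = g') (x : car S g) : car S' g' :=
  get (#|S'|, g') (rd f (enum S') x).

Lemma perm_enum_bij (S S' : finType) (f : bij S S') : perm_eq (map f (enum S)) (enum S').
Proof. by have := perm_map_bij f (@inj_id S'); rewrite map_id. Qed.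

Lemma bij_inj (S S' : finType) (f : bij S S') : injective f.
Proof. exact: can_inj (bijK f). Qed.

Lemma mkpt_fmapA (S S' : finType) g g' (f : bij S S') (e : g = g') (x : car S g) :
  mkpt (fmapA f e x) = rd f (enum S') x.
Proof.
rewrite mkpt_get // rd_tag ?perm_enum_bij -?cardE ?e //; exact: bij_inj.
Qed.

Lemma rd_fmapA (S S' H : finType) g g' (f : bij S S') (e : g = g') (x : car S g)
    (l : S' -> H) w : injective l -> perm_eq (map l (enum S')) w ->
  rd l w (fmapA f e x) = rd (l \o f) w x.
Proof.
move=> li pw; rewrite {1}/rd mkpt_fmapA.
rewrite -(rd_relabel _ (@bij_inj _ _ f) li (perm_enum_bij f)) act_rd //.
- exact: inj_comp li (@bij_inj _ _ f).
- exact: perm_map_bij.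
Qed.

Lemma rd_linear (S H : finType) (l : S -> H) w g c : injective l ->
  perm_eq (map l (enum S)) w -> linear (fun x : car S g => get c (rd l w x)).
Proof.
move=> li pw; apply: (@gval_linear _ _ _ _ _ [::] [::]).
by apply: act_ok; rewrite ?uniq_map_enum // size_map /= cardE.
Qed.

Lemma rd_homog (S H : finType) (l : S -> H) w g d (x : car S g) : injective l ->
  perm_eq (map l (enum S)) w -> homog d x -> pthomog d (rd l w x).
Proof.
move=> li pw xd; have := @gval_homog _ _ _ id w [:: (map l (enum S), mkpt x)] (fun=> d).
rewrite big_ord1; apply; last by case.
by apply: act_ok; rewrite ?uniq_map_enum // size_map /= cardE.
Qed.

Definition gmapA (S S' : finType) g g' (f : bij S S') (e : g = g') :
  gmap (car S g) (car S' g').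
Proof.
refine (@GMap k _ _ (fmapA f e) _ _).
- by apply: rd_linear; [exact: bij_inj|exact: perm_enum_bij].
- move=> d x xd; apply: get_homog; apply: rd_homog => //;
    [exact: bij_inj|exact: perm_enum_bij].
Defined.

Lemma car_ext (S H : finType) (l : S -> H) g (x y : car S g) :
  injective l -> rd l (map l (enum S)) x = rd l (map l (enum S)) y -> x = y.
Proof. by move=> li; apply: rd_inj li (perm_refl _). Qed.

Lemma fmapA1 (S : finType) g (f : bij S S) (e : g = g) (x : car S g) :
  f =1 id -> fmapA f e x = x.
Proof.
move=> f1; apply: (car_ext (@inj_id S)); rewrite rd_fmapA //.
exact: eq_rd.
Qed.

Definition operad_fun : genus_graded_functor k.
Proof.
refine (@Functor (prod_category FinBij (discrete_category nat)) (GradedVect k)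
  (fun Sg => car Sg.1 Sg.2) (fun x y fe => gmapA fe.1 fe.2) _ _).
- by move=> [S g]; apply: gmapP => x; apply: fmapA1.
- move=> [S1 g1] [S2 g2] [S3 g3] [f e] [f' e'] /=; apply: gmapP => x /=.
  apply: (car_ext (@inj_id S3)); rewrite !rd_fmapA //; [exact: bij_inj|exact: (perm_map_bij f (@inj_id S3))].
Defined.

Section Circ.
Variables (S1 S2 : finType) (g1 g2 : nat).

(** The graph with two vertices and one joining edge, its half-edges being [option S1 + option S2]:
    the two added points are exchanged and all other half-edges are legs. *)
Definition cfl (h : option S1 + option S2) : option S1 + option S2 :=
  match h with inl None => inr None | inr None => inl None | _ => h end.

Definition csum (s : S1 + S2) : option S1 + option S2 :=
  match s with inl s => inl (Some s) | inr s => inr (Some s) end.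

Definition cds (x : car (option S1) g1) (y : car (option S2) g2) :
    seq (dvert (option S1 + option S2)%type) :=
  [:: (map inl (en (option S1)), mkpt x); (map inr (en (option S2)), mkpt y)].

Definition clg := map csum (en (S1 + S2)).

Lemma csum_inj : injective csum.
Proof. by move=> [s|s] [t|t] //= [->]. Qed.

Lemma mem_clg h : (h \in clg) = (cfl h == h).
Proof.
rewrite mem_map_enum; apply/codomP/eqP => [[[s|s] ->] //|].
case: h => [[s|]|[s|]] //= _; [by exists (inl s)|by exists (inr s)].
Qed.

Lemma mem_inl (T T' : finType) (h : T + T') :
  (h \in map inl (enum T)) = (if h is inl _ then true else false).
Proof.
case: h => h; first by rewrite mem_map ?mem_enum // => x y [].
by apply/negP => /mapP[].
Qed.

Lemma mem_inr (T T' : finType) (h : T + T') :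
  (h \in map inr (enum T')) = (if h is inr _ then true else false).
Proof.
case: h => h; last by rewrite mem_map ?mem_enum // => x y [].
by apply/negP => /mapP[].
Qed.

Lemma cds_ok x y : gok cfl clg (cds x y).
Proof.
have full h : h \in flatten (unzip1 (cds x y)).
  by rewrite /= cats0 mem_cat mem_inl mem_inr; case: h.
apply: (@gok_intro _ _ _ _ _ _ 0) => //.
- rewrite /= cats0 cat_uniq; apply/and3P; split.
  + by apply: uniq_map_enum => ? ? [].
  + apply/hasP => -[h]; rewrite mem_inr mem_inl; by case: h.
  + by apply: uniq_map_enum => ? ? [].
- by move=> h _; split=> //; case: h => [[]|[]].
- by apply: uniq_map_enum; exact: csum_inj.
- by move=> h; rewrite full mem_clg.
- by rewrite /= /fitting /= 2!size_map -!cardE !eqxx.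
- case=> [|[|//]] // _ _; exists (inl None); first by rewrite /= mem_inl.
  by rewrite /= mem_inr.
Qed.

Lemma cds_tag x y : projT1 (gval cfl clg (cds x y)) = (#|(S1 + S2)%type : finType|, (g1 + g2)%N).
Proof.
have -> : #|(S1 + S2)%type : finType| = size clg by rewrite size_map -cardE.
apply: gval_tag; first exact: cds_ok.
rewrite /dgs /= !size_cat 3!size_map -!cardE card_sum !card_option /=; lia.
Qed.

Definition circA (x : car (option S1) g1) (y : car (option S2) g2) :
    car (S1 + S2)%type (g1 + g2)%N :=
  get (#|(S1 + S2)%type : finType|, (g1 + g2)%N) (gval cfl clg (cds x y)).

Lemma mkpt_circA x y : mkpt (circA x y) = gval cfl clg (cds x y).
Proof. by rewrite mkpt_get // cds_tag. Qed.

(** The one-edge graph with arbitrary names of half-edges and arbitrary local and global orders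
    still computes [circA]: names are changed first, then the leg order, then the order at each
    vertex. *)
Lemma circ_char (H : finType) (l1 : option S1 -> H) (l2 : option S2 -> H)
    (fl : H -> H) (w w1 w2 : seq H) x y :
  injective (lsum l1 l2) ->
  (forall h, fl (lsum l1 l2 h) = lsum l1 l2 (cfl h)) ->
  perm_eq (map (lsum l1 l2 \o csum) (en (S1 + S2))) w ->
  perm_eq (map l1 (en (option S1))) w1 -> perm_eq (map l2 (en (option S2))) w2 ->
  gok fl w [:: (w1, rd l1 w1 x); (w2, rd l2 w2 y)] /\
  gval fl w [:: (w1, rd l1 w1 x); (w2, rd l2 w2 y)] =
  rd (lsum l1 l2 \o csum) w (circA x y).
Proof.
move=> J flE pw pw1 pw2.
have [|ok1 E1] := @gval_relabel _ _ _ _ _ _ fl _ _ J _ (cds_ok x y); first by move=> h _.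
rewrite /clg /= -(map_comp (lsum l1 l2) csum) -(map_comp (lsum l1 l2) inl)
  -(map_comp (lsum l1 l2) inr) in ok1 E1.
have ok2 := gok_legs ok1 pw; have E2 := gval_leg ok1 pw.
have [ok3 E3] := @gval_local _ _ _ _ _ [::] _ _ w1 _ ok2 pw1.
have [ok4 E4] := @gval_local _ _ _ _ _ [:: (w1, _)] [::] _ w2 _ ok3 pw2.
split; first exact: ok4.
rewrite [LHS]E4 [LHS]E3 -E2 /rd mkpt_circA -E1.
by [].
Qed.

End Circ.

Section Contr.
Variables (S : finType) (g : nat).

(** The graph with one vertex and one loop formed by the two added points. *)
Definition kfl (h : option (option S)) : option (option S) :=
  match h with None => Some None | Some None => None | _ => h end.

Definition ksome (s : S) : option (option S) := Some (Some s).

Definition kds (x : car (option (option S)) g) : seq (dvert (option (option S))) :=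
  [:: (en (option (option S)), mkpt x)].

Definition klg := map ksome (enum S).

Lemma ksome_inj : injective ksome.
Proof. by move=> s t [->]. Qed.

Lemma mem_klg h : (h \in klg) = (kfl h == h).
Proof.
rewrite mem_map_enum; apply/codomP/eqP => [[s ->] //|].
by case: h => [[s|]|] //= _; exists s.
Qed.

Lemma kds_ok x : gok kfl klg (kds x).
Proof.
have full h : h \in flatten (unzip1 (kds x)) by rewrite /= cats0 mem_enum.
apply: (@gok_intro _ _ _ _ _ _ 0) => //.
- by rewrite /= cats0 enum_uniq.
- by move=> h _; split=> //; case: h => [[]|].
- by apply: uniq_map_enum; exact: ksome_inj.
- by move=> h; rewrite full mem_klg.
- by rewrite /= /fitting /= -!cardE !eqxx.
- by case.
Qed.

Lemma kds_tag x : projT1 (gval kfl klg (kds x)) = (#|S|, (g + 1)%N).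
Proof.
have -> : #|S| = size klg by rewrite size_map -cardE.
apply: gval_tag; first exact: kds_ok.
rewrite /dgs /= !size_cat size_map -!cardE !card_option /=; lia.
Qed.

Definition contrA (x : car (option (option S)) g) : car S (g + 1)%N :=
  get (#|S|, (g + 1)%N) (gval kfl klg (kds x)).

Lemma mkpt_contrA x : mkpt (contrA x) = gval kfl klg (kds x).
Proof. by rewrite mkpt_get // kds_tag. Qed.

Lemma contr_char (H : finType) (l : option (option S) -> H) (fl : H -> H) (w w1 : seq H) x :
  injective l ->
  (forall h, fl (l h) = l (kfl h)) ->
  perm_eq (map (l \o ksome) (enum S)) w ->
  perm_eq (map l (en (option (option S)))) w1 ->
  gok fl w [:: (w1, rd l w1 x)] /\
  gval fl w [:: (w1, rd l w1 x)] = rd (l \o ksome) w (contrA x).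
Proof.
move=> J flE pw pw1.
have [|ok1 E1] := @gval_relabel _ _ _ _ _ _ fl _ _ J _ (kds_ok x); first by move=> h _.
rewrite /klg /= -(map_comp l ksome) in ok1 E1.
have ok2 := gok_legs ok1 pw; have E2 := gval_leg ok1 pw.
have [ok3 E3] := @gval_local _ _ _ _ _ [::] _ _ w1 _ ok2 pw1.
split; first exact: ok3.
rewrite [LHS]E3 -E2 /rd mkpt_contrA -E1.
by [].
Qed.

End Contr.
End operad_of.

Ltac inj_cases := let u := fresh "u" in let v := fresh "v" in move=> u v;
  repeat match goal with
  | z : ?T |- _ => let T' := eval hnf in T in
      lazymatch T' with sum _ _ => destruct z | option _ => destruct z end
  end; rewrite /lsum /=; first [congruence | by case | by case=> ->].

Section OperadLaws.
Variables (k : fieldType) (A : algebra k).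
Local Notation dvert := (dvert A).
Local Notation car := (car A).
Local Notation mk := (fun x => mkpt (A := A) x).

(** The involution of the block keeps some edges of [fl] and cuts the rest; its legs are its fixed
    points, so they need not be compared with [w] by hand. *)
Lemma gval_contract (H : finType) (fl flF : H -> H) lg w (ds1 dsF ds2 : seq (dvert H)) :
  gok fl lg (ds1 ++ dsF ++ ds2) -> gok flF w dsF ->
  (forall h, flF h = h \/ flF h = fl h) ->
  gval fl lg (ds1 ++ dsF ++ ds2) = gval fl lg (ds1 ++ (w, gval flF w dsF) :: ds2).
Proof.
move=> okT okF flFE; apply: (proj2 (gval_sub okT okF _)) => h hF.
case: ifP => [/(legs_fixed okF) //|hw].
case: (flFE h) => // fh; case: okF => T [/reads_rwf[_ _ _ lgP _] _].
by rewrite lgP hF fh eqxx in hw.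
Qed.

Lemma circ_char_mk (H S1 S2 : finType) (l1 : option S1 -> H) (l2 : option S2 -> H)
    (fl : H -> H) (w : seq H) g1 g2 (x : car (option S1) g1) (y : car (option S2) g2) :
  injective (lsum l1 l2) ->
  (forall h, fl (lsum l1 l2 h) = lsum l1 l2 (cfl h)) ->
  perm_eq (map (lsum l1 l2 \o csum (S1:=S1) (S2:=S2)) (en (S1 + S2))) w ->
  gok fl w [:: (map l1 (en (option S1)), mkpt x); (map l2 (en (option S2)), mkpt y)] /\
  gval fl w [:: (map l1 (en (option S1)), mkpt x); (map l2 (en (option S2)), mkpt y)] =
  rd (lsum l1 l2 \o csum (S1:=S1) (S2:=S2)) w (circA x y).
Proof.
move=> J flE pw.
have J1 : injective l1 by move=> a b e; have [] := J (inl a) (inl b) e.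
have J2 : injective l2 by move=> a b e; have [] := J (inr a) (inr b) e.
have := circ_char x y J flE pw (perm_refl _) (perm_refl _).
by rewrite !rd_self.
Qed.

Lemma gval_swap (H : finType) (fl : H -> H) w (d1 d2 : dvert H) dx dy :
  gok fl w [:: d1; d2] -> pthomog dx d1.2 -> pthomog dy d2.2 ->
  gval fl w [:: d1; d2] = pt_scale ((-1) ^+ absz (dx * dy)) (gval fl w [:: d2; d1]).
Proof.
move=> [T r] hx hy; have sT := rds_size r; rewrite /= in sT.
have [|S [f [rS fp E]]] := law_perm r (Is := [:: 1%N; 0%N]); first by [].
rewrite (gvalE r) (gvalE rS).
rewrite (E (fun u => nth 0 [:: dx; dy] u)); last first.
  move=> u; have := ltn_ord u; rewrite -{2}sT.
  by case: (nat_of_ord u) => [|[|]].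
congr pt_scale; rewrite /koszul.
have t0 : (0 < nv T)%N by rewrite -sT.
have t1 : (1 < nv T)%N by rewrite -sT.
(* With two vertices, the pair of positions 0 and 1 is the only candidate for an inversion, and the
   exchange inverts it. *)
rewrite (bigD1 (Ordinal t0, Ordinal t1)) /=; last by rewrite !fp.
rewrite big1 ?mulr1 // => -[u v] /= /andP[/andP[uv _] ne].
case/negP: ne; have := ltn_ord u; have := ltn_ord v; rewrite -{2 4}sT.
rewrite xpair_eqE -!val_eqE /=.
by case: (nat_of_ord u) uv => [|[|]] //; case: (nat_of_ord v) => [|[|]].
Qed.

Lemma psc_mkpt c (x : A c) a : pt_scale a (mkpt x) = mkpt (a *: x).
Proof. by []. Qed.

Lemma rd_scale (S H : finType) (l : S -> H) w g a (x : car S g) : injective l ->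
  perm_eq (map l (enum S)) w -> rd l w (a *: x) = pt_scale a (rd l w x).
Proof.
move=> li pw; have t := rd_tag x li pw; have t' := rd_tag (a *: x) li pw.
rewrite -(mkpt_get t') -[in RHS](mkpt_get t) psc_mkpt; congr mkpt.
exact: (linearZ_ (rd_linear (A := A) (g := g) (size w, g) li pw) a x).
Qed.

Lemma circA_linearl (S1 S2 : finType) g1 g2 (y : car (option S2) g2) :
  linear (fun x : car (option S1) g1 => circA x y).
Proof. by apply: (@gval_linear _ _ _ _ _ [::]); exact: cds_ok. Qed.

Lemma circA_linearr (S1 S2 : finType) g1 g2 (x : car (option S1) g1) :
  linear (fun y : car (option S2) g2 => circA x y).
Proof. by apply: (@gval_linear _ _ _ _ _ [:: _]); exact: cds_ok. Qed.

Lemma circA_homog (S1 S2 : finType) g1 g2 d e (x : car (option S1) g1) (y : car (option S2) g2) :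
  homog d x -> homog e y -> homog (d + e) (circA x y).
Proof.
move=> xd ye; apply: get_homog.
have := gval_homog (d := nth 0 [:: d; e]) (cds_ok x y).
rewrite !big_ord_recr big_ord0 /= add0r; apply.
by case=> [|[|]].
Qed.

Lemma contrA_linear (S : finType) g : linear (@contrA _ A S g).
Proof. by apply: (@gval_linear _ _ _ _ _ [::]); exact: (kds_ok (0 : car _ g)). Qed.

Lemma contrA_homog (S : finType) g d (x : car (option (option S)) g) :
  homog d x -> homog d (contrA x).
Proof.
move=> xd; apply: get_homog.
have := gval_homog (d := fun=> d) (kds_ok x).
by rewrite big_ord1; apply; case.
Qed.

(** Both sides are the value of one joining edge, read through two labellings of the same
    half-edges. *)
Lemma circA_natural (S1 S1' S2 S2' : finType) (f1 : bij S1 S1') (f2 : bij S2 S2') g1 g2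
    (x : car (option S1) g1) (y : car (option S2) g2) :
  fmapA (bij_sum f1 f2) (erefl (g1 + g2)%N) (circA x y) =
  circA (fmapA (bij_opt f1) (erefl g1) x) (fmapA (bij_opt f2) (erefl g2) y).
Proof.
apply: (car_ext (@csum_inj S1' S2')); rewrite rd_fmapA //; last exact: csum_inj.
set w := map _ _.
have Ji : injective (lsum (@inl (option S1') (option S2')) inr) by inj_cases.
have J : injective (lsum (inl \o bij_opt f1 : _ -> option S1' + option S2')%type
    (inr \o bij_opt f2)).
  have i1 := @bij_inj _ _ f1; have i2 := @bij_inj _ _ f2.
  by move=> [[a|]|[a|]] [[b|]|[b|]] //= []; first [move/i1 -> | move/i2 ->].
have p1 : perm_eq (map (inl \o bij_opt f1 : _ -> option S1' + option S2')%type (en (option S1)))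
    (map inl (en (option S1'))) by apply: (perm_map_bij (bij_opt f1)) => ? ? [].
have p2 : perm_eq (map (inr \o bij_opt f2 : _ -> option S1' + option S2')%type (en (option S2)))
    (map inr (en (option S2'))) by apply: (perm_map_bij (bij_opt f2)) => ? ? [].
have e1 : lsum (inl \o bij_opt f1) (inr \o bij_opt f2) \o csum (S1:=S1) (S2:=S2) =1
    csum (S1:=S1') (S2:=S2') \o bij_sum f1 f2 by split_labels.
have [|| _ E] := @circ_char _ _ _ _ _ _ _ _ _ (@cfl S1' S2') w _ _ x y J _ _ p1 p2.
- by split_labels.
- by rewrite (eq_map e1); apply: perm_map_bij; exact: csum_inj.
rewrite -(eq_rd _ _ e1) -E.
have [|| _ E'] := @circ_char _ _ _ _ _ _ _ _ _ (@cfl S1' S2') w _ _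
  (fmapA (bij_opt f1) (erefl g1) x) (fmapA (bij_opt f2) (erefl g2) y) Ji _ _
  (perm_refl _) (perm_refl _).
- by split_labels.
- by rewrite (eq_map (g := csum (S1:=S1') (S2:=S2'))) //; split_labels.
have e2 : lsum inl inr \o csum (S1:=S1') (S2:=S2') =1 csum (S1:=S1') (S2:=S2') by split_labels.
rewrite -(eq_rd _ _ e2) -E' !rd_fmapA //; by move=> ? ? [].
Qed.

Lemma contrA_natural (S S' : finType) (f : bij S S') g (x : car (option (option S)) g) :
  fmapA f (erefl (g + 1)%N) (contrA x) =
  contrA (fmapA (bij_opt (bij_opt f)) (erefl g) x).
Proof.
apply: (car_ext (@ksome_inj S')); rewrite rd_fmapA //; last exact: ksome_inj.
set w := map _ _; set F := bij_opt (bij_opt f).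
have [||||_ E] := @contr_char _ _ _ _ _ F (@kfl S') w (en (option (option S'))) x.
- exact: bij_inj.
- by split_labels.
- rewrite (eq_map (g := ksome (S:=S') \o f)) //; apply: perm_map_bij; exact: ksome_inj.
- exact: perm_enum_bij.
rewrite -(@eq_rd _ _ _ _ (F \o ksome (S:=S))) // -E.
have [||||_ E'] := @contr_char _ _ _ _ _ id (@kfl S') w (en (option (option S'))) (fmapA F (erefl g) x).
- by [].
- by split_labels.
- exact: perm_refl.
- by rewrite map_id.
rewrite -(@eq_rd _ _ _ _ (id \o ksome (S:=S'))) // -E' rd_fmapA // map_id.
by [].
Qed.

Lemma contrA_sym (S : finType) g (x : car (option (option S)) g) :
  contrA (fmapA (bij_swap S) (erefl g) x) = contrA x.
Proof.
apply: (car_ext (@ksome_inj S)); set w := map _ _.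
have [||||_ E] := @contr_char _ _ _ _ _ id (@kfl S) w (en (option (option S)))
  (fmapA (bij_swap S) (erefl g) x).
- by [].
- by split_labels.
- exact: perm_refl.
- by rewrite map_id.
have [||||_ E'] := @contr_char _ _ _ _ _ (bij_swap S) (@kfl S) w (en (option (option S))) x.
- exact: bij_inj.
- by split_labels.
- exact: perm_refl.
- exact: perm_enum_bij.
rewrite -(@eq_rd _ _ _ _ (id \o ksome (S:=S))) // -E rd_fmapA // ?map_id //.
Qed.

Lemma circA_sym (S1 S2 : finType) g1 g2 d1 d2
    (x : car (option S1) g1) (y : car (option S2) g2) :
  homog d1 x -> homog d2 y ->
  circA x y = (-1) ^+ absz (d1 * d2) *:
    fmapA (bij_sumC S2 S1) (addnC g2 g1) (circA y x).
Proof.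
move=> xd yd; apply: (car_ext (@csum_inj S1 S2)).
rewrite rd_scale //; last exact: csum_inj.
rewrite rd_fmapA //; last exact: csum_inj.
rewrite rd_self; last exact: csum_inj.
rewrite mkpt_circA (gval_swap (cds_ok x y) xd yd); congr pt_scale.
have J : injective (lsum (@inr (option S1) (option S2)) inl) by inj_cases.
have e : lsum inr inl \o csum (S1:=S2) (S2:=S1) =1 csum (S1:=S1) (S2:=S2) \o bij_sumC S2 S1.
  by split_labels.
have [||_ E] := @circ_char_mk _ _ _ _ _ (@cfl S1 S2) (map (csum (S1:=S1) (S2:=S2)) (en (S1 + S2)))
  _ _ y x J.
- by split_labels.
- by rewrite (eq_map e); apply: perm_map_bij; exact: csum_inj.
by rewrite [LHS]E (eq_rd _ _ e).
Qed.

End OperadLaws.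

(** * The two-edge graphs behind the axioms *)

Section EdgeContraction.
Variables (k : fieldType) (A : algebra k).
Local Notation dvert := (dvert A).
Local Notation car := (car A).

Definition dv (S H : finType) (l : S -> H) (w : seq H) g (x : car S g) : dvert H := (w, rd l w x).

Lemma dv_fmapA (S S' H : finType) (l : S -> H) (l' : S' -> H) (b : bij S S') w g g'
    (e : g = g') (x : car S g) :
  injective l' -> l' \o b =1 l -> perm_eq (map l' (enum S')) w ->
  dv l w x = dv l' w (fmapA b e x).
Proof. by move=> li lb pw; rewrite /dv rd_fmapA // (eq_rd _ _ lb). Qed.

(** Contracts one edge of a larger graph: the merged vertex keeps the half-edges named by [m], and
    [b] is the explicit bijection that the axiom of modular operads inserts at this place. *)
Lemma circ_step (H S1 S2 S : finType) (l1 : option S1 -> H) (l2 : option S2 -> H) (m : S -> H)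
    (b : bij (S1 + S2)%type S) (fl : H -> H) (w w1 w2 : seq H) g1 g2 g (e : (g1 + g2)%N = g)
    (x : car (option S1) g1) (y : car (option S2) g2) :
  injective (lsum l1 l2) -> injective m ->
  (forall h, fl (lsum l1 l2 h) = lsum l1 l2 (cfl h)) ->
  m \o b =1 lsum l1 l2 \o csum (S1:=S1) (S2:=S2) ->
  perm_eq (map m (enum S)) w ->
  perm_eq (map l1 (en (option S1))) w1 -> perm_eq (map l2 (en (option S2))) w2 ->
  gok fl w [:: dv l1 w1 x; dv l2 w2 y] /\
  (w, gval fl w [:: dv l1 w1 x; dv l2 w2 y]) = dv m w (fmapA b e (circA x y)).
Proof.
move=> J mi flE mb pw pw1 pw2.
have [|okE E] := circ_char (w := w) x y J flE _ pw1 pw2.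
  by rewrite -(eq_map mb); apply: perm_trans pw; apply: perm_map_bij.
by split=> //; rewrite /dv E rd_fmapA // (eq_rd _ _ mb).
Qed.

Lemma contr_step (H S S' : finType) (l : option (option S) -> H) (m : S' -> H)
    (b : bij S S') (fl : H -> H) (w w1 : seq H) g g' (e : (g + 1)%N = g')
    (x : car (option (option S)) g) :
  injective l -> injective m ->
  (forall h, fl (l h) = l (kfl h)) ->
  m \o b =1 l \o ksome (S:=S) ->
  perm_eq (map m (enum S')) w ->
  perm_eq (map l (en (option (option S)))) w1 ->
  gok fl w [:: dv l w1 x] /\
  (w, gval fl w [:: dv l w1 x]) = dv m w (fmapA b e (contrA x)).
Proof.
move=> li mi flE mb pw pw1.
have [|okE E] := contr_char (w := w) x li flE _ pw1.
  by rewrite -(eq_map mb); apply: perm_trans pw; apply: perm_map_bij.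
by split=> //; rewrite /dv E rd_fmapA // (eq_rd _ _ mb).
Qed.

(** For graphs whose half-edges are all elements of [H]: covering [H] with at most [#|H|] entries
    leaves no repetition. *)
Lemma gok_full (H S : finType) (fl : H -> H) (out : S -> H) (ds : seq (dvert H)) i0 :
  (forall h, h \in flatten (unzip1 ds)) -> (size (flatten (unzip1 ds)) <= #|H|)%N ->
  involutive fl -> injective out -> (forall h, (h \in codom out) = (fl h == h)) ->
  all (@fitting _ A H) ds -> (i0 < size ds)%N ->
  (forall i, (i < size ds)%N -> i <> i0 ->
     exists2 h, h \in nth [::] (unzip1 ds) i0 & fl h \in nth [::] (unzip1 ds) i) ->
  gok fl (map out (enum S)) ds.
Proof.
move=> cover sz flK oi oE fit i0s star.
apply: (gok_intro (i0 := i0)) => //.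
- by apply: (leq_size_uniq (enum_uniq H)) => //; rewrite -cardE.
- exact: uniq_map_enum.
- by move=> h; rewrite cover mem_map_enum.
Qed.

Lemma dv_fitting (S H : finType) (l : S -> H) w g (x : car S g) : injective l ->
  perm_eq (map l (enum S)) w -> fitting (dv l w x).
Proof. by move=> li pw; rewrite /fitting /= rd_tag. Qed.

End EdgeContraction.

Ltac side := first [assumption | exact: perm_refl | by inj_cases | by split_labels].

Section Assoc.
Variables (k : fieldType) (A : algebra k) (S1 S2 S3 : finType).
Local Notation car := (car A).
Let H := (option S1 + (option (option S2) + option S3))%type.

Let I1 (s : option S1) : H := inl s.
Let I2 (s : option (option S2)) : H := inr (inl s).
Let I3 (s : option S3) : H := inr (inr s).

(** The chain of three vertices [x], [y], [z]. The involution [flL] keeps the edge from [y] to [z],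
    contracted first on the left of the axiom; [flR] keeps the edge from [x] to [y]. The maps [m23]
    and [m12] name the half-edges left at the merged vertex. *)
Let fl (h : H) : H := match h with
  | inl None => inr (inl (Some None)) | inr (inl (Some None)) => inl None
  | inr (inl None) => inr (inr None) | inr (inr None) => inr (inl None) | _ => h end.

Let flL (h : H) : H := match h with
  | inr (inl None) => inr (inr None) | inr (inr None) => inr (inl None) | _ => h end.

Let flR (h : H) : H := match h with
  | inl None => inr (inl (Some None)) | inr (inl (Some None)) => inl None | _ => h end.

Let out (s : S1 + S2 + S3) : H := match s with
  | inl (inl s) => inl (Some s) | inl (inr s) => inr (inl (Some (Some s)))
  | inr s => inr (inr (Some s)) end.

Let m23 (s : option (S2 + S3)) : H := match s with
  | None => inr (inl (Some None)) | Some (inl s) => inr (inl (Some (Some s)))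
  | Some (inr s) => inr (inr (Some s)) end.

Let m12 (s : option (S1 + S2)) : H := match s with
  | None => inr (inl None) | Some (inl s) => inl (Some s)
  | Some (inr s) => inr (inl (Some (Some s))) end.

Lemma circA_assoc g1 g2 g3
      (x : car (option S1) g1) (y : car (option (option S2)) g2) (z : car (option S3) g3) :
    fmapA (bij_sumA S1 S2 S3) (addnA g1 g2 g3)
      (circA x (fmapA (bij_optl S2 S3) (erefl (g2 + g3)%N) (circA y z))) =
    circA (fmapA (bij_optr S1 S2) (erefl (g1 + g2)%N)
            (circA x (fmapA (bij_swap S2) (erefl g2) y))) z.
Proof.
have oi : injective out by inj_cases.
have i1 : injective I1 by inj_cases.
have i2 : injective I2 by inj_cases.
have i3 : injective I3 by inj_cases.
have i23 : injective m23 by inj_cases.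
have i12 : injective m12 by inj_cases.
set w := map out (en (S1 + S2 + S3)).
set w1 := map I1 (en (option S1)).
set w2 := map I2 (en (option (option S2))).
set w3 := map I3 (en (option S3)).
have okG : gok fl w ([:: dv I1 w1 x] ++ [:: dv I2 w2 y; dv I3 w3 z] ++ [::]).
  apply: (gok_full (i0 := 1)) => //.
  - move=> h; rewrite /= !mem_cat !mem_map_enum; case: h => [s|[s|s]];
    by rewrite ?(codom_f I1) ?(codom_f I2) ?(codom_f I3) ?orbT.
  - by rewrite /= !size_cat (size_map I1) (size_map I2) (size_map I3) -!cardE addn0 !card_sum.
  - by case=> [[]|[[[]|]|[]]].
  - move=> h; apply/codomP/eqP => [[[[s|s]|s] ->] //|].
    case: h => [[s|]|[[[s|]|]|[s|]]] //= _;
      [by exists (inl (inl s))|by exists (inl (inr s))|by exists (inr s)].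
  - by rewrite /= !dv_fitting.
  - case=> [|[|[|//]]] //= _ _.
    + exists (I2 (Some None)); rewrite /= /w1 /w2 mem_map_enum; [exact: codom_f|exact: (codom_f I1 None)].
    + exists (I2 None); rewrite /= /w1 /w2 mem_map_enum; [exact: codom_f|exact: (codom_f I3 None)].
pose wL := map m23 (en (option (S2 + S3))).
pose wR := map m12 (en (option (S1 + S2))).
have [|||||||okL EL] := @circ_step _ A _ _ _ _ I2 I3 m23 (bij_optl S2 S3) flL wL w2 w3 _ _ _
  (erefl (g2 + g3)%N) y z; [side..|idtac].
have [|||||||_ EL'] := @circ_step _ A _ _ _ _ I1 m23 out (bij_sumA S1 S2 S3) fl w w1 wL _ _ _
  (addnA g1 g2 g3) x (fmapA (bij_optl S2 S3) (erefl (g2 + g3)%N) (circA y z)); [side..|idtac].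
(* On the right of the axiom [y] is used with its two added points exchanged; naming through the
   exchange leaves the decorated vertex unchanged. *)
pose I2' := I2 \o bij_swap S2.
have i2' : injective I2' by exact: inj_comp i2 (@bij_inj _ _ (bij_swap S2)).
have pI2' : perm_eq (map I2' (en (option (option S2)))) w2.
  exact: (@perm_map_bij _ _ _ I2 (bij_swap S2) i2).
have Ey : dv I2 w2 y = dv I2' w2 (fmapA (bij_swap S2) (erefl g2) y).
  by apply: dv_fmapA; side.
have [|||||||okR ER] := @circ_step _ A _ _ _ _ I1 I2' m12 (bij_optr S1 S2) flR wR w1 w2 _ _ _
  (erefl (g1 + g2)%N) x (fmapA (bij_swap S2) (erefl g2) y); [side..|idtac].
have [|||||||_ ER'] := @circ_step _ A _ _ _ _ m12 I3 out (bij_id _) fl w wR w3 _ _ _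
  (erefl (g1 + g2 + g3)%N) (fmapA (bij_optr S1 S2) (erefl (g1 + g2)%N)
            (circA x (fmapA (bij_swap S2) (erefl g2) y))) z; [side..|idtac].
have CL := gval_contract okG okL; rewrite EL in CL.
have okG' : gok fl w ([::] ++ [:: dv I1 w1 x; dv I2' w2 (fmapA (bij_swap S2) (erefl g2) y)] ++
  [:: dv I3 w3 z]) by rewrite -Ey; exact: okG.
have CR := gval_contract okG' okR; rewrite ER in CR.
apply: (car_ext oi); rewrite -/w; move: EL' ER'; rewrite [fmapA (bij_id _) _ _]fmapA1 // => -[<-] [<-].
rewrite /= in CL CR; rewrite -CL; last by split_labels; auto.
by rewrite -CR ?Ey //; split_labels; auto.
Qed.
End Assoc.

Lemma contr_step1 (k : fieldType) (A : algebra k) (H S : finType) (l : option (option S) -> H)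
    (m : S -> H) (fl : H -> H) (w w1 : seq H) g (x : car A (option (option S)) g) :
  injective l -> injective m -> (forall h, fl (l h) = l (kfl h)) ->
  m =1 l \o ksome (S:=S) -> perm_eq (map m (enum S)) w ->
  perm_eq (map l (en (option (option S)))) w1 ->
  gok fl w [:: dv l w1 x] /\ (w, gval fl w [:: dv l w1 x]) = dv m w (contrA x).
Proof.
move=> li mi flE mb pw pw1.
have [] := contr_step (b := bij_id S) (erefl (g + 1)%N) x li mi flE mb pw pw1.
by rewrite fmapA1.
Qed.

Section ContrContr.
Variables (k : fieldType) (A : algebra k) (S : finType).
Local Notation car := (car A).
Let H := (option (option (option (option S)))).

(** One vertex with two loops; [flR] keeps the loop that is contracted first on the right-hand
    side. *)
Let fl (h : H) : H := match h with
  | None => Some None | Some None => None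
  | Some (Some None) => Some (Some (Some None)) | Some (Some (Some None)) => Some (Some None)
  | _ => h end.

Let flR (h : H) : H := match h with
  | Some (Some None) => Some (Some (Some None)) | Some (Some (Some None)) => Some (Some None)
  | _ => h end.

Let out (s : S) : H := Some (Some (Some (Some s))).

Let mR (s : option (option S)) : H := bij_swap2 S (Some (Some s)).

Lemma contrA_contr g (x : car (option (option (option (option S)))) g) :
    contrA (contrA x) = contrA (contrA (fmapA (bij_swap2 S) (erefl g) x)).
Proof.
have oi : injective out by inj_cases.
have imR : injective mR by inj_cases.
pose I := @id H.
pose I' := bij_swap2 S : _ -> H.
have i' : injective I' by exact: bij_inj.
set w := map out (enum S).
set wx := map I (en (option (option (option (option S))))).
have okG : gok fl w ([::] ++ [:: dv I wx x] ++ [::]).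
  apply: (gok_full (i0 := 0)) => //.
  - by move=> h; rewrite /= !mem_cat mem_map_enum (codom_f I).
  - by rewrite /= !size_cat (size_map I) -!cardE addn0.
  - by case=> [[[[]|]|]|].
  - move=> h; apply/codomP/eqP => [[s ->] //|].
    by case: h => [[[[s|]|]|]|] //= _; exists s.
  - by rewrite /= !dv_fitting.
  - by case.
pose wL := map (@ksome (option (option S))) (en (option (option S))).
pose wR := map mR (en (option (option S))).
have pI' : perm_eq (map I' (en (option (option (option (option S)))))) wx.
  exact: (@perm_map_bij _ _ _ I (bij_swap2 S)).
have [||||||okL EL] := @contr_step1 _ A _ _ I (@ksome _) (@kfl _) wL wx _
  x; [first [side|by []|exact: ksome_inj]..|idtac].
have [||||||_ EL'] := @contr_step1 _ A _ _ (@ksome _) out fl w wL _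
  (contrA x); [first [side|exact: ksome_inj]..|idtac].
have Ex : dv I wx x = dv I' wx (fmapA (bij_swap2 S) (erefl g) x) by apply: dv_fmapA; side.
have [||||||okR ER] := @contr_step1 _ A _ _ I' mR flR wR wx _
  (fmapA (bij_swap2 S) (erefl g) x); [side..|idtac].
have [||||||_ ER'] := @contr_step1 _ A _ _ mR out fl w wR _
  (contrA (fmapA (bij_swap2 S) (erefl g) x)); [side..|idtac].
have CL := gval_contract okG okL; rewrite EL in CL.
have okG' : gok fl w ([::] ++ [:: dv I' wx (fmapA (bij_swap2 S) (erefl g) x)] ++ [::]).
  by rewrite -Ex; exact: okG.
have CR := gval_contract okG' okR; rewrite ER in CR.
move: (congr1 snd EL') (congr1 snd ER'); rewrite [X in X = _ -> _]/= [X in _ -> X = _ -> _]/= => EL2 ER2.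
refine (rd_inj oi (perm_refl w) (etrans (esym EL2) (etrans _ ER2))).
refine (etrans (esym (CL _)) (etrans _ (CR _))); [by split_labels; auto| |by split_labels; auto].
by rewrite ?Ex.
Qed.
End ContrContr.

Section ContrCirc.
Variables (k : fieldType) (A : algebra k) (S1 S2 : finType).
Local Notation car := (car A).
Let H := (option (option S1) + option (option S2))%type.

Let I1 (s : option (option S1)) : H := inl s.
Let I2 (s : option (option S2)) : H := inr s.

(** Two vertices with two parallel edges. Whichever is contracted first, the other becomes a loop,
    and [flR] keeps the one contracted first on the right-hand side. *)
Let fl (h : H) : H := match h with
  | inl None => inr None | inr None => inl None
  | inl (Some None) => inr (Some None) | inr (Some None) => inl (Some None)
  | _ => h end.

Let flR (h : H) : H := match h with
  | inl (Some None) => inr (Some None) | inr (Some None) => inl (Some None)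
  | _ => h end.

Let out (s : S1 + S2) : H := match s with
  | inl s => inl (Some (Some s)) | inr s => inr (Some (Some s)) end.

Let mL (s : option (option (S1 + S2))) : H := match s with
  | None => inl (Some None) | Some None => inr (Some None) | Some (Some s) => out s end.

Let mR (s : option (option (S1 + S2))) : H := match s with
  | None => inl None | Some None => inr None | Some (Some s) => out s end.

Lemma contrA_circ g1 g2 (x : car (option (option S1)) g1) (y : car (option (option S2)) g2) :
    contrA (fmapA (bij_opt2 S1 S2) (erefl (g1 + g2)%N) (circA x y)) =
    contrA (fmapA (bij_opt2 S1 S2) (erefl (g1 + g2)%N)
      (circA (fmapA (bij_swap S1) (erefl g1) x) (fmapA (bij_swap S2) (erefl g2) y))).
Proof.
have oi : injective out by inj_cases.
have imR : injective mR by inj_cases.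
have imL : injective mL by inj_cases.
have i1 : injective I1 by inj_cases.
have i2 : injective I2 by inj_cases.
pose I1' := I1 \o bij_swap S1; pose I2' := I2 \o bij_swap S2.
have i1' : injective I1' by exact: inj_comp i1 (@bij_inj _ _ (bij_swap S1)).
have i2' : injective I2' by exact: inj_comp i2 (@bij_inj _ _ (bij_swap S2)).
set w := map out (en (S1 + S2)).
set w1 := map I1 (en (option (option S1))).
set w2 := map I2 (en (option (option S2))).
have okG : gok fl w ([::] ++ [:: dv I1 w1 x; dv I2 w2 y] ++ [::]).
  apply: (gok_full (i0 := 0)) => //.
  - move=> h; rewrite /= !mem_cat !mem_map_enum; case: h => s;
    by rewrite ?(codom_f I1) ?(codom_f I2) ?orbT.
  - by rewrite /= !size_cat (size_map I1) (size_map I2) -!cardE addn0 !card_sum.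
  - by case=> [[[]|]|[[]|]].
  - move=> h; apply/codomP/eqP => [[[s|s] ->] //|].
    by case: h => [[[s|]|]|[[s|]|]] //= _; [exists (inl s)|exists (inr s)].
  - by rewrite /= !dv_fitting.
  - case=> [|[|//]] //= _ _.
    exists (I1 None); rewrite /= /w1 /w2 mem_map_enum; [exact: codom_f|exact: (codom_f I2 None)].
pose wL := map mL (en (option (option (S1 + S2)))).
pose wR := map mR (en (option (option (S1 + S2)))).
have p1' : perm_eq (map I1' (en (option (option S1)))) w1.
  exact: (@perm_map_bij _ _ _ I1 (bij_swap S1)).
have p2' : perm_eq (map I2' (en (option (option S2)))) w2.
  exact: (@perm_map_bij _ _ _ I2 (bij_swap S2)).
have Ex : dv I1 w1 x = dv I1' w1 (fmapA (bij_swap S1) (erefl g1) x) by apply: dv_fmapA; side.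
have Ey : dv I2 w2 y = dv I2' w2 (fmapA (bij_swap S2) (erefl g2) y) by apply: dv_fmapA; side.
have [|||||||okL EL] := @circ_step _ A _ _ _ _ I1 I2 mL (bij_opt2 S1 S2) (@cfl _ _) wL w1 w2 _ _ _
  (erefl (g1 + g2)%N) x y; [side..|idtac].
have [||||||_ EL'] := @contr_step1 _ A _ _ mL out fl w wL _
  (fmapA (bij_opt2 S1 S2) (erefl (g1 + g2)%N) (circA x y)); [side..|idtac].
have [|||||||okR ER] := @circ_step _ A _ _ _ _ I1' I2' mR (bij_opt2 S1 S2) flR wR w1 w2 _ _ _
  (erefl (g1 + g2)%N) (fmapA (bij_swap S1) (erefl g1) x) (fmapA (bij_swap S2) (erefl g2) y);
  [side..|idtac].
have [||||||_ ER'] := @contr_step1 _ A _ _ mR out fl w wR _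
  (fmapA (bij_opt2 S1 S2) (erefl (g1 + g2)%N)
  (circA (fmapA (bij_swap S1) (erefl g1) x) (fmapA (bij_swap S2) (erefl g2) y))); [side..|idtac].
have CL := gval_contract okG okL; rewrite EL in CL.
have okG' := okG; rewrite Ex Ey in okG'.
have CR := gval_contract okG' okR; rewrite ER in CR.
move: (congr1 snd EL') (congr1 snd ER'); rewrite [X in X = _ -> _]/= [X in _ -> X = _ -> _]/= => EL2 ER2.
refine (rd_inj oi (perm_refl w) (etrans (esym EL2) (etrans _ ER2))).
refine (etrans (esym (CL _)) (etrans _ (CR _))); [by split_labels; auto| |by split_labels; auto].
by rewrite ?Ex ?Ey.
Qed.
End ContrCirc.

Section CircContr.
Variables (k : fieldType) (A : algebra k) (S1 S2 : finType).
Local Notation car := (car A).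
Let H := (option (option (option S1)) + option S2)%type.

Let I1 (s : option (option (option S1))) : H := inl s.
Let I2 (s : option S2) : H := inr s.

(** A vertex with a loop joined to a second vertex; [flL] keeps the loop and [flR] the joining
    edge. *)
Let fl (h : H) : H := match h with
  | inl None => inl (Some None) | inl (Some None) => inl None
  | inl (Some (Some None)) => inr None | inr None => inl (Some (Some None))
  | _ => h end.

Let flL (h : H) : H := match h with
  | inl None => inl (Some None) | inl (Some None) => inl None
  | _ => h end.

Let flR (h : H) : H := match h with
  | inl (Some (Some None)) => inr None | inr None => inl (Some (Some None))
  | _ => h end.

Let out (s : S1 + S2) : H := match s with
  | inl s => inl (Some (Some (Some s))) | inr s => inr (Some s) end.

Let mL (s : option S1) : H := inl (Some (Some s)).

Let mR (s : option (option (S1 + S2))) : H := match s with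
  | None => inl None | Some None => inl (Some None) | Some (Some s) => out s end.

Lemma circA_contr g1 g2 (x : car (option (option (option S1))) g1) (y : car (option S2) g2) :
    fmapA (bij_id (S1 + S2)%type) (addnAC g1 1 g2) (circA (contrA x) y) =
    contrA (fmapA (bij_optl2 S1 S2) (erefl (g1 + g2)%N)
      (circA (fmapA (bij_rot S1) (erefl g1) x) y)).
Proof.
have oi : injective out by inj_cases.
have imR : injective mR by inj_cases.
have imL : injective mL by inj_cases.
have i1 : injective I1 by inj_cases.
have i2 : injective I2 by inj_cases.
(* The rotation of three points is not an involution, unlike the exchanges in the other axioms, so
   names are read through its inverse to compensate for the rotation of [x]. *)
pose inv := @Bij _ _ _ _ (bijVK (bij_rot S1)) (bijK (bij_rot S1)).
pose I1' := I1 \o inv.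
have i1' : injective I1' by exact: inj_comp i1 (@bij_inj _ _ inv).
set w := map out (en (S1 + S2)).
set w1 := map I1 (en (option (option (option S1)))).
set w2 := map I2 (en (option S2)).
have okG : gok fl w ([::] ++ [:: dv I1 w1 x] ++ [:: dv I2 w2 y]).
  apply: (gok_full (i0 := 0)) => //.
  - move=> h; rewrite /= !mem_cat !mem_map_enum; case: h => s;
    by rewrite ?(codom_f I1) ?(codom_f I2) ?orbT.
  - by rewrite /= !size_cat (size_map I1) (size_map I2) -!cardE addn0 !card_sum.
  - by case=> [[[[]|]|]|[]].
  - move=> h; apply/codomP/eqP => [[[s|s] ->] //|].
    by case: h => [[[[s|]|]|]|[s|]] //= _; [exists (inl s)|exists (inr s)].
  - by rewrite /= !dv_fitting.
  - case=> [|[|//]] //= _ _.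
    exists (I1 (Some (Some None))); rewrite /= /w1 /w2 mem_map_enum;
      [exact: codom_f|exact: (codom_f I2 None)].
pose wL := map mL (en (option S1)).
pose wR := map mR (en (option (option (S1 + S2)))).
have p1' : perm_eq (map I1' (en (option (option (option S1))))) w1.
  exact: (@perm_map_bij _ _ _ I1 inv).
have Ex : dv I1 w1 x = dv I1' w1 (fmapA (bij_rot S1) (erefl g1) x) by apply: dv_fmapA; side.
have [||||||okL EL] := @contr_step1 _ A _ _ I1 mL flL wL w1 _
  x; [side..|idtac].
have [|||||||_ EL'] := @circ_step _ A _ _ _ _ mL I2 out (bij_id _) fl w wL w2 _ _ _
  (addnAC g1 1 g2) (contrA x) y; [side..|idtac].
have [|||||||okR ER] := @circ_step _ A _ _ _ _ I1' I2 mR (bij_optl2 S1 S2) flR wR w1 w2 _ _ _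
  (erefl (g1 + g2)%N) (fmapA (bij_rot S1) (erefl g1) x) y; [side..|idtac].
have [||||||_ ER'] := @contr_step1 _ A _ _ mR out fl w wR _
  (fmapA (bij_optl2 S1 S2) (erefl (g1 + g2)%N)
      (circA (fmapA (bij_rot S1) (erefl g1) x) y)); [side..|idtac].
have CL := gval_contract okG okL; rewrite EL in CL.
have okG' : gok fl w ([::] ++ [:: dv I1' w1 (fmapA (bij_rot S1) (erefl g1) x); dv I2 w2 y] ++ [::]).
  by rewrite -Ex; exact: okG.
have CR := gval_contract okG' okR; rewrite ER in CR.
move: (congr1 snd EL') (congr1 snd ER'); rewrite [X in X = _ -> _]/= [X in _ -> X = _ -> _]/= => EL2 ER2.
refine (rd_inj oi (perm_refl w) (etrans (esym EL2) (etrans _ ER2))).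
refine (etrans (esym (CL _)) (etrans _ (CR _))); [by split_labels; auto| |by split_labels; auto].
by rewrite ?Ex.
Qed.
End CircContr.

Section OperadOf.
Variables (k : fieldType) (A : algebra k).

Definition contrG (S : finType) g : gmap (car A (option (option S)) g) (car A S (g + 1)%N) :=
  GMap (@contrA_linear k A S g) (@contrA_homog k A S g).

Definition operad_of : modular_operad k :=
  @ModularOperad k (operad_fun A) (@circA k A) contrG
    (@circA_linearl k A) (@circA_linearr k A) (@circA_homog k A) (@circA_natural k A)
    (@contrA_natural k A) (@contrA_sym k A) (@circA_sym k A) (@circA_assoc k A)
    (@contrA_contr k A) (@contrA_circ k A) (@circA_contr k A).

End OperadOf.

Section MapPt.
Variables (k : fieldType) (A B : algebra k) (f : forall c, gmap (A c) (B c)).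

Definition fpt (p : pt A) : pt B := mkpt (f (projT1 p) (projT2 p)).

Definition fds (H : finType) (ds : seq (dvert A H)) : seq (dvert B H) :=
  [seq (d.1, fpt d.2) | d <- ds].

Lemma fpt_mkpt c (x : A c) : fpt (mkpt x) = mkpt (f c x).
Proof. by []. Qed.

Lemma fpt0 : fpt pt0 = pt0.
Proof. by rewrite /fpt /= (linear0_ (@gmap_linear _ _ _ (f _))). Qed.

Lemma get_fpt c p : get c (fpt p) = f c (get c p).
Proof.
rewrite /get /=; case: pselect => [e|_]; last by rewrite (linear0_ (@gmap_linear _ _ _ (f _))).
by case: c / e.
Qed.

Lemma fpt_psc a p : fpt (pt_scale a p) = pt_scale a (fpt p).
Proof. by rewrite /fpt /pt_scale /= (linearZ_ (@gmap_linear _ _ _ (f _))). Qed.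

Lemma fpt_homog d p : pthomog d p -> pthomog d (fpt p).
Proof. exact: gmap_homog. Qed.

Lemma nth_fpt (s : seq (pt A)) i : nth pt0 (map fpt s) i = fpt (nth pt0 s i).
Proof.
have [lt|ge] := ltnP i (size s); first exact: nth_map.
by rewrite !nth_default ?size_map ?fpt0.
Qed.

Lemma unzip1_fds (H : finType) (ds : seq (dvert A H)) : unzip1 (fds ds) = unzip1 ds.
Proof. by rewrite /unzip1 /fds -map_comp. Qed.

Lemma unzip2_fds (H : finType) (ds : seq (dvert A H)) : unzip2 (fds ds) = map fpt (unzip2 ds).
Proof. by rewrite /unzip2 /fds -!map_comp. Qed.

Lemma fds_rds (H : finType) T fl lg (ds : seq (dvert A H)) :
  rds T fl lg ds -> rds T fl lg (fds ds).
Proof.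
case=> r fit; split; first by rewrite unzip1_fds /dgs /fds -map_comp.
by rewrite all_map.
Qed.

Lemma fds_ok (H : finType) fl lg (ds : seq (dvert A H)) : gok fl lg ds -> gok fl lg (fds ds).
Proof. by case=> T r; exists T; apply: fds_rds. Qed.

Lemma fpt_gval (H : finType) fl lg (ds : seq (dvert A H)) :
  (forall (T : ggGrc) (a : inputs A T), f (pi0 T) (alpha a) = alpha (fun i => f _ (a i) : B _)) ->
  gok fl lg ds -> fpt (gval fl lg ds) = gval fl lg (fds ds).
Proof.
move=> fa [T r]; rewrite (gvalE r) (gvalE (fds_rds r)) /al fpt_mkpt fa; congr mkpt.
congr alpha; apply: functional_extensionality_dep => i.
by rewrite /inp unzip2_fds nth_fpt get_fpt.
Qed.

End MapPt.

Section OnMor.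
Variables (k : fieldType) (A B : algebra k) (f : algebra_mor A B).

Definition operad_mor : modular_operad_mor (operad_of A) (operad_of B).
Proof.
refine (@ModularOperadMor k (operad_of A) (operad_of B) (fun S g => f (#|S|, g)) _ _ _).
- move=> S S' g g' b e x; change (f (#|S'|, g') (fmapA b e x) = fmapA b e (f (#|S|, g) x)).
  rewrite /fmapA /rd /act -get_fpt (fpt_gval (@amor_alpha _ _ _ f)) //.
  apply: act_ok; last by rewrite size_map /= cardE.
    by apply: uniq_map_enum; exact: bij_inj.
  exact: perm_enum_bij.
- move=> S1 S2 g1 g2 x y; change (f (#|(S1 + S2)%type : finType|, (g1 + g2)%N) (circA x y) =
    circA (f (_, _) x : car B _ _) (f (_, _) y : car B _ _)).
  by rewrite /circA -get_fpt (fpt_gval (@amor_alpha _ _ _ f)) //; exact: cds_ok.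
- move=> S g x; change (f (#|S|, (g + 1)%N) (contrA x) = contrA (f (_, _) x : car B _ _)).
  by rewrite /contrA -get_fpt (fpt_gval (@amor_alpha _ _ _ f)) //; exact: kds_ok.
Defined.
End OnMor.

Definition operad_functor (k : fieldType) : functor (TerminalAlgebras k) (ModularOperads k).
Proof.
refine (@Functor (TerminalAlgebras k) (ModularOperads k) (@operad_of k) (@operad_mor k) _ _).
- by move=> A; apply: modular_operad_morP.
- by move=> A B C f g; apply: modular_operad_morP.
Defined.

Lemma card_color (c : nat * nat) : (#|'I_c.1|, c.2) = c.
Proof. by rewrite card_ord; case: c. Qed.

(** Each color is realized by a standard ordinal, so the components of an algebra morphism occur
    among those of the operad morphism. *)
Lemma operad_functor_faithful (k : fieldType) (A B : algebra k) (f f' : algebra_mor A B) :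
  operad_mor f = operad_mor f' -> f = f'.
Proof.
move=> e; apply: algebra_morP => c; rewrite -(card_color c) => x.
exact: (congr1 (fun h : modular_operad_mor (operad_of A) (operad_of B) => h 'I_c.1 c.2 x) e).
Qed.

(** * Fullness *)

Lemma map_enum_rank (S : finType) : map enum_rank (enum S) = enum 'I_#|S|.
Proof.
have sS : size (map (@enum_rank S) (enum S)) = #|S| by rewrite (size_map (@enum_rank S)) -cardE.
case: (posnP #|S|) => [S0|/card_gt0P[s0 _]].
  by apply: etrans (size0nil _) (esym (size0nil _)); rewrite ?sS // size_enum_ord.
apply: (@eq_from_nth _ (enum_rank s0)); first by rewrite sS size_enum_ord.
move=> i; rewrite sS => iS; rewrite (nth_map s0) -?cardE //.
rewrite (_ : i = Ordinal iS) // nth_ord_enum -[RHS]enum_valK; congr enum_rank.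
by rewrite (enum_val_nth s0).
Qed.

Definition bij_rank (S : finType) : bij S 'I_#|S| := Bij (@enum_rankK S) (@enum_valK S).

Section RankPt.
Variables (k : fieldType) (A : algebra k).

(** Ranking respects the order of [enum], so the corolla that acts is a trivial graph. *)
Lemma mkpt_rank (S : finType) g (x : car A S g) : mkpt (fmapA (bij_rank S) (erefl g) x) = mkpt x.
Proof.
rewrite mkpt_fmapA /rd /= map_enum_rank act_id ?enum_uniq //.
by rewrite size_enum_ord.
Qed.

Lemma rd_surj (S H : finType) (l : S -> H) (w : seq H) g (p : pt A) : injective l ->
  perm_eq (map l (enum S)) w -> projT1 p = (size w, g) -> exists x : car A S g, p = rd l w x.
Proof.
move=> li pw pt; have uw : uniq w by rewrite -(perm_uniq pw) uniq_map_enum.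
have pw' : perm_eq w (map l (enum S)) by rewrite perm_sym.
have p1 : (projT1 p).1 = size w by rewrite pt.
exists (get (#|S|, g) (act w (map l (enum S)) p)).
rewrite /rd mkpt_get; last by rewrite act_tag // pt (size_map l) -cardE.
by rewrite act_act // act_id.
Qed.

End RankPt.

Section MapOfMor.
Variables (k : fieldType) (A B : algebra k) (phi : modular_operad_mor (operad_of A) (operad_of B)).

(** The component of [phi] at the ordinal with [c.1] elements, cast along [card_color]. *)
Definition amap c : gmap (A c) (B c) :=
  eq_rect _ (fun c => gmap (A c) (B c)) (phi 'I_c.1 c.2) c (card_color c).

Lemma cast_gmap c c' (e : c = c') (h : gmap (A c) (B c)) (x : A c) :
  mkpt (eq_rect c (fun c => gmap (A c) (B c)) h c' e (acast e x)) = mkpt (h x).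
Proof. by case: c' / e. Qed.

Local Notation phipt := (fpt amap).
Local Notation ph S g x := (phi S g x : car B S g).

Lemma phipt_mkpt (S : finType) g (x : car A S g) : phipt (mkpt x) = mkpt (ph S g x).
Proof.
have ord_case n (y : car A 'I_n g) : phipt (mkpt y) = mkpt (ph 'I_n g y).
  have -> : mkpt y = mkpt (acast (card_color (n, g)) y) by exact: same_acast.
  exact: (cast_gmap (card_color (n, g)) (phi 'I_n g)).
rewrite -mkpt_rank ord_case -[RHS]mkpt_rank; congr mkpt.
exact: (mmor_natural phi (bij_rank S) (erefl g) x).
Qed.

(** Naturality of [phi] replaces [l] by the numbering of the positions of [w], for which [rd]
    changes nothing. *)
Lemma phipt_rd (S H : finType) (l : S -> H) (w : seq H) g (x : car A S g) : injective l ->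
  perm_eq (map l (enum S)) w -> phipt (rd l w x) = rd l w (ph S g x).
Proof.
move=> li pw; have uw : uniq w by rewrite -(perm_uniq pw) uniq_map_enum.
pose l' : 'I_(size w) -> H := tnth (in_tuple w).
have l'E : map l' (enum 'I_(size w)) = w by exact: map_tnth_enum.
have l'i : injective l' by apply/injectiveP; rewrite /injectiveb /dinjectiveb l'E.
have [|b lb] := same_labels_bij li l'i.
  by move=> h; rewrite -!mem_map_enum l'E (perm_mem pw).
have pl' : perm_eq (map l' (enum 'I_(size w))) w by rewrite l'E.
rewrite -(eq_rd _ _ lb) -(eq_rd _ _ lb).
rewrite -(rd_fmapA b (erefl g) x l'i pl') -(rd_fmapA b (erefl g) (ph S g x) l'i pl').
have self (C : algebra k) (y : car C 'I_(size w) g) : rd l' w y = mkpt y.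
  by rewrite -[RHS](rd_self y l'i) l'E.
rewrite !self phipt_mkpt; congr mkpt.
exact: (mmor_natural phi b (erefl g) x).
Qed.

End MapOfMor.

Definition ksgn (k : fieldType) n (Is : seq nat) (d : nat -> int) : k :=
  \prod_(p : 'I_n * 'I_n | (p.1 < p.2)%N && (index (p.2 : nat) Is < index (p.1 : nat) Is)%N)
    (-1) ^+ absz (d p.1 * d p.2).

Section Perm.
Variables (k : fieldType) (A : algebra k).

Lemma gval_perm (H : finType) (fl : H -> H) lg (ds : seq (dvert A H)) (Is : seq nat) d :
  gok fl lg ds -> perm_eq Is (iota 0 (size ds)) ->
  (forall i, pthomog (d i) (nth pt0 (unzip2 ds) i)) ->
  gok fl lg [seq nth (dv0 A H) ds i | i <- Is] /\
  gval fl lg ds = pt_scale (ksgn k (size ds) Is d) (gval fl lg [seq nth (dv0 A H) ds i | i <- Is]).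
Proof.
move=> [T r] pI dh; have [S [f [rS fp E]]] := law_perm r pI.
split; first by exists S.
rewrite (gvalE r) (gvalE rS) (E (fun u => d u)) => [|u]; last exact: dh.
congr pt_scale; rewrite (rds_size r) /ksgn /koszul.
by apply: eq_bigl => p; rewrite !fp.
Qed.

Definition homog_pt (p : pt A) : Prop := exists d, pthomog d p.
(** All positions are allowed, as beyond the end the default [pt0] is zero and hence homogeneous. *)
Definition homog_ds (H : finType) (ds : seq (dvert A H)) : Prop :=
  forall i, homog_pt (nth pt0 (unzip2 ds) i).

Lemma homog_pt0 : homog_pt pt0.
Proof. by exists 0; exact: homog0. Qed.

Lemma homog_ds_cons (H : finType) (d : dvert A H) ds : homog_pt d.2 -> homog_ds ds -> homog_ds (d :: ds).
Proof. by move=> hd h [|i] //=; apply: h. Qed.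

Lemma homog_ds_cat (H : finType) (ds1 ds2 : seq (dvert A H)) :
  homog_ds ds1 -> homog_ds ds2 -> homog_ds (ds1 ++ ds2).
Proof.
by move=> h1 h2 i; rewrite /unzip2 map_cat nth_cat; case: ifP => _; [apply: h1|apply: h2].
Qed.

Lemma homog_ds_catl (H : finType) (ds1 ds2 : seq (dvert A H)) : homog_ds (ds1 ++ ds2) -> homog_ds ds1.
Proof.
move=> h i; have := h i; rewrite /unzip2 map_cat nth_cat; case: ltnP => // ge _.
by rewrite nth_default //; exact: homog_pt0.
Qed.

Lemma homog_ds_catr (H : finType) (ds1 ds2 : seq (dvert A H)) : homog_ds (ds1 ++ ds2) -> homog_ds ds2.
Proof.
move=> h i; have := h (size ds1 + i)%N; rewrite /unzip2 map_cat nth_cat size_map.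
by rewrite ltnNge leq_addr /= addKn.
Qed.

Lemma homog_ds_perm (H : finType) (ds : seq (dvert A H)) (Is : seq nat) :
  homog_ds ds -> homog_ds [seq nth (dv0 A H) ds i | i <- Is].
Proof.
move=> h; elim: Is => [|i Is IH]; first by move=> i; rewrite nth_nil; exact: homog_pt0.
apply: homog_ds_cons IH; have := h i; have [lt|ge] := ltnP i (size ds).
  by rewrite /unzip2 (nth_map (dv0 A H)).
by move=> _; rewrite nth_default //; exact: homog_pt0.
Qed.

Lemma gval_hpt (H : finType) (fl : H -> H) lg (ds : seq (dvert A H)) :
  gok fl lg ds -> homog_ds ds -> homog_pt (gval fl lg ds).
Proof.
move=> okd h; exists (\sum_(i < size ds) sval (cid (h i))).
apply: (gval_homog (d := fun i => sval (cid (h i)))) => // i _.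
exact: svalP (cid (h i)).
Qed.

(** The involution of a block in which only the edge formed by [h] and [h'] survives. *)
Definition transp (H : finType) (h h' x : H) : H :=
  if x == h then h' else if x == h' then h else x.

Lemma gok_no_edge (H : finType) (fl : H -> H) lg (ds : seq (dvert A H)) : gok fl lg ds ->
  (forall h, h \in flatten (unzip1 ds) -> fl h = h) -> size ds = 1%N.
Proof.
case=> T r fx; rewrite (rds_size r); case: r => [[l rl] _].
have n0 : (0 < nv T)%N by case/andP: (graph_connected T).
have e0 : ne T = 0%N.
  apply: ne_flip => i; have mE := reads_mem rl; case: rl => li lf _ _ _.
  by apply: li; rewrite lf fx //; apply/mE; exists i.
by have := connected_nv_le T; rewrite e0; case: (nv T) n0 => [|[|]].
Qed.

Lemma gok_corolla (H : finType) (fl : H -> H) lg w (p : pt A) : gok fl lg [:: (w, p)] ->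
  (forall h, h \in w -> fl h = h) ->
  [/\ uniq w, perm_eq w lg, (projT1 p).1 = size w & gval fl lg [:: (w, p)] = act w lg p].
Proof.
move=> okd fx; have [T [/reads_rwf[+ _ ulg lgE _] fit]] := okd.
rewrite /= cats0 => uw; split=> //.
- apply: uniq_perm => // h; rewrite lgE /= cats0.
  by case: (boolP (h \in w)) => //= /fx ->; rewrite eqxx.
- by move: fit; rewrite /= andbT /fitting => /eqP.
by apply/esym; apply: (proj2 (gval_ext _ okd)) => h; rewrite /= cats0 => /fx.
Qed.

End Perm.

Section Edges.
Variables (k : fieldType) (A B : algebra k) (phi : modular_operad_mor (operad_of A) (operad_of B)).
Local Notation phipt := (fpt (amap phi)).
Local Notation phids := (fds (amap phi)).
Local Notation ph S g x := (phi S g x : car B S g).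

Lemma phipt_act (H : finType) (w w' : seq H) (p : pt A) : uniq w -> perm_eq w w' ->
  (projT1 p).1 = size w -> phipt (act w w' p) = act w w' (phipt p).
Proof.
move=> uw pw pt.
pose l : 'I_(size w) -> H := tnth (in_tuple w).
have lE : map l (enum 'I_(size w)) = w by exact: map_tnth_enum.
have li : injective l by apply/injectiveP; rewrite /injectiveb /dinjectiveb lE.
have pl : perm_eq (map l (enum 'I_(size w))) w by rewrite lE.
have tp : projT1 p = (size w, (projT1 p).2) by rewrite -pt -surjective_pairing.
have [x ->] := rd_surj li pl tp; have plw := perm_trans pl pw.
by rewrite (act_rd _ li pl pw) !phipt_rd // (act_rd _ li pl pw).
Qed.

Lemma phi_loop (H : finType) (w : seq H) h h' (p : pt A) : uniq w -> h \in w -> h' \in w -> h != h' ->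
  (projT1 p).1 = size w ->
  exists w', [/\ gok (transp h h') w' [:: (w, p)],
    phipt (gval (transp h h') w' [:: (w, p)]) = gval (transp h h') w' [:: (w, phipt p)] &
    size w = (size w').+2].
Proof.
move=> uw hw h'w hh' pt.
pose S : finType := {x : H | [&& x \in w, x != h & x != h']}.
pose l (s : option (option S)) : H :=
  match s with None => h | Some None => h' | Some (Some s) => val s end.
have li : injective l.
  move=> [[[x /= px]|]|] [[[y /= py]|]|] //= e.
  - by congr (Some (Some _)); apply: val_inj.
  - by exfalso; have := px; rewrite e eqxx !andbF.
  - by exfalso; have := px; rewrite e eqxx andbF.
  - by exfalso; have := py; rewrite -e eqxx !andbF.
  - by rewrite e eqxx in hh'.
  - by exfalso; have := py; rewrite -e eqxx andbF.
  - by rewrite e eqxx in hh'.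
have pl : perm_eq (map l (en (option (option S)))) w.
  apply: uniq_perm => //; first exact: uniq_map_enum.
  move=> x; rewrite mem_map_enum; apply/codomP/idP => [[[[[y /= /and3P[yw _ _]]|]|] ->]|xw] //.
  have [->|xh] := eqVneq x h; first by exists None.
  have [->|xh'] := eqVneq x h'; first by exists (Some None).
  have px : [&& x \in w, x != h & x != h'] by rewrite xw xh xh'.
  by exists (Some (Some (exist _ x px : S))).
have tp : projT1 p = (size w, (projT1 p).2) by rewrite -pt -surjective_pairing.
have [x ->] := rd_surj li pl tp.
have flE s : transp h h' (l s) = l (kfl s).
  rewrite /transp; case: s => [[[y /= /and3P[_ /negbTE -> /negbTE ->]]|]|] //=.
    by rewrite eqxx; case: eqP => // ->.
  by rewrite eqxx.
exists (map (l \o ksome (S:=S)) (enum S)).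
have [okA EA] := contr_char x li flE (perm_refl _) pl.
have [okB EB] := contr_char (ph _ _ x) li flE (perm_refl _) pl.
have lki : injective (l \o ksome (S:=S)) by apply: inj_comp li (@ksome_inj S).
split=> //.
  rewrite EA phipt_rd // (phipt_rd phi x li pl) EB.
  by congr rd; exact: (mmor_contr phi x).
by rewrite -(perm_size pl) 2!size_map -!cardE !card_option.
Qed.

Lemma phi_edge (H : finType) (w1 w2 : seq H) h h' (p1 p2 : pt A) :
  uniq (w1 ++ w2) -> h \in w1 -> h' \in w2 ->
  (projT1 p1).1 = size w1 -> (projT1 p2).1 = size w2 ->
  exists w', [/\ gok (transp h h') w' [:: (w1, p1); (w2, p2)],
    phipt (gval (transp h h') w' [:: (w1, p1); (w2, p2)]) =
      gval (transp h h') w' [:: (w1, phipt p1); (w2, phipt p2)] &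
    (size w1 + size w2 = (size w').+2)%N].
Proof.
rewrite cat_uniq => /and3P[u1 dj u2] hw h'w pt1 pt2.
have djx x y : x \in w1 -> y \in w2 -> x != y.
  move=> x1 y2; apply/eqP => e; case/negP: dj; apply/hasP; exists y => //; by rewrite -e.
have {dj} hh' := djx _ _ hw h'w.
pose S1 : finType := {x : H | (x \in w1) && (x != h)}.
pose S2 : finType := {x : H | (x \in w2) && (x != h')}.
pose l1 (s : option S1) : H := if s is Some s then val s else h.
pose l2 (s : option S2) : H := if s is Some s then val s else h'.
have l1i : injective l1.
  move=> [[x /= px]|] [[y /= py]|] //= e.
  - by congr Some; apply: val_inj.
  - by exfalso; have := px; rewrite e eqxx andbF.
  - by exfalso; have := py; rewrite -e eqxx andbF.
have l2i : injective l2.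
  move=> [[x /= px]|] [[y /= py]|] //= e.
  - by congr Some; apply: val_inj.
  - by exfalso; have := px; rewrite e eqxx andbF.
  - by exfalso; have := py; rewrite -e eqxx andbF.
have l1w s : l1 s \in w1 by case: s => [[x /= /andP[? _]]|].
have l2w s : l2 s \in w2 by case: s => [[x /= /andP[? _]]|].
have J : injective (lsum l1 l2).
  by apply: lsum_inj => // s t e; have := djx _ _ (l1w s) (l2w t); rewrite e eqxx.
have pl1 : perm_eq (map l1 (en (option S1))) w1.
  apply: uniq_perm => //; first exact: uniq_map_enum.
  move=> x; rewrite mem_map_enum; apply/codomP/idP => [[s ->] //|xw].
  have [->|xh] := eqVneq x h; first by exists None.
  have px : (x \in w1) && (x != h) by rewrite xw xh.
  by exists (Some (exist _ x px : S1)).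
have pl2 : perm_eq (map l2 (en (option S2))) w2.
  apply: uniq_perm => //; first exact: uniq_map_enum.
  move=> x; rewrite mem_map_enum; apply/codomP/idP => [[s ->] //|xw].
  have [->|xh] := eqVneq x h'; first by exists None.
  have px : (x \in w2) && (x != h') by rewrite xw xh.
  by exists (Some (exist _ x px : S2)).
have tp1 : projT1 p1 = (size w1, (projT1 p1).2) by rewrite -pt1 -surjective_pairing.
have tp2 : projT1 p2 = (size w2, (projT1 p2).2) by rewrite -pt2 -surjective_pairing.
have [x ->] := rd_surj l1i pl1 tp1; have [y ->] := rd_surj l2i pl2 tp2.
have flE s : transp h h' (lsum l1 l2 s) = lsum l1 l2 (cfl s).
  rewrite /transp; case: s => [[[z pz]|]|[[z pz]|]] /=.
  - by have /andP[z1 /negbTE ->] := pz; rewrite (negbTE (djx _ _ z1 h'w)).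
  - by rewrite eqxx.
  - have /andP[z2 /negbTE ->] := pz; case: eqVneq => // e.
    by have := djx _ _ hw z2; rewrite e eqxx.
  - by rewrite eqxx; case: eqVneq => // e; rewrite e eqxx in hh'.
exists (map (lsum l1 l2 \o csum (S1:=S1) (S2:=S2)) (en (S1 + S2))).
have [okA EA] := circ_char x y J flE (perm_refl _) pl1 pl2.
have [okB EB] := circ_char (ph _ _ x) (ph _ _ y) J flE (perm_refl _) pl1 pl2.
have lki : injective (lsum l1 l2 \o csum (S1:=S1) (S2:=S2)) by apply: inj_comp J (@csum_inj S1 S2).
split=> //.
  rewrite EA phipt_rd // (phipt_rd phi x l1i pl1) (phipt_rd phi y l2i pl2) EB.
  by congr rd; exact: (mmor_circ phi x y).
rewrite -(perm_size pl1) -(perm_size pl2) (size_map l1) (size_map l2) (size_map (lsum l1 l2 \o _)) -!cardE.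
by rewrite !card_option card_sum addSn addnS.
Qed.

End Edges.

Lemma lt_merge a b c w m : (a + b = w.+2)%N -> (a + (b + c) < m.+1)%N -> (w + c < m)%N.
Proof. lia. Qed.

Lemma lt_loop a b c w m : b = w.+2 -> (a + (b + c) < m.+1)%N -> (a + (w + c) < m)%N.
Proof. lia. Qed.

Section Full.
Variables (k : fieldType) (A B : algebra k) (phi : modular_operad_mor (operad_of A) (operad_of B)).
Local Notation phipt := (fpt (amap phi)).
Local Notation phids := (fds (amap phi)).

Lemma flat_cat (H : finType) (ds1 ds2 : seq (dvert A H)) :
  size (flatten (unzip1 (ds1 ++ ds2))) =
  (size (flatten (unzip1 ds1)) + size (flatten (unzip1 ds2)))%N.
Proof. by rewrite /unzip1 map_cat flatten_cat size_cat. Qed.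

Lemma flat_cons (H : finType) (d : dvert A H) ds :
  size (flatten (unzip1 (d :: ds))) = (size d.1 + size (flatten (unzip1 ds)))%N.
Proof. by rewrite /= size_cat. Qed.

Lemma flpE (H : finType) (fl : H -> H) h h' : fl h = h' -> fl h' = h ->
  forall x, transp h h' x = x \/ transp h h' x = fl x.
Proof.
by move=> e e' x; rewrite /transp; case: eqVneq => [->|_]; [right|case: eqVneq => [->|_]; [right|left]].
Qed.

Lemma phi_block (H : finType) (fl flF : H -> H) lg w (ds1 dsF ds2 : seq (dvert A H)) :
  gok fl lg (ds1 ++ dsF ++ ds2) -> gok flF w dsF ->
  (forall h, flF h = h \/ flF h = fl h) ->
  phipt (gval flF w dsF) = gval flF w (phids dsF) ->
  (gok fl lg (ds1 ++ (w, gval flF w dsF) :: ds2) ->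
   phipt (gval fl lg (ds1 ++ (w, gval flF w dsF) :: ds2)) =
   gval fl lg (phids (ds1 ++ (w, gval flF w dsF) :: ds2))) ->
  phipt (gval fl lg (ds1 ++ dsF ++ ds2)) = gval fl lg (phids (ds1 ++ dsF ++ ds2)).
Proof.
move=> okd okF flFE phiF IH.
have [|okS ES] := gval_sub okd okF.
  move=> h hF; case: ifP => [/(legs_fixed okF) //|hw].
  case: (flFE h) => // fh; case: okF => T [/reads_rwf[_ _ _ lgP _] _].
  by rewrite lgP hF fh eqxx in hw.
rewrite ES (IH okS) /fds !map_cat /= phiF.
apply/esym; apply: gval_contract (fds_ok (amap phi) okF) flFE.
by have := fds_ok (amap phi) okd; rewrite /fds !map_cat.
Qed.

Lemma phi_gval (H : finType) (fl : H -> H) lg (ds : seq (dvert A H)) :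
  gok fl lg ds -> homog_ds ds -> phipt (gval fl lg ds) = gval fl lg (phids ds).
Proof.
have [m] := ubnP (size (flatten (unzip1 ds))).
elim: m ds => // m IHm ds sz okd hd.
have [uf flP _ _ _] : rwf fl lg (unzip1 ds) (dgs ds).
  by case: okd => T [/reads_rwf].
have fit : all (@fitting _ A H) ds by case: okd => T [].
(* An edge shows up as a half-edge moved by [fl]. Without one the graph is a corolla, and naturality
   of [phi] suffices. *)
have [/hasP[h hds_ hfl]|/hasPn fx] := boolP (has (fun h => fl h != h) (flatten (unzip1 ds))); last first.
  have fx' h : h \in flatten (unzip1 ds) -> fl h = h by move=> /fx; rewrite negbK => /eqP.
  have s1 := gok_no_edge okd fx'.
  case: ds {IHm sz hd uf flP fit fx} okd fx' s1 => [|[w p] [|]] // okd fx' _.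
  rewrite /= cats0 in fx'; have [uw pw pt ->] := gok_corolla okd fx'.
  have [_ _ _ E] := gok_corolla (fds_ok (amap phi) okd) fx'.
  by rewrite [RHS]E; apply: phipt_act.
have [fhd ffh] := flP _ hds_.
set h' := fl h in fhd ffh hfl *.
have fitP i : (i < size ds)%N ->
    (projT1 (nth (dv0 A H) ds i).2).1 = size (nth (dv0 A H) ds i).1.
  by move=> id; have /eqP := all_nthP (dv0 A H) fit i id.
have nth1 i : nth [::] (unzip1 ds) i = (nth (dv0 A H) ds i).1.
  have [id|di] := ltnP i (size ds); first by rewrite /unzip1 (nth_map (dv0 A H)).
  by rewrite !nth_default // size_map.
have vlt x : x \in flatten (unzip1 ds) -> (vidx (unzip1 ds) x < size ds)%N.
  by move=> /vidx_lt; rewrite size_map.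
set i := vidx (unzip1 ds) h; set j := vidx (unzip1 ds) h'.
have il : (i < size ds)%N by exact: vlt.
have jl : (j < size ds)%N by exact: vlt.
have hi : h \in (nth (dv0 A H) ds i).1 by rewrite -nth1; exact: nth_vidx.
have hj : h' \in (nth (dv0 A H) ds j).1 by rewrite -nth1; exact: nth_vidx.
have flE := @flpE H fl h h' erefl ffh.
(* A loop sits at a single vertex, which can be collapsed where it stands. *)
have [ij|ij] := eqVneq i j.
  have dsE : ds = take i ds ++ [:: nth (dv0 A H) ds i] ++ drop i.+1 ds.
    by rewrite /= -drop_nth // cat_take_drop.
  move: hi hj (fitP i il); rewrite -ij; case: (nth _ _ _) dsE => w p dsE hi hj pt /=.
  have uw : uniq w.
    by move: uf; rewrite dsE /unzip1 map_cat flatten_cat /= !cat_uniq => /and3P[_ _ /andP[]].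
  have hh' : h != h' by rewrite eq_sym.
  have [w' [okF EF sw]] := phi_loop phi uw hi hj hh' pt.
  have okd' := okd; have hd' := hd; rewrite dsE in okd' hd'; rewrite dsE.
  apply: (phi_block okd' okF flE EF) => okS; apply: IHm => //.
    by move: sz; rewrite [in X in X -> _]dsE !(flat_cat, flat_cons) /= ?addn0; apply: lt_loop sw.
  apply: homog_ds_cat; first exact: homog_ds_catl hd'.
  apply: homog_ds_cons; last exact: homog_ds_catr (homog_ds_catr hd').
  apply: (gval_hpt okF); exact: homog_ds_catl (homog_ds_catr hd').
(* The ends of a joining edge have to become consecutive before the block can be collapsed, and this
   renumbering is where signs enter. *)
pose Is := i :: j :: [seq u <- iota 0 (size ds) | (u != i) && (u != j)].
have pI : perm_eq Is (iota 0 (size ds)).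
  apply: uniq_perm; rewrite ?iota_uniq //=.
    by rewrite inE negb_or ij !mem_filter !eqxx /= andbF filter_uniq ?iota_uniq.
  move=> u; rewrite !inE mem_filter mem_iota add0n /=.
  case: eqVneq => [->|_] /=; first by rewrite il.
  by case: eqVneq => [->|_] //=; rewrite jl.
pose d n := sval (cid (hd n)).
have dP n : pthomog (d n) (nth pt0 (unzip2 ds) n) by exact: svalP (cid (hd n)).
have dP' n : pthomog (d n) (nth pt0 (unzip2 (phids ds)) n).
  by rewrite unzip2_fds nth_fpt; apply: fpt_homog.
have pI' : perm_eq Is (iota 0 (size (phids ds))) by rewrite size_map.
have [okp E] := gval_perm okd pI dP.
(* The maps [amap phi] preserve degrees, so the same [d] gives the same sign in [B]. *)
have [_ E'] := gval_perm (fds_ok (amap phi) okd) pI' dP'.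
rewrite E E' fpt_psc size_map; congr pt_scale.
have -> : [seq nth (dv0 B H) (phids ds) u | u <- Is] = phids [seq nth (dv0 A H) ds u | u <- Is].
  rewrite /fds -map_comp; apply/eq_in_map => u; rewrite (perm_mem pI) mem_iota /= => ul.
  by rewrite (nth_map (dv0 A H)).
set ds' := [seq nth (dv0 A H) ds u | u <- Is] in okp *.
have pds : perm_eq (flatten (unzip1 ds')) (flatten (unzip1 ds)).
  apply: perm_flatten; rewrite /unzip1 /ds' -map_comp.
  rewrite (@eq_map _ _ _ (fun u => nth [::] (unzip1 ds) u)); last by move=> u; rewrite /= nth1.
  have := perm_map (nth [::] (unzip1 ds)) pI; rewrite -(size_map fst ds).
  by rewrite -[X in perm_eq _ X]/(mkseq (nth [::] (unzip1 ds)) (size (unzip1 ds))) mkseq_nth.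
have hd' : homog_ds ds' by exact: homog_ds_perm.
have sz' : (size (flatten (unzip1 ds')) < m.+1)%N by rewrite (perm_size pds).
have u' : uniq (flatten (unzip1 ds')) by rewrite (perm_uniq pds).
move: okp hd' sz' u'; rewrite /ds' /=; set rest := [seq _ | u <- _].
move: hi hj (fitP i il) (fitP j jl).
case: (nth _ ds i) => w1 p1; case: (nth _ ds j) => w2 p2 /= hi hj pt1 pt2 okp hd' sz' u'.
have uw : uniq (w1 ++ w2) by move: u'; rewrite catA cat_uniq => /and3P[].
have [w' [okF EF sw]] := phi_edge phi uw hi hj pt1 pt2.
apply: (@phi_block H fl (transp h h') lg w' [::] [:: (w1, p1); (w2, p2)] rest okp okF flE EF) => okS.
apply: IHm => //.
  by move: sz'; rewrite /= !size_cat; apply: lt_merge.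
apply: homog_ds_cons; last exact: (@homog_ds_catr _ _ _ [:: (w1, p1); (w2, p2)]).
apply: (gval_hpt okF); exact: (@homog_ds_catl _ _ _ [:: (w1, p1); (w2, p2)] rest).
Qed.

Lemma rds_graph (C : algebra k) (T : ggGrc) (a : inputs C T) :
  rds T (@flip T) (legs T) [seq (local_flags v, mkpt (a v)) | v <- enum 'I_(nv T)] /\
  alpha a = alpha (inp T (unzip2 [seq (local_flags v, mkpt (a v)) | v <- enum 'I_(nv T)])).
Proof.
split.
  split.
    exists id; split=> //.
    - by rewrite map_id.
    - by rewrite /unzip1 -map_comp; apply: eq_map => v; rewrite /= map_id.
    - rewrite /dgs -map_comp; apply: eq_map => v /=.
      exact: (congr1 snd (pi0_source v)).
  apply/allP => d /mapP[v _ ->]; rewrite /fitting; apply/eqP.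
  by rewrite size_local_flags.
congr alpha; apply: functional_extensionality_dep => v.
by rewrite /inp /unzip2 -map_comp nth_map_ord getK.
Qed.

(** Both sides are multilinear, which removes the homogeneity assumption of [phi_gval]; the graph is
    read with its own half-edges as names. *)
Lemma amap_alpha (T : ggGrc) (a : inputs A T) :
  amap phi (pi0 T) (alpha a) = alpha (fun i => amap phi _ (a i) : B _).
Proof.
pose F (a : inputs A T) := amap phi (pi0 T) (alpha a).
pose G (a : inputs A T) := alpha (fun i => amap phi _ (a i) : B _).
apply: (@multilinear_ext k _ _ _ F G) => {a}.
- by move=> a i c x y; rewrite /F alpha_linear gmap_linear.
- move=> a i c x y; rewrite /G.
  have E z : (fun j => amap phi _ (dfwith a z j) : B _) =
      dfwith (fun j => amap phi _ (a j) : B _) (amap phi _ z : B (pi0 (source i))).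
    apply: functional_extensionality_dep => j.
    have [->|ji] := eqVneq j i; first by rewrite !dfwith_in.
    by rewrite !dfwith_out // eq_sym.
  by rewrite !E gmap_linear alpha_linear.
move=> a d ad; apply: mkpt_inj; rewrite /F /G -fpt_mkpt.
have [r E] := rds_graph a; have [rB EB] := rds_graph (fun i => amap phi _ (a i) : B _).
rewrite EB E -[X in fpt _ X]/(al T _) -[RHS]/(al T _) -(gvalE r) -(gvalE rB).
rewrite phi_gval //; last 2 first.
- by exists T.
- move=> u; rewrite /unzip2 -map_comp; have [ul|lu] := ltnP u (nv T).
    by rewrite -[u]/(nat_of_ord (Ordinal ul)) nth_map_ord; exists (d (Ordinal ul)); exact: ad.
  rewrite nth_default; first exact: homog_pt0.
  by rewrite (size_map (fun v => _)) size_enum_ord.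
by rewrite /fds -map_comp.
Qed.

Definition amor_of : algebra_mor A B := @AlgebraMor k A B (amap phi) amap_alpha.

Lemma operad_functor_full : operad_mor amor_of = phi.
Proof.
apply: modular_operad_morP => S g x; apply: (@mkpt_inj _ B).
exact: phipt_mkpt.
Qed.
End Full.

(** * Values in the algebra of an operad as packed elements *)

Section Value.
Variables (k : fieldType) (M : modular_operad k) (H : finType) (h0 : H).
Local Notation G := (mo_algebra M).

(** Links the two ways of carrying labels: an element with a color, whose inputs are numbered,
    becomes a packed element with the entries of [w] as labels. The label [h0] is only the default
    of [nth]. *)
Definition wpacked (w : seq H) (p : pt G) : packed M H :=
  pk (fun i : 'I_(projT1 p).1 => nth h0 w i) (projT2 p : mspace M 'I_(projT1 p).1 (projT1 p).2).

(** Any tree may be used, so graphs with at most one edge are evaluated with trees having at most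
    one node above the leaves. *)
Lemma wpacked_alR (T : ggGrc) (l : 'I_(nh T) -> H) fl lg (ds : seq (dvert G H)) (d : nat -> int) t :
  reads_by fl lg (unzip1 ds) (dgs ds) l -> all (@fitting _ G H) ds ->
  (forall i, pthomog (d i) (nth pt0 (unzip2 ds) i)) ->
  wf (@att T) (@flip T) t -> tV t = setT -> tL (@att T) t = [set h | flip h == h] ->
  wpacked lg (gval fl lg ds) =
  prelabel l (pv (dpar (fun u : 'I_(nv T) => d u)) (decorate (inp T (unzip2 ds))) t).
Proof.
move=> rl fit dh w tVT tLT; rewrite (gvalE (conj (ex_intro _ l rl) fit)).
have ad (i : 'I_(nv T)) : homog (d i) (inp T (unzip2 ds) i) by exact: get_homog.
rewrite /wpacked /al /=; change (@alpha k G) with (@galpha k M); rewrite (galphaE ad).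
have [li _ -> _ _] := rl; rewrite -(pk_talpha ad w tVT tLT) prelabel_pk //; last exact: leg_label_inj.
apply: pk_label_ext => i; rewrite (nth_map (leg_label i)); last exact: ltn_ord.
by rewrite /= -leg_labelE.
Qed.

Lemma wpacked_decorate (T : ggGrc) (l : 'I_(nh T) -> H) fl lg (ds : seq (dvert G H)) (v : 'I_(nv T)) :
  reads_by fl lg (unzip1 ds) (dgs ds) l -> all (@fitting _ G H) ds ->
  prelabel l (pack (decorate (inp T (unzip2 ds)) v)) =
  wpacked (nth [::] (unzip1 ds) v) (nth pt0 (unzip2 ds) v).
Proof.
move=> rl fit; have gT := rds_good (conj (ex_intro _ l rl) fit).
have [li _ _ _ _] := rl; have [-> _] := reads_nth v rl.
rewrite pack_decorate prelabel_pk //; last exact: source_label_inj.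
rewrite -(inp_same v gT) /wpacked; apply: pk_label_ext => i /=.
by rewrite (nth_map (source_label i)) ?size_local_flags // -source_labelE.
Qed.

Lemma wpacked_act (w w' : seq H) (p : pt G) : uniq w -> perm_eq w w' ->
  (projT1 p).1 = size w -> homog_pt p -> wpacked w' (act w w' p) = wpacked w p.
Proof.
move=> uw pw pt [d pd]; have [T r] := act_ok uw pw pt.
have n1 : nv T = 1%N by rewrite -(rds_size r).
have T0 : (0 < nv T)%N by rewrite n1.
pose v0 := Ordinal T0; have vE v : v = v0 by apply: ord_eq1.
case: (r) => -[l rl] fit.
have fx (h : 'I_(nh T)) : flip h = h by case: rl => li lf _ _ _; apply: li; rewrite lf.
have dh i : pthomog d (nth pt0 (unzip2 [:: (w, p)]) i).
  by case: i => [|i] //=; rewrite nth_nil; exact: homog0.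
rewrite /act (wpacked_alR (d := fun=> d) (t := Leaf v0) rl fit) //.
- exact: (wpacked_decorate v0 rl fit).
- by apply/setP => v; rewrite !inE [v]vE eqxx.
- by apply/setP => h; rewrite !inE fx [att h]vE !eqxx.
Qed.

Lemma wpacked_circ fl lg (w1 w2 : seq H) (p1 p2 : pt G) h h' : gok fl lg [:: (w1, p1); (w2, p2)] ->
  h \in w1 -> h' \in w2 -> fl h = h' ->
  (forall x, x \in w1 ++ w2 -> x != h -> x != h' -> fl x = x) ->
  homog_pt p1 -> homog_pt p2 ->
  wpacked lg (gval fl lg [:: (w1, p1); (w2, p2)]) = pcirc h h' (wpacked w1 p1) (wpacked w2 p2).
Proof.
move=> [T r] h1 h2 fh fx [d1 pd1] [d2 pd2].
have n2 : nv T = 2%N by rewrite -(rds_size r).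
have T0 : (0 < nv T)%N by rewrite n2.
have T1 : (1 < nv T)%N by rewrite n2.
pose v0 := Ordinal T0; pose v1 := Ordinal T1.
have vE v : v = v0 \/ v = v1.
  case: v => -[|[|v]] lv; [left; exact: val_inj|right; exact: val_inj|].
  by exfalso; have := lv; rewrite n2.
have v01 : v0 != v1 by [].
case: (r) => -[l rl] fit.
have [uf _ _ _ _] := reads_rwf (ex_intro _ l rl).
have mE := reads_mem rl; have [li lf _ _ _] := rl.
have attE x v : l x \in nth [::] (unzip1 [:: (w1, p1); (w2, p2)]) (nat_of_ord v) -> att x = v.
  by move=> xv; apply: ord_inj; rewrite (reads_att _ rl); apply: vidx_eq.
have [i iE] : exists i, h = l i by apply/mE; rewrite /= mem_cat h1.
have [i' iE'] : exists i', h' = l i' by apply/mE; rewrite /= !mem_cat h2 orbT.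
have ai : att i = v0 by apply: attE; rewrite -iE.
have ai' : att i' = v1 by apply: attE; rewrite -iE'.
have fi : flip i = i' by apply: li; rewrite lf -iE fh.
have dh u : pthomog (nth 0 [:: d1; d2] u) (nth pt0 (unzip2 [:: (w1, p1); (w2, p2)]) u).
  by case: u => [|[|u]] //=; rewrite !nth_nil; exact: homog0.
rewrite (wpacked_alR (d := nth 0 [:: d1; d2]) (t := Circ i i' (Leaf v0) (Leaf v1)) rl fit) //.
(* The leaf [v0] precedes [v1], so the shuffle is trivial and no sign appears. *)
- rewrite /pv /= (_ : sg _ _ _ = false) ?expr0 ?scale1r; last first.
    by rewrite /sg big_set1 big1 // => v; rewrite inE => /andP[/eqP ->].
  rewrite -[pack _]/(pcirc i i' (pack (decorate (inp T [:: p1; p2]) v0))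
    (pack (decorate (inp T [:: p1; p2]) v1))).
  rewrite prelabel_pcirc //.
  + by rewrite (wpacked_decorate v0 rl fit) (wpacked_decorate v1 rl fit) -iE -iE'.
  + by rewrite /= inE ai.
  + by rewrite /= inE ai'.
  + apply/pred0P => x /=; rewrite !inE; apply/negP => /andP[/eqP -> /eqP e].
    by rewrite e eqxx in v01.
- rewrite /= !inE fi ai ai' !eqxx /=.
  by apply/pred0P => x /=; rewrite !inE; apply/negP => /andP[/eqP -> /eqP e]; rewrite e eqxx in v01.
- by apply/setP => v; rewrite /= !inE; have [->|->] := vE v; rewrite eqxx ?orbT.
- have ii' : i != i' by apply/eqP => e; move: v01; rewrite -ai -ai' e eqxx.
  have i'i : i' != i by rewrite eq_sym.
  have fi' : flip i' = i by rewrite -fi flipK.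
  apply/setP => x; rewrite /= !inE.
  have [->|xi] := eqVneq x i; first by rewrite fi ai (negbTE v01) (negbTE i'i) andbF.
  have [->|xi'] := eqVneq x i'.
    by rewrite fi' ai' eq_sym (negbTE v01) (negbTE ii') orbF.
  have -> : flip x == x.
    apply/eqP/li; rewrite lf; apply: fx; rewrite ?iE ?iE' ?(inj_eq li) //.
    have : l x \in flatten (unzip1 [:: (w1, p1); (w2, p2)]) by apply/mE; exists x.
    by rewrite /= cats0.
  by have [->|->] := vE (att x); rewrite eqxx ?orbT.
Qed.


End Value.

(** * Essential surjectivity *)

Lemma linear_homog_ext (k : fieldType) (V : gvect k) (W : lmodType k) (f g : V -> W) :
  linear f -> linear g -> (forall d v, homog d v -> f v = g v) -> f =1 g.
Proof.
move=> fL gL fg v; have [s [_ ->]] := gcomp_sum v.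
rewrite (linear_sum_ fL) (linear_sum_ gL); apply: eq_bigr => d _; apply: (fg d).
by rewrite /homog gcomp_proj eqxx.
Qed.

(** A degree 0 map commutes with the projections to the homogeneous components, so its inverse also
    has degree 0. Compatibility of the inverse with the structure is checked after applying [f]. *)
Lemma mo_mor_isom (k : fieldType) (M N : ModularOperads k) (f : hom M N)
    (f' : forall S g, mspace (N : modular_operad k) S g -> mspace (M : modular_operad k) S g) :
  (forall S g, cancel ((f : modular_operad_mor _ _) S g) (f' S g)) ->
  (forall S g, cancel (f' S g) ((f : modular_operad_mor _ _) S g)) -> is_isom f.
Proof.
move: f f'; change ((forall (f : modular_operad_mor M N)
  (f' : forall S g, mspace (N : modular_operad k) S g -> mspace (M : modular_operad k) S g),
  (forall S g, cancel (f S g) (f' S g)) -> (forall S g, cancel (f' S g) (f S g)) ->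
  is_isom (C := ModularOperads k) f)).
move=> f f' fK f'K.
have lin S g : linear (f' S g).
  by move=> a x y; apply: (can_inj (fK S g)); rewrite gmap_linear !f'K.
have hom' S g d v : homog d v -> homog d (f' S g v).
  move=> vd; rewrite /homog; have [s [us e]] := gcomp_sum (f' S g v).
  have fc c x : f S g (gcomp c x) = gcomp c (f S g x).
    apply: (linear_homog_ext (f := fun x => f S g (gcomp c x)) (g := fun x => gcomp c (f S g x))).
    - by move=> a u w; rewrite gcomp_linear gmap_linear.
    - by move=> a u w; rewrite gmap_linear gcomp_linear.
    move=> d' u ud; have fu := gmap_homog (f S g) ud.
    rewrite -{1}ud -fu !gcomp_proj; case: eqP => _; first by rewrite ud fu.
    exact: (linear0_ (@gmap_linear _ _ _ (f S g))).
  by apply: (can_inj (fK S g)); rewrite fc f'K.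
pose F S g := GMap (lin S g) (hom' S g).
have F1 (S S' : finType) g g' (b : bij S S') (e : g = g') x :
    F S' g' (mact N b e x) = mact M b e (F S g x).
  by apply: (can_inj (fK S' g')); rewrite mmor_natural /= !f'K.
have F2 (S1 S2 : finType) g1 g2 (x : mspace N (option S1) g1) (y : mspace N (option S2) g2) :
    F _ _ (circ x y) = circ (F _ _ x) (F _ _ y).
  by apply: (can_inj (fK _ _)); rewrite mmor_circ /= !f'K.
have F3 (S : finType) g (x : mspace N (option (option S)) g) :
    F _ _ (contr N S g x) = contr M S g (F _ _ x).
  by apply: (can_inj (fK _ _)); rewrite mmor_contr /= !f'K.
exists (ModularOperadMor F1 F2 F3); split; apply: modular_operad_morP => S g x /=.
  exact: fK.
exact: f'K.
Qed.

Section Comparison.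
Variables (k : fieldType) (M : modular_operad k).
Local Notation G := (mo_algebra M).

Lemma wpacked_contr (H : finType) (h0 : H) fl lg (w : seq H) (p : pt G) h h' : gok fl lg [:: (w, p)] ->
  h \in w -> h' \in w -> h != h' -> fl h = h' ->
  (forall x, x \in w -> x != h -> x != h' -> fl x = x) -> homog_pt p ->
  wpacked h0 lg (gval fl lg [:: (w, p)]) = pcontr h h' (wpacked h0 w p).
Proof.
move=> [T r] h1 h2 hh' fh fx [d pd].
have n1 : nv T = 1%N by rewrite -(rds_size r).
have T0 : (0 < nv T)%N by rewrite n1.
pose v0 := Ordinal T0; have vE v : v = v0 by apply: ord_eq1.
case: (r) => -[l rl] fit.
have mE := reads_mem rl; have [li lf _ _ _] := rl.
have [i iE] : exists i, h = l i by apply/mE; rewrite /= cats0.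
have [i' iE'] : exists i', h' = l i' by apply/mE; rewrite /= cats0.
have fi : flip i = i' by apply: li; rewrite lf -iE fh.
have fi' : flip i' = i by rewrite -fi flipK.
have ii' : i != i' by apply: contra hh' => /eqP e; rewrite iE iE' e.
have i'i : i' != i by rewrite eq_sym.
have dh u : pthomog d (nth pt0 (unzip2 [:: (w, p)]) u).
  by case: u => [|u] //=; rewrite nth_nil; exact: homog0.
rewrite (wpacked_alR h0 (d := fun=> d) (t := Contr i i' (Leaf v0)) rl fit) //.
- rewrite -[pv _ _ _]/(pcontr i i' (pack (decorate (inp T [:: p]) v0))).
  rewrite prelabel_pcontr //.
  + by rewrite (wpacked_decorate h0 v0 rl fit) -iE -iE'.
  + by rewrite /= inE [att i]vE.
  + by rewrite /= inE [att i']vE.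
- by rewrite /= !inE fi ii' [att i]vE [att i']vE !eqxx.
- by apply/setP => v; rewrite /= !inE [v]vE eqxx.
- apply/setP => x; rewrite /= !inE [att x]vE eqxx andbT.
  have [->|xi] := eqVneq x i; first by rewrite fi (negbTE i'i) andbF.
  have [->|xi'] := eqVneq x i'; first by rewrite fi' (negbTE ii').
  apply/esym/eqP/li; rewrite lf; apply: fx; rewrite ?iE ?iE' ?(inj_eq li) //.
  have : l x \in flatten (unzip1 [:: (w, p)]) by apply/mE; exists x.
  by rewrite /= cats0.
Qed.

(** Since [car G S g] unfolds to the space of [M] at the ordinal with [#|S|] elements, the
    comparison map is transport along the enumeration of [S]. *)
Definition eta (S : finType) g : gmap (mspace M S g) (car G S g) :=
  mact M (bij_rank S) (erefl g).

Lemma wpacked_eta (S H : finType) (h0 : H) (l : S -> H) g (x : mspace M S g) : injective l ->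
  wpacked h0 (map l (enum S)) (mkpt (eta S g x)) = pk l x.
Proof.
move=> li.
have lE (i : 'I_#|S|) : nth h0 (map l (enum S)) (nat_of_ord i) = l (enum_val i).
  rewrite (nth_map (enum_val i) h0 l); last by rewrite -cardE; exact: ltn_ord.
  by rewrite -enum_val_nth.
rewrite /wpacked /= (@pk_label_ext _ _ _ _ _ (l \o enum_val)) //.
apply: pk_mact => [|s]; first exact: inj_comp li enum_val_inj.
by rewrite /= enum_rankK.
Qed.

Lemma eta_surj (S : finType) g (y : car G S g) : exists x, y = eta S g x.
Proof.
pose b' : bij 'I_#|S| S := Bij (@enum_valK S) (@enum_rankK S).
exists (mact M b' (erefl g) y).
by rewrite /eta mact_comp mact_id // => i; rewrite /= enum_valK.
Qed.

Lemma wpacked_inj (S H : finType) (h0 : H) (l : S -> H) g (x y : car G S g) : injective l ->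
  wpacked h0 (map l (enum S)) (mkpt x) = wpacked h0 (map l (enum S)) (mkpt y) -> x = y.
Proof.
move=> li; have [x' ->] := eta_surj x; have [y' ->] := eta_surj y.
by rewrite !wpacked_eta // => /(pk_inj li) ->.
Qed.

Lemma homog_mkpt c d (x : G c) : homog d x -> homog_pt (mkpt x).
Proof. by exists d. Qed.

Lemma eta_homog (S : finType) g d (x : mspace M S g) : homog d x -> homog_pt (mkpt (eta S g x)).
Proof. by move=> /(gmap_homog (eta S g)); exact: homog_mkpt. Qed.

(** On the right [f] acts through the value of a corolla in the algebra, on the left through the
    functor [M]. After [wpacked] both become [x] with labels renamed along [f], at first for
    homogeneous [x]. *)
Lemma eta_natural (S S' : finType) g g' (f : bij S S') (e : g = g') (x : mspace M S g) :
  eta S' g' (mact M f e x) = fmapA f e (eta S g x).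
Proof.
pose gm := gmapA G f e.
move: x; apply: linear_homog_ext.
- by move=> a x y; rewrite !gmap_linear.
- by move=> a x y; rewrite gmap_linear -[LHS]/(gm _) (gmap_linear gm).
move=> d x xd.
have si : injective (@Some S') by move=> ? ? [].
have fi := @bij_inj _ _ f.
have pf : perm_eq (map (Some \o f) (enum S)) (map Some (enum S')) by exact: perm_map_bij.
apply: (@wpacked_inj S' _ None Some) => //.
rewrite (wpacked_eta None _ si) -(rd_self (fmapA f e (eta S g x)) si) rd_fmapA // /rd.
rewrite wpacked_act //; last exact: eta_homog xd.
- rewrite (wpacked_eta None _ (inj_comp si fi)).
  exact: pk_mact.
- exact: uniq_map_enum (inj_comp si fi).
- by rewrite (size_map (Some \o f)) car_fit.
Qed.

(** As packed elements both sides are [x] and [y] glued along their added points: the value of the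
    joining edge is computed by [wpacked_circ], and [pcirc_pk] recognizes [circ] in it. *)
Lemma eta_circ (S1 S2 : finType) g1 g2 (x : mspace M (option S1) g1) (y : mspace M (option S2) g2) :
  eta _ _ (circ x y) = circA (eta _ _ x) (eta _ _ y).
Proof.
move: x; apply: linear_homog_ext.
- by move=> a x x'; rewrite circ_linearl gmap_linear.
- by move=> a x x'; rewrite gmap_linear circA_linearl.
move=> d x xd; move: y; apply: linear_homog_ext.
- by move=> a y y'; rewrite circ_linearr gmap_linear.
- by move=> a y y'; rewrite gmap_linear circA_linearr.
move=> e y ye.
apply: (@wpacked_inj _ _ (inl None) (csum (S1:=S1) (S2:=S2))); first exact: csum_inj.
rewrite (wpacked_eta _ _ (@csum_inj S1 S2)) mkpt_circA /cds.
rewrite (@wpacked_circ _ _ _ _ _ _ _ _ _ _ (inl None) (inr None)) //; first last.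
- exact: eta_homog ye.
- exact: eta_homog xd.
- by case=> [[s|]|[s|]].
- by rewrite mem_inr.
- by rewrite mem_inl.
- exact: cds_ok.
have il : injective (@inl (option S1) (option S2)) by move=> ? ? [].
have ir : injective (@inr (option S1) (option S2)) by move=> ? ? [].
rewrite (wpacked_eta _ _ il) (wpacked_eta _ _ ir).
rewrite -(@pk_label_ext _ _ _ _ (lopt (inl None) (inl \o Some)) inl); last by case.
rewrite -(@pk_label_ext _ _ _ _ (lopt (inr None) (inr \o Some)) inr); last by case.
rewrite pcirc_pk; try by inj_cases.
by apply: pk_label_ext; case.
Qed.

Lemma eta_contr (S : finType) g (x : mspace M (option (option S)) g) :
  eta _ _ (contr M S g x) = contrA (eta _ _ x).
Proof.
move: x; apply: linear_homog_ext.
- by move=> a x x'; rewrite !gmap_linear.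
- by move=> a x x'; rewrite gmap_linear contrA_linear.
move=> d x xd.
apply: (@wpacked_inj _ _ None (ksome (S:=S))); first exact: ksome_inj.
rewrite (wpacked_eta _ _ (@ksome_inj S)) mkpt_contrA /kds.
rewrite (@wpacked_contr _ _ _ _ _ _ None (Some None)) //; first last.
- exact: eta_homog xd.
- by case=> [[s|]|].
- by rewrite mem_enum.
- by rewrite mem_enum.
- exact: kds_ok.
rewrite -[X in wpacked _ X _]map_id (wpacked_eta _ _ (@inj_id _)).
rewrite -(@pk_label_ext _ _ _ _ (lopt None (lopt (Some None) (ksome (S:=S)))) id); last by case=> [[]|].
by rewrite pcontr_pk //; inj_cases.
Qed.

Definition eta_mor : modular_operad_mor M (operad_of G) :=
  @ModularOperadMor k M (operad_of G) eta eta_natural eta_circ eta_contr.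

Lemma eta_isom : is_isom (C := ModularOperads k) eta_mor.
Proof.
pose b' (S : finType) : bij 'I_#|S| S := Bij (@enum_valK S) (@enum_rankK S).
apply: (@mo_mor_isom k M (operad_of G) eta_mor (fun S g => mact M (b' S) (erefl g))) => S g x.
  by rewrite /= /eta mact_comp mact_id // => s; rewrite /= enum_rankK.
by rewrite /= /eta mact_comp mact_id // => i; rewrite /= enum_valK.
Qed.
End Comparison.

Theorem proposition5p11 (k : fieldType) (hk : [pchar k] =i pred0) :
  equivalent_categories (TerminalAlgebras k) (ModularOperads k).
Proof.
apply: (@fully_faithful_equivalence _ _ (operad_functor k)).
- by move=> A B phi; exists (amor_of phi); exact: operad_functor_full.
- by move=> A B f f'; exact: operad_functor_faithful.
move=> M; exists (mo_algebra M); have [e [e1 e2]] := eta_isom M.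
by exists e; exists (eta_mor M).
Qed.
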